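(* Let $d\ge3$, $T>0$ and let $(u,f)\in\mathcal N(Q_T)$ be such that $f\in L^p(0,T;H^{-2+\frac2p}(\mathbb T^d))$ for some $1\le p\le2$. Then the anomalous work vanishes: $\overline{\mathbf\Phi}=0$. Moreover, if in addition $u\in C([0,T];L^2(\mathbb T^d))$, then $\overline\Pi=\overline{\mathbf\Phi}=0$.
   Context: $\mathbb T^d$ is the $d$-dimensional ($2\pi$-periodic) torus, $Q_T=\mathbb T^d\times(0,T)$, $\langle\cdot,\cdot\rangle$ is the $L^2(\mathbb T^d)$ inner product. The forced Navier-Stokes equations (NSE) are $\partial_t u-\Delta u+\operatorname{div}(u\otimes u)+\nabla p=f$, $\operatorname{div}u=0$, with velocity $u$, pressure $p$, force $f$. $\mathcal L(0,T)$ is the set of $g\in L^1_{loc}(0,T)$ such that $\lim_{a\to0^+,\,b\to T^-}\int_a^b g\,dt$ exists (as a finite limit); integrals of such $g$ up to the endpoints are understood as these limits. Class $\mathcal N(Q_T)$ (smooth solutions with finite energy input): pairs $(u,f)$ such that (i) $u\in C^\infty(Q_T)\cap L^\infty(0,T;L^2(\mathbb T^d))$ and $f\in C^\infty(Q_T)$; (ii) $u,f$ satisfy the NSE (with some pressure $p$) at every point of $Q_T$; (iii) $\langle u,f\rangle\in\mathcal L(0,T)$; (iv) the limits of $f(t)$ exist in $\mathcal D'(\mathbb T^d)$ as $t\to0^+$ and $t\to T^-$. For $(u,f)\in\mathcal N(Q_T)$ the weak $L^2$ limits of $u(t)$ as $t\to0^+$ and $t\to T^-$ exist, and $u(0)$,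 $u(T)$ always denote these weak limits. Littlewood-Paley cutoff: fix a radially non-increasing $\chi\in C_c^\infty(\mathbb R^d)$ with $\chi(\xi)=1$ for $|\xi|\le 1/2$ and $\chi(\xi)=0$ for $|\xi|\ge1$; $u_{\le q}$ is the Fourier multiplier with symbol $\chi(2^{-(q+1)}\xi)$ applied to $u$. Anomalous dissipation and anomalous work (at time $T$): $$\overline\Pi=\limsup_{q\to\infty}\Big|\int_{T/2}^T\langle(u\cdot\nabla u)_{\le q},u_{\le q}\rangle\,dt\Big|,\qquad \overline{\mathbf\Phi}=\limsup_{q\to\infty}\Big|\int_{T/2}^T\big(\langle u_{\le q},f_{\le q}\rangle-\langle u,f\rangle\big)\,dt\Big| .$$ *)

(* Defs.v *)
From HB Require Import structures.
From mathcomp Require Import all_boot all_order all_algebra.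
From mathcomp Require Import complex.
From mathcomp Require Import all_classical all_reals all_analysis.

Set Implicit Arguments.
Unset Strict Implicit.
Unset Printing Implicit Defensive.

Import Order.TTheory GRing.Theory Num.Theory.
Import numFieldNormedType.Exports.

Local Open Scope classical_set_scope.
Local Open Scope ring_scope.

(* Functions on the torus T^d are 2pi-periodic functions on 'rV[R]_d. The norm
   carried by 'rV[R]_d in the library is the sup norm, hence [enorm]. *)
Section torus.
Context {R : realType}.

Definition dot d (x y : 'rV[R]_d) : R := \sum_i x 0 i * y 0 i.

Definition enorm d (x : 'rV[R]_d) : R := Num.sqrt (dot x x).

Definition basis_vec d (i : 'I_d) : 'rV[R]_d := delta_mx 0 i.

Definition torus_fun (V : Type) d (g : 'rV[R]_d -> V) : Prop :=
  forall x i, g (x + (pi *+ 2) *: basis_vec i) = g x.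

Local Notation mR := (measurableTypeR R).

Definition circle : set mR := `[0, pi *+ 2[.

Lemma measurable_circle : measurable circle.
Proof. exact: measurable_itv. Qed.

Lemma circle_lty : (lebesgue_measure circle < +oo)%E.
Proof. by rewrite /circle lebesgue_measure_itv /=; case: ifP => _; rewrite ltry. Qed.

Definition circle_measure : {finite_measure set mR -> \bar R} :=
  @mfrestr _ mR R circle lebesgue_measure measurable_circle circle_lty.

Definition tuple_cons d (z : mR * d.-tuple mR) : d.+1.-tuple mR :=
  [tuple of z.1 :: z.2].

Lemma measurable_tuple_cons d : measurable_fun setT (@tuple_cons d).
Proof. exact: (measurable_cons measurable_fst measurable_snd). Qed.

Section measure_cons.
Variables (d : nat) (mu : {finite_measure set (d.-tuple mR) -> \bar R}).

Definition measure_cons : set (d.+1.-tuple mR) -> \bar R :=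
  pushforward (circle_measure \x mu)%E (@tuple_cons d).

Let measurable_pre (A : set (d.+1.-tuple mR)) :
  measurable A -> measurable (@tuple_cons d @^-1` A).
Proof. by move=> mA; rewrite -[X in measurable X]setTI; exact: measurable_tuple_cons. Qed.

Let measure_cons0 : measure_cons set0 = 0%E.
Proof. by rewrite /measure_cons /pushforward preimage_set0 measure0. Qed.

Let measure_cons_ge0 A : (0 <= measure_cons A)%E.
Proof. by rewrite /measure_cons /pushforward measure_ge0. Qed.

Let measure_cons_sigma_additive : semi_sigma_additive measure_cons.
Proof.
move=> F mF tF mUF; rewrite /measure_cons /pushforward preimage_bigcup.
apply: measure_semi_sigma_additive.
- by move=> n; exact: measurable_pre.
- apply/trivIsetP => /= i j _ _ ij; rewrite -preimage_setI.
  by move/trivIsetP : tF => /(_ _ _ _ _ ij) ->//; rewrite preimage_set0.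
- by rewrite -preimage_bigcup; exact: measurable_pre.
Qed.

HB.instance Definition _ := isMeasure.Build _ _ _ measure_cons
  measure_cons0 measure_cons_ge0 measure_cons_sigma_additive.

Let measure_cons_fin : fin_num_fun measure_cons.
Proof.
apply: lty_fin_num_fun.
rewrite [X in (X < _)%E](_ : _ = (circle_measure \x mu)%E (setT `*` setT)); last first.
  by rewrite setXTT.
rewrite product_measure1E//.
by rewrite -ge0_fin_numE ?mule_ge0 // fin_numM ?fin_num_measure.
Qed.

HB.instance Definition _ :=
  Measure_isFinite.Build _ _ _ measure_cons measure_cons_fin.
End measure_cons.

(* Lebesgue measure of the fundamental domain [0, 2pi[^d, as the d-fold product
   measure on d.-tuple R, whose sigma-algebra is the product one. *)
Fixpoint torus_measure d : {finite_measure set (d.-tuple mR) -> \bar R} :=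
  match d with
  | 0 => \d_([tuple])
  | d'.+1 => measure_cons (torus_measure d')
  end.

Section functions_on_the_torus.
Variable d : nat.
Local Notation T := 'rV[R]_d.
Local Notation field := (T -> T).

Definition vec_of_tuple (x : d.-tuple mR) : T := \row_i tnth x i.

Definition torus_int (g : T -> R) : R :=
  \int[torus_measure d]_x g (vec_of_tuple x).

Definition inner (v w : field) : R := torus_int (fun x => dot (v x) (w x)).

Definition L2norm (w : field) : \bar R :=
  ('N[torus_measure d]_2%:E[(fun x => (enorm (w (vec_of_tuple x)))%:E)])%E.

Definition inL2 (w : field) : Prop := torus_fun w /\
  forall i, (fun x : d.-tuple mR => w (vec_of_tuple x) 0 i)
              \in Lfun (torus_measure d) 2%:E.

Definition freq (k : 'rV[int]_d) : T := map_mx intr k.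

(* [fourier_mode k x] is e^{i k.x} *)
Definition fourier_mode (k : 'rV[int]_d) (x : T) : R[i] :=
  Complex (cos (dot (freq k) x)) (sin (dot (freq k) x)).

Definition fourier_coef (g : T -> R) (k : 'rV[int]_d) : R[i] :=
  let e x := fourier_mode k x in
  Complex ((pi *+ 2) ^- d * torus_int (fun x => g x * complex.Re (e x)))
          (- ((pi *+ 2) ^- d * torus_int (fun x => g x * complex.Im (e x)))).

Definition sqmod (z : R[i]) : R := complex.Re z ^+ 2 + complex.Im z ^+ 2.

Definition Hs_norm (s : R) (w : field) : \bar R :=
  ((\esum_(k in [set: 'rV[int]_d])
     ((1 + dot (freq k) (freq k)) `^ s *
      \sum_i sqmod (fourier_coef (fun x => w x 0 i) k))%:E) `^ 2^-1)%E.

(* The sum over k has finite support when chi vanishes for |xi| >= 1, and its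
   value is real when chi is even; [complex.Re] only changes its type. *)
Definition lowpass_scal (chi : T -> R) (q : nat) (g : T -> R) : T -> R :=
  fun x => complex.Re (\sum_(k \in [set: 'rV[int]_d])
    Complex (chi (2 ^- q.+1 *: freq k)) 0 * fourier_coef g k * fourier_mode k x).

Definition lowpass (chi : T -> R) (q : nat) (w : field) : field :=
  fun x => \row_i lowpass_scal chi q (fun y => w y 0 i) x.

Definition partial (i : 'I_d) (g : T -> R) : T -> R := 'D_(basis_vec i) g.

(* w . grad w *)
Definition advection (w : field) : field :=
  fun x => \row_i \sum_j w x 0 j * partial j (fun y => w y 0 i) x.

End functions_on_the_torus.

Fixpoint Ck_on (V W : normedModType R) (A : set V) (k : nat) (f : V -> W) : Prop :=
  (forall x, A x -> {for x, continuous f}) /\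
  match k with
  | 0 => True
  | k'.+1 => forall v, (forall x, A x -> derivable f x v) /\ Ck_on A k' ('D_v f)
  end.

Definition smooth_on (V W : normedModType R) (A : set V) (f : V -> W) : Prop :=
  forall k, Ck_on A k f.

Section distributions.
Variable d : nat.
Local Notation T := 'rV[R]_d.

Definition test_fun (phi : T -> R) : Prop := torus_fun phi /\ smooth_on setT phi.

Definition iter_partial (s : seq 'I_d) (phi : T -> R) : T -> R :=
  foldr (@partial d) phi s.

(* Continuity for the topology of C^oo(T^d), which is given by the sup norms of
   the iterated partial derivatives. *)
Definition distribution (F : (T -> R) -> R) : Prop :=
  (forall (a : R) phi psi, test_fun phi -> test_fun psi ->
     F (fun x => a * phi x + psi x) = a * F phi + F psi) /\
  exists N C, forall phi M, test_fun phi ->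
    (forall s x, (size s <= N)%N -> `|iter_partial s phi x| <= M) ->
    `|F phi| <= C * M.

(* Componentwise, for a time-dependent vector field. *)
Definition has_limit_D' (f : R -> T -> T) (G : set_system R) : Prop :=
  forall i : 'I_d, exists2 F, distribution F &
    forall phi, test_fun phi ->
      torus_int (fun x => f t x 0 i * phi x) @[t --> G] --> F phi.

End distributions.

Section time.
Variable tau : R.

Definition in_calL (g : R -> R) : Prop :=
  locally_integrable `]0, tau[ g /\
  exists l : R, (fun ab : R * R => \int[lebesgue_measure]_(t in `[ab.1, ab.2]) g t)
    @ (0^'+, tau^'-) --> l.

(* Integrals up to the endpoint tau are limits. [lim] is total, with an
   arbitrary value when the limit does not exist; for pairs in [class_N] the
   limits used below do exist. *)
Definition int_to_end (a : R) (g : R -> R) : R :=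
  lim ((\int[lebesgue_measure]_(t in `[a, b]) g t) @[b --> tau^'-]).

Section fields.
Variable d : nat.
Local Notation T := 'rV[R]_d.
Implicit Types u f : R -> T -> T.

Definition smooth_QT u : Prop :=
  (forall t, 0 < t < tau -> torus_fun (u t)) /\
  smooth_on (`]0, tau[ `*` [set: T]) (fun z : R * T => u z.1 z.2).

Definition Linfty_L2 u : Prop :=
  exists C : R,
    {ae lebesgue_measure, forall t, 0 < t < tau -> (L2norm (u t) <= C%:E)%E}.

(* Only the first-order derivatives of the pressure appearing in the equation
   are required to exist. *)
Definition NSE u f : Prop :=
  exists p : R -> T -> R, forall t, 0 < t < tau ->
  [/\ torus_fun (p t),
      forall x i, derivable (p t) x (basis_vec i),
      forall x i,
        derive1 (fun s => u s x 0 i) t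
        - \sum_j partial j (partial j (fun y => u t y 0 i)) x
        + \sum_j partial j (fun y => u t y 0 j * u t y 0 i) x
        + partial i (p t) x
        = f t x 0 i
    & forall x, \sum_j partial j (fun y => u t y 0 j) x = 0].

Definition class_N u f : Prop :=
  [/\ [/\ smooth_QT u, Linfty_L2 u & smooth_QT f],
      NSE u f,
      in_calL (fun t => inner (u t) (f t))
    & has_limit_D' f 0^'+ /\ has_limit_D' f tau^'-].

Definition Lp_Hs (p s : R) f : Prop :=
  (\int[lebesgue_measure]_(t in `]0%R, tau[) (Hs_norm s (f t) `^ p) < +oo)%E.

Definition weakL2_cvg u (G : set_system R) (w : T -> T) : Prop :=
  inL2 w /\ forall phi, inL2 phi -> inner (u t) phi @[t --> G] --> inner w phi.

(* [v] is u extended to [0, tau] by its weak L^2 limits u(0) and u(tau). *)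
Definition continuous_L2 u : Prop :=
  exists v : R -> T -> T,
  [/\ forall t, 0 < t < tau -> v t = u t,
      weakL2_cvg u 0^'+ (v 0),
      weakL2_cvg u tau^'- (v tau)
    & forall t, 0 <= t <= tau ->
      L2norm (fun x => v s x - v t x) @[s --> within `[0, tau] (nbhs t)] --> 0%E].

Definition anomalous_dissipation (chi : T -> R) u : \bar R :=
  limn_esup (fun q => `|int_to_end (tau / 2) (fun t =>
    inner (lowpass chi q (advection (u t))) (lowpass chi q (u t)))|%:E).

Definition anomalous_work (chi : T -> R) u f : \bar R :=
  limn_esup (fun q => `|int_to_end (tau / 2) (fun t =>
    inner (lowpass chi q (u t)) (lowpass chi q (f t)) - inner (u t) (f t))|%:E).

End fields.
End time.

(* Monotonicity in |xi| includes radiality, and vanishing for |xi| >= 1 includes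
   compact support. *)
Definition LP_cutoff d (chi : 'rV[R]_d -> R) : Prop :=
  [/\ smooth_on setT chi,
      forall xi eta, enorm xi <= enorm eta -> chi eta <= chi xi,
      forall xi, enorm xi <= 2^-1 -> chi xi = 1
    & forall xi, 1 <= enorm xi -> chi xi = 0].

End torus.

(* Main.v *)
Require Import Defs.
From mathcomp Require Import all_boot all_order all_algebra.
From mathcomp Require Import complex.
From mathcomp Require Import all_classical all_reals all_analysis.
From mathcomp Require Import measurable_realfun.
From mathcomp Require Import ring lra zify.

Import Order.TTheory GRing.Theory Num.Theory.
Import numFieldNormedType.Exports.
Local Open Scope classical_set_scope.
Local Open Scope ring_scope.
Set Implicit Arguments.
Unset Strict Implicit.
Unset Printing Implicit Defensive.

(** Why the theorem is true.

    Let [D_q] be the high-frequency part of the L^2 product: the value of [D_q] at two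
    fields is their L^2 product minus the L^2 product of their low-frequency parts.
    It is a Fourier multiplier form with symbol [1 - chi^2], which lies between 0 and 1
    and tends to 0 at each frequency. Hence it is symmetric and nonnegative, it is
    bounded by the L^2 product, derivatives can be integrated by parts in it, and by
    Parseval's identity it tends to 0 at any two fixed continuous fields.

    The integrand of the anomalous work is [- D_q(f, u)], so that the first claim is a
    matter of dominated convergence. The energy equality and the existence of the limit
    of the energy input bound the energy of [u] and the integral of its dissipation
    [G = |grad u|^2] up to the final time ([energy_bounds]). The majorant is
    [1 + G + F^p], where [F] is the norm of [f] in [H^(-s)] with [s = 2 - 2/p], which
    is integrable by assumption. It dominates because [s] lies between 0 and 1:
    interpolation between the energy and the dissipation bounds the norm of [u] in
    [H^s] by [(1 + G)^(s/2)] up to a constant ([sobolev_bessel]), duality bounds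
    [D_q(f, u)] by the product of the two norms ([defect_dual_bound]), and
    [s/2 = 1 - 1/p] is exactly the power for which Young's inequality yields the
    majorant ([critical_scaling], [work_defect_bound]).

    For the dissipation, the balance of [D_q(u, u)] is obtained like that of the
    energy: the pressure drops out because its gradient is orthogonal to divergence-free
    fields also for [D_q]. As [u . grad u] is orthogonal to [u] in L^2, the flux through
    the cutoff is, up to sign, the advection term of this balance, hence the sum of three
    terms: half the change of [D_q(u, u)] over the time interval, the integral of the
    dissipation measured by [D_q], and minus the integral of [D_q(f, u)]
    ([lp_flux_balance]). The last one tends to 0 by the first claim, and the second one
    by domination by [G]. In the first one the initial value tends to 0 since it is
    taken at a fixed time. For the final value, strong continuity makes [u(t)] a Cauchy
    family in L^2 as [t] tends to the final time, so that [D_q(u(t), u(t))] has a limit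
    and is close, uniformly in [q], to its value at a fixed earlier time. *)

Section torus_functions.
Context {R : realType}.

(** * Periodic functions and measurability on the torus *)

Lemma torus_fun_shift V d (g : 'rV[R]_d -> V) (n : 'rV[int]_d) x :
  torus_fun g -> g (x + (pi *+ 2) *: freq n) = g x.
Proof.
move=> tg.
have gn i (k : nat) y : g (y + k%:R *: ((pi *+ 2) *: basis_vec i)) = g y.
  elim: k y => [|k IH] y; first by rewrite scale0r addr0.
  by rewrite -natr1 scalerDl addrA scale1r tg IH.
have gz i (k : int) y : g (y + k%:~R *: ((pi *+ 2) *: basis_vec i)) = g y.
  case: k => k; first exact: gn.
  rewrite NegzE mulrNz scaleNr.
  by rewrite -[in RHS](subrK (k.+1%:R *: ((pi *+ 2) *: basis_vec i)) y) gn.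
have -> : (pi *+ 2) *: freq n = \sum_i (n 0 i)%:~R *: ((pi *+ 2) *: basis_vec i) :> 'rV[R]_d.
  apply/rowP => j; rewrite summxE (bigD1 j)//= big1 ?addr0; last first.
    by move=> i ij; rewrite !mxE eqxx eq_sym (negbTE ij) !mulr0.
  by rewrite !mxE !eqxx mulr1 mulrC.
elim: (index_enum _) x => [|i s IH] x; first by rewrite big_nil addr0.
by rewrite big_cons addrA IH gz.
Qed.

Definition torus_rep d (x : 'rV[R]_d) : 'rV[R]_d :=
  x - (pi *+ 2) *: freq (\row_i Num.floor (x 0 i / (pi *+ 2))).

Lemma pi2_gt0 : 0 < pi *+ 2 :> R.
Proof. by rewrite pmulrn_lgt0 ?pi_gt0. Qed.

Lemma torus_rep_itv d (x : 'rV[R]_d) i : 0 <= torus_rep x 0 i <= pi *+ 2.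
Proof.
rewrite !mxE; have := floor_itv (x 0 i / (pi *+ 2)).
rewrite ler_pdivlMr ?pi2_gt0// ltr_pdivrMr ?pi2_gt0// => /andP[h1 h2].
by move: h2; rewrite intrD mulrDl; lra.
Qed.

Lemma torus_repE V d (g : 'rV[R]_d -> V) x : torus_fun g -> g (torus_rep x) = g x.
Proof.
move=> tg; rewrite /torus_rep -[in RHS](subrK ((pi *+ 2) *: freq (\row_i Num.floor (x 0 i / (pi *+ 2)))) x).
by rewrite (torus_fun_shift _ _ tg).
Qed.

Lemma cvg_row d (T : Type) (F : set_system T) (f : T -> 'rV[R]_d) (l : 'rV[R]_d) :
  Filter F -> (forall i, f x 0 i @[x --> F] --> l 0 i) -> f x @[x --> F] --> l.
Proof.
move=> FF h; apply/cvg_ballP => e e0; near=> t; split=> // i j.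
rewrite (ord1 i); move: j; near: t; apply: filter_forall => j.
by have /cvg_ballP/(_ e e0) := h j.
Unshelve. all: end_near. Qed.

Definition row_cons d (s : R) (y : 'rV[R]_d) : 'rV[R]_d.+1 :=
  \row_i (if unlift ord0 i is Some j then y 0 j else s).

Lemma row_cons0 d s (y : 'rV[R]_d) : row_cons s y 0 ord0 = s.
Proof. by rewrite mxE unlift_none. Qed.

Lemma row_consS d s (y : 'rV[R]_d) j : row_cons s y 0 (lift ord0 j) = y 0 j.
Proof. by rewrite mxE liftK. Qed.

Lemma vec_of_tuple_cons d z :
  vec_of_tuple (@tuple_cons R d z) = row_cons z.1 (vec_of_tuple z.2).
Proof.
apply/rowP => i; have [j ->|->] := unliftP ord0 i.
  by rewrite row_consS !mxE tnthS.
by rewrite row_cons0 mxE tnth0.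
Qed.

Lemma cvg_row_cons d T (F : set_system T) {FF : Filter F} (f : T -> R)
    (g : T -> 'rV[R]_d) s y :
  f x @[x --> F] --> s -> g x @[x --> F] --> y ->
  row_cons (f x) (g x) @[x --> F] --> row_cons s y.
Proof.
move=> fs gy; apply: cvg_row => i.
have [j ->|->] := unliftP ord0 i.
  rewrite row_consS; under eq_fun do rewrite row_consS.
  by apply: (@continuous_cvg _ _ _ F _ g (fun M : 'rV[R]_d => M 0 j) y _ gy); exact: coord_continuous.
by rewrite row_cons0; under eq_fun do rewrite row_cons0.
Qed.

Lemma row_consDl d s h (y : 'rV[R]_d) :
  row_cons (s + h) y = row_cons s y + h *: basis_vec ord0.
Proof.
apply/rowP => i; have [j ->|->] := unliftP ord0 i; rewrite [RHS]mxE.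
  by rewrite !row_consS !mxE /= mulr0 addr0.
by rewrite !row_cons0 !mxE /= mulr1.
Qed.

Lemma row_consDr d s h (y : 'rV[R]_d) j :
  row_cons s (y + h *: basis_vec j) = row_cons s y + h *: basis_vec (lift ord0 j).
Proof.
apply/rowP => i; have [k ->|->] := unliftP ord0 i; rewrite [RHS]mxE.
  by rewrite !row_consS !mxE /= (inj_eq lift_inj).
by rewrite !row_cons0 !mxE /= mulr0 addr0.
Qed.

Local Notation mR := (measurableTypeR R).

(** The sigma-algebra of the tuples is generated by the coordinates, so that an open set
must be written as a countable union of boxes with rational centres. *)
Lemma measurable_vec_open d (U : set 'rV[R]_d) :
  open U -> measurable (@vec_of_tuple R d @^-1` U).
Proof.
move=> oU.
pose box (q : 'rV[rat]_d * nat) : set 'rV[R]_d :=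
  [set x | forall i, `|x 0 i - ratr (q.1 0 i)| < q.2.+1%:R^-1].
pose F q := if `[< box q `<=` U >] then @vec_of_tuple R d @^-1` box q else set0.
rewrite (_ : _ @^-1` U = \bigcup_q F q).
  apply: countable_bigcupT_measurable => // q; rewrite /F; case: ifPn => // _.
  rewrite (_ : _ @^-1` _ = \bigcap_(i in [set: 'I_d])
     ((fun t : d.-tuple mR => tnth t i) @^-1` ball (ratr (q.1 0 i) : R) q.2.+1%:R^-1)).
    apply: fin_bigcap_measurable => // i _.
    by rewrite -[X in measurable X]setTI; apply: measurable_tnth => //; exact: measurable_ball.
  apply/seteqP; split=> t /=; first by move=> h i _; have := h i; rewrite mxE distrC.
  by move=> h i; have := h i Logic.I; rewrite mxE /ball/= distrC.
apply/seteqP; split=> t /=; last first.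
  by move=> [q _]; rewrite /F; case: ifPn => // /asboolP h /h.
move=> Ut.
have := oU; rewrite openE => /(_ _ Ut); rewrite /interior => /nbhs_ballP[e e0 he].
have [n _ hn] := near_infty_natSinv_lt (PosNum e0).
have {}hn : n.+1%:R^-1 < e by have := hn n (leqnn _).
pose r : R := (n.+1.*2)%:R^-1.
have r0 : 0 < r by rewrite invr_gt0.
have hr : r + r = n.+1%:R^-1.
  by rewrite /r -muln2 natrM invfM; move: (n.+1%:R^-1) => a; lra.
have ex i : exists q : rat, `|vec_of_tuple t 0 i - ratr q| < r.
  have := @rat_in_itvoo R (vec_of_tuple t 0 i - r) (vec_of_tuple t 0 i + r).
  case; first by lra.
  move=> q; rewrite in_itv/= => /andP[h1 h2]; exists q.
  by rewrite ltr_norml; apply/andP; split; lra.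
have [q hq] := choice ex.
exists (\row_i q i, (n.+1.*2).-1) => //; rewrite /F; case: ifPn => [_ i|/negP].
  by have := hq i; rewrite /= !mxE.
case; apply/asboolP => y hy; apply: he; split=> // i j; rewrite (ord1 i).
have := hy j; have := hq j; rewrite /= !mxE -/r => h1 h2.
rewrite /ball/= (le_lt_trans (ler_distD (ratr (q j)) _ _))//.
apply: lt_trans hn; rewrite -hr; apply: ltrD => //.
by rewrite distrC.
Qed.

Lemma measurable_vec d (g : 'rV[R]_d -> R) : continuous g ->
  measurable_fun setT (g \o @vec_of_tuple R d).
Proof.
move=> cg; apply: (measurability (@RGenOpens.G R)).
  exact: RGenOpens.measurableE.
move=> _ [_ [a [b ->] <-]]; rewrite setTI comp_preimage.
apply: measurable_vec_open; move/continuousP: cg; apply.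
exact: interval_open.
Qed.

(** * Integrals over the torus of continuous functions *)

Lemma cvg_sum_seq (T I : Type) (F : set_system T) (r : seq I) (P : pred I)
    (f : I -> T -> R) (l : I -> R) : Filter F ->
  (forall i, P i -> f i x @[x --> F] --> l i) ->
  \sum_(i <- r | P i) f i x @[x --> F] --> \sum_(i <- r | P i) l i.
Proof. by move=> FF h; apply: cvg_big => //; exact: add_continuous. Qed.

Definition torus_cont d (g : 'rV[R]_d -> R) := torus_fun g /\ continuous g.

Lemma torus_contD d (g h : 'rV[R]_d -> R) :
  torus_cont g -> torus_cont h -> torus_cont (fun x => g x + h x).
Proof.
move=> [tg cg] [th ch]; split; first by move=> x i; rewrite tg th.
by move=> x; exact: (cvgD (cg x) (ch x)).
Qed.

Lemma torus_contM d (g h : 'rV[R]_d -> R) :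
  torus_cont g -> torus_cont h -> torus_cont (fun x => g x * h x).
Proof.
move=> [tg cg] [th ch]; split; first by move=> x i; rewrite tg th.
by move=> x; exact: (cvgM (cg x) (ch x)).
Qed.

Lemma torus_cont_cst d c : torus_cont (fun _ : 'rV[R]_d => c).
Proof. by split; [|exact: cst_continuous]. Qed.

Lemma torus_contZ d c (g : 'rV[R]_d -> R) :
  torus_cont g -> torus_cont (fun x => c * g x).
Proof. by move=> cg; apply: torus_contM => //; exact: torus_cont_cst. Qed.

Lemma torus_contN d (g : 'rV[R]_d -> R) : torus_cont g -> torus_cont (fun x => - g x).
Proof.
by move=> [tg cg]; split; [move=> x i; rewrite tg|move=> x; exact: (cvgN (cg x))].
Qed.

Lemma torus_contB d (g h : 'rV[R]_d -> R) :
  torus_cont g -> torus_cont h -> torus_cont (fun x => g x - h x).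
Proof. by move=> cg ch; apply: torus_contD => //; exact: torus_contN. Qed.

Lemma torus_cont_sum d I (r : seq I) (P : pred I) (g : I -> 'rV[R]_d -> R) :
  (forall i, P i -> torus_cont (g i)) -> torus_cont (fun x => \sum_(i <- r | P i) g i x).
Proof.
move=> cg; elim: r => [|i r IH].
  by under eq_fun do rewrite big_nil; exact: torus_cont_cst.
under eq_fun do rewrite big_cons.
by case: (boolP (P i)) => // Pi; apply: torus_contD => //; exact: cg.
Qed.

Lemma torus_contX d n (g : 'rV[R]_d -> R) :
  torus_cont g -> torus_cont (fun x => g x ^+ n).
Proof.
move=> cg; elim: n => [|n IH]; first exact: torus_cont_cst.
by under eq_fun do rewrite exprS; exact: torus_contM.
Qed.

(** Continuity in time and space together: by compactness of the period cell it gives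
bounds that are locally uniform in time, which is all that continuity and
differentiation under the integral sign need. *)
Definition jointly_cont d (I : set R) (h : R -> 'rV[R]_d -> R) :=
  (forall s, I s -> torus_fun (h s)) /\
  (forall s x, I s -> {for (s, x), continuous (fun z : R * 'rV[R]_d => h z.1 z.2)}).

Lemma jointly_contl d I (h : R -> 'rV[R]_d -> R) s : jointly_cont I h -> I s -> torus_cont (h s).
Proof.
move=> [th ch] Is; split; first exact: th.
by move=> x; apply: (@continuous2_cvg _ R 'rV[R]_d R (nbhs x) _ (fun=> s) id h s x (ch s x Is)); [exact: cst_continuous|exact: cvg_id].
Qed.

Lemma jointly_contr d I (h : R -> 'rV[R]_d -> R) s x :
  jointly_cont I h -> I s -> {for s, continuous (h ^~ x)}.
Proof.
move=> [th ch] Is; apply: (@continuous2_cvg _ R 'rV[R]_d R (nbhs s) _ id (fun=> x) h s x (ch s x Is)); [exact: cvg_id|exact: cst_continuous].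
Qed.

Lemma jointly_cont_bounded d (I : set R) (h : R -> 'rV[R]_d -> R) (a b : R) :
  jointly_cont I h -> (forall s, a <= s <= b -> I s) ->
  exists2 M, 0 <= M & forall s x, a <= s <= b -> `|h s x| <= M.
Proof.
move=> [th ch] abI.
have [ab|ba] := leP a b; last first.
  exists 0 => // s x /andP[h1 h2]; have : a <= b by apply: le_trans h2.
  by rewrite leNgt ba.
pose K : set (R * 'rV[R]_d) :=
  `[a, b] `*` [set v : 'rV[R]_d | forall i, `[0, pi *+ 2]%classic (v ord0 i)].
have cK : compact K.
  apply: compact_setX; first exact: segment_compact.
  by apply: (@rV_compact _ _ (fun=> `[0, pi *+ 2]%classic)) => i; exact: segment_compact.
have [||c _ hc] := @compact_EVT_max _ R (fun z => `|h z.1 z.2|) K _ cK.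
- exists (a, 0); split => /=; first by rewrite in_itv/= lexx ab.
  by move=> i; rewrite mxE /= in_itv/= lexx ltW// pi2_gt0.
- apply: continuous_in_subspaceT => -[s x]; rewrite inE => -[/= + _].
  rewrite in_itv/= => sab; apply: cvg_norm.
  by apply: ch; exact: abI.
exists `|h c.1 c.2| => // s x sab.
rewrite -(torus_repE x (th _ (abI _ sab))).
apply: (hc (s, torus_rep x)); rewrite inE; split => /=; first by rewrite in_itv.
by move=> i; rewrite in_itv/=; exact: torus_rep_itv.
Qed.

Lemma jointly_cont_cst d I (g : 'rV[R]_d -> R) : torus_cont g -> jointly_cont I (fun _ => g).
Proof.
move=> [tg cg]; split=> // s x _.
apply: (@continuous_cvg _ _ _ (nbhs (s, x)) _ snd g x); first exact: cg.
exact: cvg_snd.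
Qed.

Lemma torus_cont_bounded d (g : 'rV[R]_d -> R) :
  torus_cont g -> exists2 M, 0 <= M & forall x, `|g x| <= M.
Proof.
move=> /(@jointly_cont_cst _ [set: R]) cg.
have [|M M0 hM] := @jointly_cont_bounded _ _ _ 0 0 cg; first by [].
by exists M => // x; apply: (hM 0); rewrite lexx.
Qed.

(** Integrability is only ever needed for continuous periodic functions, which are
bounded because their values are taken on a compact cell. *)
Lemma integrable_torus d (g : 'rV[R]_d -> R) : torus_cont g ->
  (torus_measure d).-integrable setT (EFin \o (g \o @vec_of_tuple R d)).
Proof.
move=> cg; apply: measurable_bounded_integrable => //.
- by rewrite -ge0_fin_numE ?fin_num_measure.
- by apply: measurable_vec; exact: cg.2.
- have [M _ hM] := torus_cont_bounded cg.
  by exists M; split; [exact: num_real|move=> y My x _ /=; apply: le_trans (ltW My)].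
Qed.

Lemma torus_intD d (g h : 'rV[R]_d -> R) : torus_cont g -> torus_cont h ->
  torus_int (fun x => g x + h x) = torus_int g + torus_int h.
Proof. by move=> cg ch; apply: RintegralD => //; exact: integrable_torus. Qed.

Lemma torus_intB d (g h : 'rV[R]_d -> R) : torus_cont g -> torus_cont h ->
  torus_int (fun x => g x - h x) = torus_int g - torus_int h.
Proof. by move=> cg ch; apply: RintegralB => //; exact: integrable_torus. Qed.

Lemma torus_intZ d c (g : 'rV[R]_d -> R) : torus_cont g ->
  torus_int (fun x => c * g x) = c * torus_int g.
Proof. by move=> cg; apply: RintegralZl => //; exact: integrable_torus. Qed.

Lemma torus_intN d (g : 'rV[R]_d -> R) : torus_cont g ->
  torus_int (fun x => - g x) = - torus_int g.
Proof. by move=> cg; under eq_fun do rewrite -mulN1r; rewrite torus_intZ// mulN1r. Qed.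

Lemma torus_int0 d : torus_int (fun _ : 'rV[R]_d => 0) = 0.
Proof. by rewrite /torus_int /Rintegral integral0. Qed.

Lemma torus_int_sum d I (r : seq I) (P : pred I) (g : I -> 'rV[R]_d -> R) :
  (forall i, P i -> torus_cont (g i)) ->
  torus_int (fun x => \sum_(i <- r | P i) g i x) = \sum_(i <- r | P i) torus_int (g i).
Proof.
move=> cg; elim: r => [|i r IH].
  by under eq_fun do rewrite big_nil; rewrite big_nil torus_int0.
under eq_fun do rewrite big_cons; rewrite big_cons.
case: (boolP (P i)) => // Pi; rewrite torus_intD ?IH//; first exact: cg.
exact: torus_cont_sum.
Qed.

Lemma torus_int_le d (g h : 'rV[R]_d -> R) : torus_cont g -> torus_cont h ->
  (forall x, g x <= h x) -> torus_int g <= torus_int h.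
Proof. by move=> cg ch gh; apply: le_Rintegral => //; exact: integrable_torus. Qed.

Lemma torus_int_ge0 d (g : 'rV[R]_d -> R) : (forall x, 0 <= g x) -> 0 <= torus_int g.
Proof. by move=> g0; apply: Rintegral_ge0. Qed.

Lemma circle_measureT : @circle_measure R setT = (pi *+ 2)%:E.
Proof.
rewrite /circle_measure/= /mfrestr /mrestr setTI /circle lebesgue_measure_itv/= lte_fin pi2_gt0.
by rewrite sube0.
Qed.

Lemma torus_measureT d : torus_measure d setT = ((pi *+ 2) ^+ d)%:E :> \bar R.
Proof.
elim: d => [|d IH]; first by rewrite /= diracE in_setT.
rewrite [LHS](_ : _ = (circle_measure \x torus_measure d)%E (setT `*` setT)); last by rewrite setXTT.
by rewrite product_measure1E// exprS EFinM -circle_measureT -IH.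
Qed.

Lemma torus_int_cst d c : torus_int (fun _ : 'rV[R]_d => c) = c * (pi *+ 2) ^+ d.
Proof. by rewrite /torus_int Rintegral_cst//; congr (c * _); rewrite -[RHS]/(fine ((pi *+ 2) ^+ d)%:E) -torus_measureT. Qed.

Lemma torus_int_norm_le d M (g : 'rV[R]_d -> R) : torus_cont g ->
  (forall x, `|g x| <= M) -> `|torus_int g| <= M * (pi *+ 2) ^+ d.
Proof.
move=> cg gM; rewrite ler_norml -mulNr -!torus_int_cst.
apply/andP; split; apply: torus_int_le => //; try exact: torus_cont_cst;
  by move=> x; have := gM x; rewrite ler_norml => /andP[].
Qed.

Local Notation mu := lebesgue_measure.

Lemma jointly_cont_int d a b (h : R -> 'rV[R]_d -> R) : jointly_cont `]a, b[ h ->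
  {in `]a, b[, continuous (fun s => torus_int (h s))}.
Proof.
move=> ch s sab.
have /near_in_itvoo [e /= e0 hs] := sab.
pose u := s - e / 2; pose v := s + e / 2.
have uv r : u <= r <= v -> r \in `]a, b[.
  by move=> /andP[h1 h2]; apply: hs; rewrite /= ltr_norml /u /v in h1 h2 *; lra.
have [|M M0 hM] := @jointly_cont_bounded _ _ _ u v ch; first exact: uv.
have := @continuity_under_integral R _ _ (torus_measure d)
  (fun r t => h r (vec_of_tuple t)) setT measurableT u v _ _ (fun=> M) _ _.
move=> /(_ _ _ _ _ s); apply.
- by move=> r; rewrite /= in_itv/= => /andP[/ltW h1 /ltW h2]; apply: integrable_torus;
    apply: (jointly_contl ch); apply: uv; rewrite h1 h2.
- apply: aeW => t _ r; rewrite inE/= in_itv/= => /andP[/ltW h1 /ltW h2].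
  have ruv : r \in `]a, b[ by apply: uv; rewrite h1 h2.
  exact: (jointly_contr ch ruv).
- by apply: (@integrable_torus _ (fun=> M)); exact: torus_cont_cst.
- move=> r; rewrite /= in_itv/= => /andP[/ltW h1 /ltW h2].
  by apply: aeW => t _; apply: hM; rewrite h1 h2.
- by rewrite inE /= in_itv/= /u /v; apply/andP; split; lra.
Qed.

Lemma is_derive_torus_int d a b (h dh : R -> 'rV[R]_d -> R) s :
  jointly_cont `]a, b[ h -> jointly_cont `]a, b[ dh ->
  (forall r x, r \in `]a, b[ -> is_derive r 1 (h ^~ x) (dh r x)) ->
  s \in `]a, b[ ->
  is_derive s 1 (fun r => torus_int (h r)) (torus_int (dh s)).
Proof.
move=> ch cdh hd sab.
have /near_in_itvoo [e /= e0 hs] := sab.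
pose u := s - e / 2; pose v := s + e / 2.
have uv r : u <= r <= v -> r \in `]a, b[.
  by move=> /andP[h1 h2]; apply: hs; rewrite /= ltr_norml /u /v in h1 h2 *; lra.
have [|M M0 hM] := @jointly_cont_bounded _ _ _ u v cdh; first exact: uv.
have us : `]u, v[%classic s by rewrite /= in_itv/= /u /v; apply/andP; split; lra.
have dE r x : r \in `]a, b[ -> 'D_1 (h^~ x) r = dh r x.
  by move=> rab; have := hd r x rab => ?; rewrite derive_val.
have uv' r : `]u, v[%classic r -> r \in `]a, b[.
  by rewrite /= in_itv/= => /andP[/ltW h1 /ltW h2]; apply: uv; rewrite h1 h2.
have H1 r : `]u, v[%classic r -> (torus_measure d).-integrable setT (EFin \o (fun t => h r (vec_of_tuple t))).
  by move=> /uv' rab; apply: integrable_torus; apply: (jointly_contl ch).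
have H2 r t : `]u, v[%classic r -> [set: d.-tuple (measurableTypeR R)] t ->
    derivable (fun r => h r (vec_of_tuple t)) r 1.
  by move=> /uv' rab _; have [] := hd r (vec_of_tuple t) rab.
have H3 r (t : d.-tuple (measurableTypeR R)) : `]u, v[%classic r -> [set: d.-tuple (measurableTypeR R)] t ->
    `|partial1of2 (fun r t => h r (vec_of_tuple t)) r t| <= M.
  move=> ruv _; rewrite partial1of2E dE; last exact: uv'.
  by apply: hM; move: ruv; rewrite /= in_itv/= => /andP[/ltW -> /ltW ->].
have H4 : (torus_measure d).-integrable setT (EFin \o (fun=> M)).
  by apply: (@integrable_torus _ (fun=> M)); exact: torus_cont_cst.
have D1 := @derivable_under_integral R _ _ (torus_measure d)
  (fun r t => h r (vec_of_tuple t)) setT measurableT s u v us H1 H2 (fun=> M) (fun=> M0) H4 H3.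
have D2 := @differentiation_under_integral R _ _ (torus_measure d)
  (fun r t => h r (vec_of_tuple t)) setT measurableT s u v us H1 H2 (fun=> M) (fun=> M0) H4 H3.
apply: DeriveDef => //.
rewrite -derive1E D2; apply: eq_Rintegral => t _.
by rewrite partial1of2E dE.
Qed.

(** * Fubini's theorem and integrals of partial derivatives *)

Lemma jointly_cont_row_cons d I (g : 'rV[R]_d.+1 -> R) :
  torus_cont g -> jointly_cont I (fun s y => g (row_cons s y)).
Proof.
move=> [tg cg]; split.
  by move=> s _ y i; rewrite row_consDr tg.
move=> s y _; apply: (@continuous_cvg _ _ _ (nbhs (s, y)) _
    (fun z : R * 'rV[R]_d => row_cons z.1 z.2) g (row_cons s y)); first exact: cg.
by apply: cvg_row_cons; [exact: cvg_fst|exact: cvg_snd].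
Qed.

Lemma torus_cont_row_cons d (g : 'rV[R]_d.+1 -> R) s :
  torus_cont g -> torus_cont (fun y => g (row_cons s y)).
Proof. by move=> /(@jointly_cont_row_cons _ setT)/jointly_contl; exact. Qed.

Lemma jointly_cont_intT d (h : R -> 'rV[R]_d -> R) : jointly_cont setT h ->
  continuous (fun s => torus_int (h s)).
Proof.
move=> [th ch] s; apply: (@jointly_cont_int d (s - 1) (s + 1)).
  by split=> [r _|r x _]; [exact: th|exact: ch].
by rewrite in_itv/=; apply/andP; split; lra.
Qed.

Lemma continuous_int_cons d (g : 'rV[R]_d.+1 -> R) : torus_cont g ->
  continuous (fun s => torus_int (fun y => g (row_cons s y))).
Proof. by move=> cg; apply: jointly_cont_intT; exact: jointly_cont_row_cons. Qed.

Lemma integrable_itv a b (f : R -> R) : continuous f -> mu.-integrable `[a, b] (EFin \o f).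
Proof.
move=> cf; apply: continuous_compact_integrable; first exact: segment_compact.
exact: continuous_subspaceT.
Qed.

(** The measure of the torus is defined by recursion on the dimension, so that this is
Fubini's theorem for one circle factor. It is the tool for inductions on the dimension. *)
Lemma torus_int_cons d (g : 'rV[R]_d.+1 -> R) : torus_cont g ->
  torus_int g = \int[mu]_(s in `[0, pi *+ 2]) torus_int (fun y => g (row_cons s y)).
Proof.
move=> cg.
pose F := EFin \o (g \o @vec_of_tuple R d.+1).
have iF : (torus_measure d.+1).-integrable setT F := integrable_torus cg.
have mF : measurable_fun setT F by case/integrableP : iF.
have iFc : (circle_measure \x torus_measure d)%E.-integrable setT (F \o @tuple_cons R d).
  apply: measurable_bounded_integrable => //.
  - by rewrite [X in (X < _)%E](_ : _ = torus_measure d.+1 setT)// torus_measureT ltry.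
  - apply: measurableT_comp; last exact: measurable_tuple_cons.
    by apply: measurable_vec; exact: cg.2.
  - have [M _ hM] := torus_cont_bounded cg.
    by exists M; split; [exact: num_real|move=> y My x _ /=; apply: le_trans (ltW My)].
have -> : torus_int g = fine (\int[(circle_measure \x torus_measure d)%E]_z (F \o @tuple_cons R d) z)%E.
  rewrite /torus_int /Rintegral; congr fine.
  exact: (@integral_pushforward _ _ _ _ R _ (@measurable_tuple_cons R d)
    (circle_measure \x torus_measure d)%E setT F mF iFc measurableT).
rewrite -integral12_prod_meas1//.
have E s : fubini_F (torus_measure d) (F \o @tuple_cons R d) s =
    (torus_int (fun y => g (row_cons s y)))%:E.
  rewrite /fubini_F /torus_int /Rintegral fineK.
    by apply: eq_integral => t _; rewrite /F /= vec_of_tuple_cons.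
  by apply: integrable_fin_num => //; apply: (integrable_torus (torus_cont_row_cons s cg)).
under eq_integral do rewrite E.
rewrite -Rintegral_itv_bndo_bndc; last first.
  apply: (integrableS _ _ _ (integrable_itv 0 (pi *+ 2) (continuous_int_cons cg))) => //.
  by apply: subset_itvl; rewrite bnd_simp.
rewrite /Rintegral; congr fine.
rewrite (@negligible_integral _ _ _ circle_measure setT (~` @circle R)) => //.
- rewrite setTD setCK; apply: eq_measure_integral => A mA AD.
  by rewrite /circle_measure/= /mfrestr /mrestr setIidl.
- by apply: measurableC; exact: measurable_circle.
- apply: measurable_bounded_integrable => //.
  + by rewrite -ge0_fin_numE ?fin_num_measure.
  + exact: (continuous_measurable_fun (continuous_int_cons cg)).
  + have [M _ hM] := torus_cont_bounded cg.
    exists (M * (pi *+ 2) ^+ d); split; [exact: num_real|move=> y My s _ /=].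
    by apply: le_trans (ltW My); apply: torus_int_norm_le => //; exact: torus_cont_row_cons.
- by rewrite /circle_measure/= /mfrestr /mrestr setICl measure0.
Qed.

Lemma FTC2_itv (F f : R -> R) (a b : R) : a <= b ->
  (forall x : R, x \in `[a, b] -> is_derive x 1 F (f x)) ->
  {within `[a, b], continuous f} ->
  \int[mu]_(x in `[a, b]) f x = F b - F a.
Proof.
rewrite le_eqVlt => /predU1P[<- _ _|ab dF cf].
  by rewrite set_itv1 Rintegral_set1 subrr.
rewrite /Rintegral (@continuous_FTC2 _ f F)//.
- have dc x : x \in `[a, b] -> {for x, continuous F}.
    by move=> /dF [dx _]; apply/differentiable_continuous/derivable1_diffP.
  split.
  + by move=> x xab; have [] := dF x (subset_itv_oo_cc xab).
  + apply: cvg_at_right_filter; apply: dc; by rewrite in_itv/= lexx ltW.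
  + apply: cvg_at_left_filter; apply: dc; by rewrite in_itv/= lexx ltW.
- by move=> x xab; rewrite derive1E; have ? := dF x (subset_itv_oo_cc xab); rewrite derive_val.
Qed.

(** A directional derivative depends only on the restriction to a line. This carries
derivatives between the torus, its lower-dimensional slices and the time axis. *)
Lemma derive_shift (V W : normedModType R) (g : V -> R) (k : W -> R) x y v w :
  (forall h : R, g (h *: v + x) = k (h *: w + y)) ->
  'D_v g x = 'D_w k y /\ (derivable k y w -> derivable g x v).
Proof.
move=> E; have gk : g x = k y by have := E 0; rewrite !scale0r !add0r.
have {}E : (fun h : R => h^-1 *: (g (h *: v + x) - g x)) =
           (fun h => h^-1 *: (k (h *: w + y) - k y)).
  by apply/funext => h; rewrite E gk.
by rewrite /derivable /derive /= E.
Qed.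

Lemma is_derive_line (V : normedModType R) (g : V -> R) (x v : V) s :
  derivable g (x + s *: v) v ->
  is_derive s 1 (fun r => g (x + r *: v)) ('D_v g (x + s *: v)).
Proof.
move=> dg; have [|E1 E2] := @derive_shift _ _ (fun r : R => g (x + r *: v)) g s (x + s *: v) 1 v.
  by move=> h; rewrite scaler1 scalerDl addrCA.
exact: (DeriveDef (E2 dg) E1).
Qed.

Lemma torus_fun_line d (g : 'rV[R]_d.+1 -> R) (y : 'rV[R]_d) :
  torus_fun g -> g (row_cons (pi *+ 2) y) = g (row_cons 0 y).
Proof. by move=> tg; rewrite -[pi *+ 2]add0r row_consDl tg. Qed.

(** The integral over the torus of a partial derivative vanishes. By Fubini's
theorem it reduces to the fundamental theorem of calculus on a circle. *)
Lemma torus_int_partial d (g : 'rV[R]_d -> R) i : torus_cont g ->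
  (forall x, derivable g x (basis_vec i)) -> torus_cont (partial i g) ->
  torus_int (partial i g) = 0.
Proof.
elim: d g i => [g []//|d IH g i tg dg cg].
rewrite torus_int_cons//.
have [j ij|i0] := unliftP ord0 i.
  rewrite [X in Rintegral _ _ X](_ : _ = cst 0) ?Rintegral_cst ?mul0r//.
  apply/funext => s /=.
  have E y := @derive_shift _ _ (fun y => g (row_cons s y)) g y (row_cons s y) (basis_vec j) (basis_vec i).
  have {}E y : partial j (fun y => g (row_cons s y)) y = partial i g (row_cons s y) /\
      derivable (fun y => g (row_cons s y)) y (basis_vec j).
    have [|E1 E2] := E y; first by move=> h; rewrite addrC row_consDr -ij addrC.
    by split; [rewrite /partial E1|exact: E2].
  under eq_fun => y do rewrite -(E y).1.
  apply: IH.
  - exact: torus_cont_row_cons.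
  - by move=> y; have [] := E y.
  - have -> : partial j (fun y => g (row_cons s y)) = (fun y => partial i g (row_cons s y)).
      by apply/funext => y; rewrite (E y).1.
    exact: torus_cont_row_cons.
have E (t : R) y : row_cons t y = row_cons 0 y + t *: basis_vec i.
  by rewrite i0 -row_consDl add0r.
have dS (s : R) : is_derive s 1 (fun s => torus_int (fun y => g (row_cons s y)))
    (torus_int (fun y => partial i g (row_cons s y))).
  apply: (@is_derive_torus_int d (s - 1) (s + 1) (fun s y => g (row_cons s y))
    (fun s y => partial i g (row_cons s y))).
  - exact: jointly_cont_row_cons.
  - exact: (jointly_cont_row_cons _ cg).
  - move=> r y _.
    have -> : (fun t => g (row_cons t y)) = (fun t => g (row_cons 0 y + t *: basis_vec i)).
      by apply/funext => t; rewrite E.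
    by rewrite (E r); apply: is_derive_line.
  - by rewrite in_itv/=; apply/andP; split; lra.
rewrite (FTC2_itv (ltW pi2_gt0) (fun s _ => dS s)).
  under eq_fun do rewrite (torus_fun_line _ tg.1).
  by rewrite subrr.
exact/continuous_subspaceT/continuous_int_cons.
Qed.

(** * Trigonometric modes *)

Definition phase d (k : 'rV[int]_d) (x : 'rV[R]_d) : R := dot (freq k) x.

Lemma phaseD d k (x y : 'rV[R]_d) : phase k (x + y) = phase k x + phase k y.
Proof. by rewrite /phase /dot -big_split; apply: eq_bigr => i _; rewrite !mxE mulrDr. Qed.

Lemma phaseZ d k a (x : 'rV[R]_d) : phase k (a *: x) = a * phase k x.
Proof. by rewrite /phase /dot mulr_sumr; apply: eq_bigr => i _; rewrite !mxE mulrCA. Qed.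

Lemma phaseDl d k l (x : 'rV[R]_d) : phase (k + l) x = phase k x + phase l x.
Proof.
rewrite /phase /dot -big_split; apply: eq_bigr => i _.
by rewrite !mxE rmorphD /= mulrDl.
Qed.

Lemma phaseNl d k (x : 'rV[R]_d) : phase (- k) x = - phase k x.
Proof.
rewrite /phase /dot -sumrN; apply: eq_bigr => i _.
by rewrite !mxE rmorphN /= mulNr.
Qed.

Lemma phaseBl d k l (x : 'rV[R]_d) : phase (k - l) x = phase k x - phase l x.
Proof. by rewrite phaseDl phaseNl. Qed.

Lemma phase0l d (x : 'rV[R]_d) : phase 0 x = 0.
Proof. by rewrite -[0 in LHS](subrr 0) phaseBl subrr. Qed.

Lemma phase_basis d k i : phase k (basis_vec i : 'rV[R]_d) = (k 0 i)%:~R.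
Proof.
rewrite /phase /dot (bigD1 i)//= big1 ?addr0; last first.
  by move=> j ji; rewrite !mxE eqxx (negbTE ji) mulr0.
by rewrite !mxE !eqxx mulr1.
Qed.

Lemma phase_delta d i (x : 'rV[R]_d) : phase (delta_mx 0 i) x = x 0 i.
Proof.
rewrite /phase /dot (bigD1 i)//= big1 ?addr0; last first.
  by move=> j ji; rewrite !mxE eqxx (negbTE ji) mul0r.
by rewrite !mxE !eqxx mul1r.
Qed.

Lemma cosD2piz (t : R) (n : int) : cos (t + n%:~R * (pi *+ 2)) = cos t.
Proof.
case: n => n; first by rewrite -pmulrn mulr_natl (periodicn (@cosD2pi R)).
rewrite NegzE mulrNz mulNr -pmulrn.
by rewrite -(periodicn (@cosD2pi R) n.+1 (t - _)) -[(pi *+ 2) *+ _]mulr_natl subrK.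
Qed.

Lemma sinD2piz (t : R) (n : int) : sin (t + n%:~R * (pi *+ 2)) = sin t.
Proof.
case: n => n; first by rewrite -pmulrn mulr_natl (periodicn (@sinD2pi R)).
rewrite NegzE mulrNz mulNr -pmulrn.
by rewrite -(periodicn (@sinD2pi R) n.+1 (t - _)) -[(pi *+ 2) *+ _]mulr_natl subrK.
Qed.

Definition cosm d (k : 'rV[int]_d) (x : 'rV[R]_d) : R := cos (phase k x).
Definition sinm d (k : 'rV[int]_d) (x : 'rV[R]_d) : R := sin (phase k x).

Lemma continuous_phase d k : continuous (@phase d k).
Proof.
move=> x; rewrite /phase /dot; apply: (@cvg_sum_seq _ _ (nbhs x)) => i _.
exact: (cvgM (cvg_cst _) (@coord_continuous R 1 d 0 i x)).
Qed.

Lemma torus_cont_cosm d k : torus_cont (@cosm d k).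
Proof.
split; last first.
  by move=> x; apply: (@continuous_comp _ _ _ (phase k) cos); [exact: continuous_phase|exact: continuous_cos].
by move=> x i; rewrite /cosm phaseD phaseZ phase_basis mulrC cosD2piz.
Qed.

Lemma torus_cont_sinm d k : torus_cont (@sinm d k).
Proof.
split; last first.
  by move=> x; apply: (@continuous_comp _ _ _ (phase k) sin); [exact: continuous_phase|exact: continuous_sin].
by move=> x i; rewrite /sinm phaseD phaseZ phase_basis mulrC sinD2piz.
Qed.

(** Along a basis vector the phase is affine, which reduces the modes to functions of
one variable. *)
Lemma is_derive_phase d (k : 'rV[int]_d) (F : R -> R) dF x i :
  (forall t : R, is_derive t 1 F (dF t)) ->
  is_derive x (basis_vec i) (fun x => F (phase k x)) ((k 0 i)%:~R * dF (phase k x)).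
Proof.
move=> hF.
have hd : is_derive (0 : R) 1 (fun h : R => F (phase k x + h * (k 0 i)%:~R)) ((k 0 i)%:~R * dF (phase k x)).
  have h1 : is_derive (0 : R) 1 (fun h : R => phase k x + h * (k 0 i)%:~R) (k 0 i)%:~R.
    by apply: is_derive_eq; rewrite /GRing.scale /=; ring.
  have h2 := hF (phase k x + 0 * (k 0 i)%:~R).
  have := @is_derive1_comp R F (fun h : R => phase k x + h * (k 0 i)%:~R) 0 _ _ h2 h1.
  by rewrite mul0r addr0 mulrC.
have [|E1 E2] := @derive_shift _ _ (fun x => F (phase k x)) (fun h : R => F (phase k x + h * (k 0 i)%:~R)) x 0 (basis_vec i) 1.
  by move=> h; rewrite phaseD phaseZ phase_basis scaler1 addr0 addrC.
by apply: (DeriveDef (E2 _)); rewrite ?E1 ?derive_val //; exact: ex_derive.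
Qed.

Lemma is_derive_cosm d (k : 'rV[int]_d) x i :
  is_derive x (basis_vec i) (cosm k) (- ((k 0 i)%:~R * sinm k x)).
Proof.
by rewrite -mulrN; apply: (@is_derive_phase d k cos (fun t => - sin t)) => t; exact: is_derive_cos.
Qed.

Lemma is_derive_sinm d (k : 'rV[int]_d) x i :
  is_derive x (basis_vec i) (sinm k) ((k 0 i)%:~R * cosm k x).
Proof. by apply: (@is_derive_phase d k sin cos) => t; exact: is_derive_sin. Qed.

Lemma cosm0 d (x : 'rV[R]_d) : cosm 0 x = 1.
Proof. by rewrite /cosm phase0l cos0. Qed.

Lemma cosmN d k (x : 'rV[R]_d) : cosm (- k) x = cosm k x.
Proof. by rewrite /cosm phaseNl cosN. Qed.

Lemma sinmN d k (x : 'rV[R]_d) : sinm (- k) x = - sinm k x.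
Proof. by rewrite /sinm phaseNl sinN. Qed.

(** A nonconstant mode is, up to a nonzero factor, a partial derivative. *)
Lemma torus_int_cosm d (k : 'rV[int]_d) :
  torus_int (cosm k) = (k == 0)%:R * (pi *+ 2) ^+ d.
Proof.
have [->|k0] := eqVneq k 0.
  by rewrite (_ : cosm 0 = cst 1) ?torus_int_cst//; apply/funext => x; rewrite cosm0.
rewrite mul0r.
have [i ki] : exists i, k 0 i != 0.
  apply/existsP; apply: contraNT k0; rewrite negb_exists => /forallP h.
  by apply/eqP/rowP => i; rewrite mxE; apply/eqP; move: (h i); rewrite negbK.
have dE : partial i (sinm k) = (fun x : 'rV[R]_d => (k 0 i)%:~R * cosm k x).
  by apply/funext => x; rewrite /partial; have ? := is_derive_sinm k x i; rewrite derive_val.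
have : torus_int (partial i (sinm k : 'rV[R]_d -> R)) = 0.
  apply: torus_int_partial; first exact: torus_cont_sinm.
    by move=> x; have ? := is_derive_sinm k x i; exact: ex_derive.
  by rewrite dE; apply: torus_contZ; exact: torus_cont_cosm.
rewrite dE torus_intZ; last exact: torus_cont_cosm.
by move/eqP; rewrite mulf_eq0 intr_eq0 (negbTE ki) => /eqP.
Qed.

Lemma torus_int_sinm d (k : 'rV[int]_d) : torus_int (sinm k : 'rV[R]_d -> R) = 0.
Proof.
have [->|k0] := eqVneq k 0.
  by rewrite (_ : sinm 0 = cst 0) ?torus_int0//; apply/funext => x; rewrite /sinm phase0l sin0.
have [i ki] : exists i, k 0 i != 0.
  apply/existsP; apply: contraNT k0; rewrite negb_exists => /forallP h.
  by apply/eqP/rowP => i; rewrite mxE; apply/eqP; move: (h i); rewrite negbK.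
have dE : partial i (cosm k) = (fun x : 'rV[R]_d => (- (k 0 i)%:~R) * sinm k x).
  by apply/funext => x; rewrite /partial; have ? := is_derive_cosm k x i; rewrite derive_val mulNr.
have : torus_int (partial i (cosm k : 'rV[R]_d -> R)) = 0.
  apply: torus_int_partial; first exact: torus_cont_cosm.
    by move=> x; have ? := is_derive_cosm k x i; exact: ex_derive.
  by rewrite dE; apply: torus_contZ; exact: torus_cont_sinm.
rewrite dE torus_intZ; last exact: torus_cont_sinm.
by move/eqP; rewrite mulf_eq0 oppr_eq0 intr_eq0 (negbTE ki) => /eqP.
Qed.

Lemma cosm_cosm d k l (x : 'rV[R]_d) :
  cosm k x * cosm l x = 2^-1 * (cosm (k - l) x + cosm (k + l) x).
Proof. by rewrite /cosm phaseBl phaseDl cosB cosD; lra. Qed.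

Lemma sinm_sinm d k l (x : 'rV[R]_d) :
  sinm k x * sinm l x = 2^-1 * (cosm (k - l) x - cosm (k + l) x).
Proof. by rewrite /cosm /sinm phaseBl phaseDl cosB cosD; lra. Qed.

Lemma sinm_cosm d k l (x : 'rV[R]_d) :
  sinm k x * cosm l x = 2^-1 * (sinm (k + l) x + sinm (k - l) x).
Proof. by rewrite /cosm /sinm phaseBl phaseDl sinB sinD; lra. Qed.

Local Hint Resolve torus_cont_cosm torus_cont_sinm torus_cont_cst : core.

Lemma torus_int_cosm_cosm d k l :
  torus_int (fun x : 'rV[R]_d => cosm k x * cosm l x) =
  2^-1 * (pi *+ 2) ^+ d * ((k == l)%:R + (k == - l)%:R).
Proof.
under eq_fun do rewrite cosm_cosm.
rewrite torus_intZ ?torus_intD ?torus_int_cosm//; last exact: torus_contD.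
by rewrite subr_eq0 addr_eq0; ring.
Qed.

Lemma torus_int_sinm_sinm d k l :
  torus_int (fun x : 'rV[R]_d => sinm k x * sinm l x) =
  2^-1 * (pi *+ 2) ^+ d * ((k == l)%:R - (k == - l)%:R).
Proof.
under eq_fun do rewrite sinm_sinm.
rewrite torus_intZ ?torus_intB ?torus_int_cosm//; last exact: torus_contB.
by rewrite subr_eq0 addr_eq0; ring.
Qed.

Lemma torus_int_sinm_cosm d k l :
  torus_int (fun x : 'rV[R]_d => sinm k x * cosm l x) = 0.
Proof.
under eq_fun do rewrite sinm_cosm.
by rewrite torus_intZ ?torus_intD ?torus_int_sinm ?addr0 ?mulr0//; exact: torus_contD.
Qed.

(** * Fourier multipliers and Bessel's inequality *)

(** Any exhaustion of the frequencies by finite sets that are symmetric under [k |-> - k]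
would do; a cube contains the supports of the cutoffs and the differences of the
frequencies of a Fejer kernel. *)
Definition cube d N : seq 'rV[int]_d :=
  [seq \row_i ((f i : nat)%:Z - N%:Z) | f : {ffun 'I_d -> 'I_N.*2.+1}].

Lemma mem_cube d N (k : 'rV[int]_d) : (k \in cube d N) = [forall i, `|k 0 i| <= N%:Z].
Proof.
apply/mapP/forallP => [[f _ ->] i|h].
  rewrite mxE; have : (f i <= N.*2)%N by rewrite -ltnS.
  by move: (nat_of_ord (f i)) => a; rewrite -addnn ler_norml; lia.
have hk i : (absz (k 0 i + N%:Z)%R < N.*2.+1)%N.
  by have := h i; rewrite ler_norml -addnn; move: (k 0 i) => a; lia.
exists [ffun i => Ordinal (hk i)]; first by rewrite mem_enum.
apply/rowP => i; rewrite mxE ffunE /=.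
by have := h i; rewrite ler_norml; move: (k 0 i) => a; lia.
Qed.

Lemma cube_uniq d N : uniq (cube d N).
Proof.
rewrite map_inj_uniq ?enum_uniq// => f g /rowP fg; apply/ffunP => i.
by apply/val_inj; have := fg i; rewrite !mxE => /addIr [].
Qed.

Lemma cubeN d N k : (- k \in cube d N) = (k \in cube d N).
Proof. by rewrite !mem_cube; apply: eq_forallb => i; rewrite mxE normrN. Qed.

Lemma cubeS d N N' : (N <= N')%N -> {subset cube d N <= cube d N'}.
Proof.
move=> NN' k; rewrite !mem_cube => /forallP h; apply/forallP => i.
by apply: (le_trans (h i)); rewrite lez_nat.
Qed.

Lemma sum_cube1 d N (F : 'rV[int]_d -> R) l :
  \sum_(k <- cube d N) F k * (k == l)%:R = F l * (l \in cube d N)%:R.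
Proof.
case: (boolP (l \in _)) => lN.
  rewrite (bigD1_seq l) ?cube_uniq//= eqxx big1 ?addr0// => k kl.
  by rewrite (negbTE kl) mulr0.
rewrite mulr0 big_seq big1// => k kN.
by case: eqP kN => [->|]; rewrite ?(negbTE lN) ?mulr0.
Qed.

Definition cosc d (g : 'rV[R]_d -> R) k := torus_int (fun x => g x * cosm k x).
Definition sinc d (g : 'rV[R]_d -> R) k := torus_int (fun x => g x * sinm k x).

(** Up to the factor [(2 pi)^(2 d)] this is the real part of the product of the Fourier
coefficient of [g] with the conjugate of that of [h]. Real coefficients avoid complex
integrals. *)
Definition fpair d (g h : 'rV[R]_d -> R) k := cosc g k * cosc h k + sinc g k * sinc h k.

(** Each real mode occurs for both [k] and [- k], which makes up for the factor [1/2] in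
the orthogonality relations. *)
Definition multiplier d (w : 'rV[int]_d -> R) N (g : 'rV[R]_d -> R) : 'rV[R]_d -> R :=
  fun x => (pi *+ 2) ^- d * \sum_(k <- cube d N)
    w k * (cosc g k * cosm k x + sinc g k * sinm k x).

Definition symbol d N (w : 'rV[int]_d -> R) :=
  (forall k, w (- k) = w k) /\ (forall k, k \notin cube d N -> w k = 0).

Local Hint Resolve torus_contD torus_contB torus_contM torus_contZ : core.

Lemma torus_cont_multiplier d w N (g : 'rV[R]_d -> R) : torus_cont (multiplier w N g).
Proof.
apply: torus_contZ; apply: torus_cont_sum => k _.
by apply: torus_contZ; apply: torus_contD; apply: torus_contZ.
Qed.
Local Hint Resolve torus_cont_multiplier : core.

Lemma torus_int_multiplier d w N (g h : 'rV[R]_d -> R) : torus_cont h ->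
  torus_int (fun x => multiplier w N g x * h x) =
  (pi *+ 2) ^- d * \sum_(k <- cube d N) w k * fpair g h k.
Proof.
move=> ch; rewrite /multiplier; under eq_fun do rewrite -mulrA mulr_suml.
have H k : torus_cont (fun x : 'rV[R]_d => w k * (cosc g k * cosm k x + sinc g k * sinm k x) * h x).
  by apply: torus_contM => //; apply: torus_contZ; apply: torus_contD; apply: torus_contZ.
rewrite torus_intZ; last by apply: torus_cont_sum => k _; exact: H.
rewrite torus_int_sum; last by move=> k _; exact: H.
congr (_ * _); apply: eq_bigr => k _; rewrite /fpair.
rewrite (_ : (fun x => _) = (fun x => w k * (cosc g k * (h x * cosm k x) + sinc g k * (h x * sinm k x)))); last first.
  by apply/funext => x; ring.
by rewrite torus_intZ ?torus_intD ?torus_intZ//; auto.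
Qed.

Lemma cosc_sym d (g : 'rV[R]_d -> R) k : cosc g (- k) = cosc g k.
Proof. by rewrite /cosc; congr torus_int; apply/funext => x; rewrite cosmN. Qed.

Lemma sinc_sym d (g : 'rV[R]_d -> R) k : torus_cont g -> sinc g (- k) = - sinc g k.
Proof.
move=> cg; rewrite /sinc -torus_intN; last by auto.
by congr torus_int; apply/funext => x; rewrite sinmN mulrN.
Qed.

Lemma fpair_mode_cos d (g : 'rV[R]_d -> R) k l :
  fpair g (cosm l) k = 2^-1 * (pi *+ 2) ^+ d * (cosc g k * ((k == l)%:R + (k == - l)%:R)).
Proof.
rewrite /fpair /cosc /sinc.
rewrite (_ : (fun x => cosm l x * cosm k x) = (fun x => cosm k x * cosm l x)); last first.
  by apply/funext => x; rewrite mulrC.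
rewrite (_ : (fun x => cosm l x * sinm k x) = (fun x => sinm k x * cosm l x)); last first.
  by apply/funext => x; rewrite mulrC.
by rewrite torus_int_cosm_cosm torus_int_sinm_cosm; ring.
Qed.

Lemma fpair_mode_sin d (g : 'rV[R]_d -> R) k l :
  fpair g (sinm l) k = 2^-1 * (pi *+ 2) ^+ d * (sinc g k * ((k == l)%:R - (k == - l)%:R)).
Proof.
rewrite /fpair /cosc /sinc.
rewrite (_ : (fun x => sinm l x * sinm k x) = (fun x => sinm k x * sinm l x)); last first.
  by apply/funext => x; rewrite mulrC.
by rewrite torus_int_sinm_cosm torus_int_sinm_sinm; ring.
Qed.

Lemma pi2X_neq0 d : (pi *+ 2) ^+ d != 0 :> R.
Proof. by rewrite expf_neq0// gt_eqF// pi2_gt0. Qed.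

Lemma cosc_multiplier d w N (g : 'rV[R]_d -> R) l : symbol N w ->
  cosc (multiplier w N g) l = w l * cosc g l.
Proof.
move=> [ws wN]; rewrite /cosc torus_int_multiplier//.
under eq_bigr do rewrite fpair_mode_cos mulrCA mulrDr mulrDr !mulrA.
rewrite -mulr_sumr big_split/= !sum_cube1 cubeN cosc_sym ws -/(cosc g l).
have -> : w l * cosc g l * (l \in cube d N)%:R = w l * cosc g l.
  by case: (boolP (l \in _)) => [|/wN ->]; rewrite ?mulr1// !mul0r.
by field; exact: pi2X_neq0.
Qed.

Lemma sinc_multiplier d w N (g : 'rV[R]_d -> R) l : torus_cont g -> symbol N w ->
  sinc (multiplier w N g) l = w l * sinc g l.
Proof.
move=> cg [ws wN]; rewrite /sinc torus_int_multiplier//.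
under eq_bigr do rewrite fpair_mode_sin mulrCA mulrBr mulrBr !mulrA.
rewrite -mulr_sumr sumrB/= !sum_cube1 cubeN sinc_sym// ws -/(sinc g l) mulrN mulNr opprK.
have -> : w l * sinc g l * (l \in cube d N)%:R = w l * sinc g l.
  by case: (boolP (l \in _)) => [|/wN ->]; rewrite ?mulr1// !mul0r.
by field; exact: pi2X_neq0.
Qed.

Lemma torus_int_multiplier2 d w N (g h : 'rV[R]_d -> R) :
  torus_cont h -> symbol N w ->
  torus_int (fun x => multiplier w N g x * multiplier w N h x) =
  (pi *+ 2) ^- d * \sum_(k <- cube d N) w k ^+ 2 * fpair g h k.
Proof.
move=> ch sw; rewrite torus_int_multiplier//; congr (_ * _).
apply: eq_bigr => k _.
by rewrite /fpair cosc_multiplier// sinc_multiplier//; ring.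
Qed.

Lemma fpair_ge0 d (g : 'rV[R]_d -> R) k : 0 <= fpair g g k.
Proof. by rewrite addr_ge0// -expr2 sqr_ge0. Qed.

(** The squared distance from [g] to its truncated Fourier series is nonnegative. *)
Lemma bessel d N (g : 'rV[R]_d -> R) : torus_cont g ->
  (pi *+ 2) ^- d * \sum_(k <- cube d N) fpair g g k <= torus_int (fun x => g x ^+ 2).
Proof.
move=> cg; pose w k : R := (k \in cube d N)%:R.
have sw : symbol N w.
  by split=> k; rewrite /w ?cubeN// => /negbTE ->.
have wE : \sum_(k <- cube d N) w k * fpair g g k = \sum_(k <- cube d N) fpair g g k.
  by rewrite !big_seq; apply: eq_bigr => k kN; rewrite /w kN mul1r.
have w2E : \sum_(k <- cube d N) w k ^+ 2 * fpair g g k = \sum_(k <- cube d N) fpair g g k.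
  by rewrite -wE; apply: eq_bigr => k _; rewrite /w; case: (_ \in _); rewrite ?expr1n ?expr0n.
have : 0 <= torus_int (fun x => (g x - multiplier w N g x) ^+ 2).
  by apply: torus_int_ge0 => x; exact: sqr_ge0.
rewrite (_ : (fun x => _) = (fun x => g x ^+ 2 - 2 * (multiplier w N g x * g x) +
    multiplier w N g x * multiplier w N g x)); last by apply/funext => x; ring.
have cg2 := torus_contX 2 cg.
rewrite torus_intD ?torus_intB ?torus_intZ ?torus_int_multiplier2 ?torus_int_multiplier//; auto 6.
by rewrite wE w2E; lra.
Qed.

(** * Parseval's identity *)

Lemma continuous_comp_fst (U V W : topologicalType) (g : U -> W) :
  continuous g -> continuous (fun z : U * V => g z.1).
Proof. by move=> cg z; apply: (@continuous_comp _ _ _ fst g); [exact: cvg_fst|exact: cg]. Qed.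

Lemma continuous_comp_snd (U V W : topologicalType) (g : V -> W) :
  continuous g -> continuous (fun z : U * V => g z.2).
Proof. by move=> cg z; apply: (@continuous_comp _ _ _ snd g); [exact: cvg_snd|exact: cg]. Qed.

Lemma cos_eq1 (z : R) : `|z| <= pi *+ 2 -> cos z = 1 -> `|z| = 0 \/ `|z| = pi *+ 2.
Proof.
move=> hz cz; have {cz} : cos `|z| = 1 by case: (ger0P z) => _; rewrite ?cosN.
have := normr_ge0 z; move: (`|z| : R) hz => {}z z2 z0 cz.
have pi0 := pi_ge0 R.
have inj (t : R) : 0 <= t <= pi -> cos t = 1 -> t = 0.
  move=> tpi ct; apply: (@cos_inj R).
  - by rewrite in_itv.
  - by rewrite in_itv/= lexx.
  - by rewrite ct cos0.
have [zpi|/ltW zpi] := leP z pi; first by left; apply: inj => //; rewrite z0.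
right; have /eqP : pi *+ 2 - z = 0.
  apply: inj; first by rewrite subr_ge0 z2 /= mulr2n; lra.
  by rewrite addrC cosD2pi cosN.
by rewrite subr_eq0 => /eqP.
Qed.

(** In the closed period cell two points with these coordinates differ by a period: the
only coincidences are equal coordinates and opposite faces. *)
Lemma torus_fun_eq d (g : 'rV[R]_d -> R) (x y : 'rV[R]_d) : torus_fun g ->
  (forall i, 0 <= x 0 i <= pi *+ 2) -> (forall i, 0 <= y 0 i <= pi *+ 2) ->
  (forall i, cos (x 0 i - y 0 i) = 1) -> g x = g y.
Proof.
move=> tg hx hy c1.
have pi0 := @pi2_gt0.
pose n : 'rV[int]_d := \row_i (if x 0 i == y 0 i then 0 else if x 0 i > y 0 i then 1 else -1).
rewrite -(torus_fun_shift n y tg); congr (g _); apply/rowP => i; rewrite !mxE.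
have := hx i; have := hy i => /andP[y0 y2] /andP[x0 x2].
have [|h|h] := @cos_eq1 (x 0 i - y 0 i) _ (c1 i).
- by rewrite ler_norml; apply/andP; split; lra.
- by have /eqP := normr0_eq0 h; rewrite subr_eq0 => /eqP ->; rewrite eqxx mulr0 addr0.
- move: h; case: eqP => [->|_]; first by rewrite subrr normr0 => /eqP; rewrite lt_eqF.
  have [yx|xy] := ltP (y 0 i) (x 0 i).
    by rewrite gtr0_norm ?subr_gt0// mulr1; lra.
  by rewrite ler0_norm ?subr_le0// rmorphN /= mulrN mulr1; lra.
Qed.

(** A quantitative form of uniform continuity adapted to convolution with a
kernel: the modulus of continuity is measured by the trigonometric polynomial
[\sum_i (1 - cos z_i)], which vanishes only on the lattice of periods. *)
Lemma torus_modulus d (g : 'rV[R]_d -> R) (e : R) : torus_cont g -> 0 < e ->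
  exists2 C, 0 <= C & forall x y,
    `|g x - g y| <= e + C * \sum_i (1 - cos (x 0 i - y 0 i)).
Proof.
move=> cg e0; have [M M0 hM] := torus_cont_bounded cg.
pose box := [set v : 'rV[R]_d | forall i, `[0, pi *+ 2]%classic (v ord0 i)].
have cbox : compact box.
  by apply: (@rV_compact _ _ (fun=> `[0, pi *+ 2]%classic)) => i; exact: segment_compact.
pose psi (z : 'rV[R]_d * 'rV[R]_d) := `|g z.1 - g z.2|.
pose phi (z : 'rV[R]_d * 'rV[R]_d) := \sum_i (1 - cos (z.1 0 i - z.2 0 i)).
have phi_ge0 z : 0 <= phi z by apply: sumr_ge0 => i _; rewrite subr_ge0 cos_le1.
have cpsi : continuous psi.
  move=> z.
  have c1 := @continuous_comp_fst _ 'rV[R]_d _ g cg.2 z.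
  have c2 := @continuous_comp_snd 'rV[R]_d _ _ g cg.2 z.
  exact: (cvg_norm (cvgB c1 c2)).
have cphi : continuous phi.
  move=> z; apply: (@cvg_sum_seq _ _ (nbhs z)) => i _.
  apply: (cvgB (cvg_cst _)).
  apply: (@continuous_cvg _ _ _ (nbhs z) _ (fun z : 'rV[R]_d * 'rV[R]_d => z.1 0 i - z.2 0 i) cos).
    exact: continuous_cos.
  have c1 := @continuous_comp_fst _ 'rV[R]_d _ _ (@coord_continuous R 1 d 0 i) z.
  have c2 := @continuous_comp_snd 'rV[R]_d _ _ _ (@coord_continuous R 1 d 0 i) z.
  exact: (cvgB c1 c2).
pose K := (box `*` box) `&` [set z | e <= psi z].
have cK : compact K.
  apply: compact_closedI; first exact: compact_setX.
  by apply: (closed_comp _ (@closed_ge R e)) => z _; exact: cpsi.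
(* Where [g] varies by [e] or more the polynomial has a positive minimum, by compactness. *)
have [m m0 hm] : exists2 m, 0 < m & forall z, K z -> m <= phi z.
  have [K0|K0] := pselect (K !=set0); last by exists 1 => // z Kz; exfalso; apply: K0; exists z.
  have [|c cK' hc] := @compact_EVT_min _ R phi K K0 cK; first exact: continuous_subspaceT.
  exists (phi c) => [|z Kz]; last by apply: hc; rewrite inE.
  rewrite lt_neqAle phi_ge0 andbT.
  move: cK'; rewrite inE => -[[b1 b2] /= ec].
  apply: contraPneq ec => /esym/eqP; rewrite psumr_eq0; last by move=> i _; rewrite subr_ge0 cos_le1.
  move=> /allP h; rewrite /psi (@torus_fun_eq _ g c.1 c.2 cg.1).
  - by rewrite subrr normr0 leNgt e0.
  - by move=> i; have := b1 i; rewrite /= in_itv.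
  - by move=> i; have := b2 i; rewrite /= in_itv.
  - by move=> i; have := h i (mem_index_enum i); rewrite /= subr_eq0 => /eqP <-.
exists (2 * M / m); first by rewrite divr_ge0 ?mulr_ge0// ltW.
move=> x y; rewrite -(torus_repE x cg.1) -(torus_repE y cg.1).
have -> : \sum_i (1 - cos (x 0 i - y 0 i)) = phi (torus_rep x, torus_rep y).
  apply: eq_bigr => i _ /=; rewrite !mxE; congr (1 - _).
  rewrite -[LHS](@cosD2piz _ (- Num.floor (x 0 i / (pi *+ 2)) + Num.floor (y 0 i / (pi *+ 2)))).
  by congr cos; rewrite rmorphD rmorphN /=; ring.
have Cge : 0 <= 2 * M / m by rewrite divr_ge0 ?mulr_ge0// ltW.
have [hl|/ltW hl] := leP (psi (torus_rep x, torus_rep y)) e.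
  by apply: (le_trans hl); rewrite lerDl mulr_ge0.
have /hm hmz : K (torus_rep x, torus_rep y).
  by split=> //; split=> i /=; rewrite in_itv/=; exact: torus_rep_itv.
have : `|g (torus_rep x) - g (torus_rep y)| <= 2 * M.
  by apply: (le_trans (ler_normB _ _)); have := hM (torus_rep x); have := hM (torus_rep y); lra.
move=> /le_trans; apply; apply: (@le_trans _ _ (2 * M / m * m)).
  by rewrite divfK// gt_eqF.
by rewrite (le_trans (ler_wpM2l Cge hmz))// lerDr ltW.
Qed.

Definition box_freq d N (f : {ffun 'I_d -> 'I_N.+1}) : 'rV[int]_d := \row_i (f i : nat)%:Z.

Lemma box_freq_inj d N : injective (@box_freq d N).
Proof.
by move=> f g /rowP fg; apply/ffunP => i; apply/val_inj; have := fg i; rewrite !mxE => -[].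
Qed.

Lemma box_freqB_cube d N (f h : {ffun 'I_d -> 'I_N.+1}) : box_freq f - box_freq h \in cube d N.
Proof.
rewrite mem_cube; apply/forallP => i; rewrite !mxE.
have := ltn_ord (f i); have := ltn_ord (h i).
by move: (nat_of_ord (f i)) (nat_of_ord (h i)) => a b; rewrite ler_norml; lia.
Qed.

(** Up to normalization this is the Fejer kernel of the torus, the squared modulus
of the Dirichlet sum over the box [{0, ..., N}^d]. *)
Definition fejer d N (z : 'rV[R]_d) : R :=
  \sum_(f : {ffun 'I_d -> 'I_N.+1}) \sum_(h : {ffun 'I_d -> 'I_N.+1})
    cosm (box_freq f - box_freq h) z.

Lemma fejer_ge0 d N (z : 'rV[R]_d) : 0 <= fejer N z.
Proof.
rewrite (_ : fejer N z = (\sum_(f : {ffun 'I_d -> 'I_N.+1}) cosm (box_freq f) z) ^+ 2 +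
   (\sum_(f : {ffun 'I_d -> 'I_N.+1}) sinm (box_freq f) z) ^+ 2); first by rewrite addr_ge0 ?sqr_ge0.
rewrite !expr2 !mulr_suml -big_split/=; apply: eq_bigr => f _.
rewrite !mulr_sumr -big_split/=; apply: eq_bigr => h _.
by rewrite /cosm /sinm phaseBl cosB.
Qed.

Lemma cosmB d m (x y : 'rV[R]_d) :
  cosm m (x - y) = cosm m x * cosm m y + sinm m x * sinm m y.
Proof. by rewrite /cosm /sinm -(scaleN1r y) phaseD phaseZ mulN1r cosB. Qed.

Lemma torus_cont_cosmB d m (x : 'rV[R]_d) : torus_cont (fun y => cosm m (x - y)).
Proof.
by under eq_fun do rewrite cosmB; apply: torus_contD; apply: torus_contZ.
Qed.
Local Hint Resolve torus_cont_cosmB : core.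

Lemma torus_int_cosmB d m (x : 'rV[R]_d) :
  torus_int (fun y => cosm m (x - y)) = (m == 0)%:R * (pi *+ 2) ^+ d.
Proof.
under eq_fun do rewrite cosmB.
rewrite torus_intD ?torus_intZ//; try by auto.
rewrite torus_int_cosm torus_int_sinm mulr0 addr0.
by case: eqP => [->|_]; rewrite ?cosm0 ?mul1r// !mul0r mulr0.
Qed.

Lemma torus_cont_fejer d N (x : 'rV[R]_d) : torus_cont (fun y => fejer N (x - y)).
Proof. by do 2 (apply: torus_cont_sum => ? _). Qed.
Local Hint Resolve torus_cont_fejer : core.

Lemma torus_int_fejer d N (x : 'rV[R]_d) :
  torus_int (fun y => fejer N (x - y)) = N.+1%:R ^+ d * (pi *+ 2) ^+ d.
Proof.
rewrite torus_int_sum; last by move=> f _; apply: torus_cont_sum.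
under eq_bigr do rewrite torus_int_sum//.
under eq_bigr => f _.
  under eq_bigr => h _ do rewrite torus_int_cosmB subr_eq0 (inj_eq (@box_freq_inj d N)).
  rewrite -mulr_suml (bigD1 f)//= eqxx big1 ?addr0; last first.
    by move=> h /negbTE; rewrite eq_sym => ->.
  over.
by rewrite -mulr_suml sumr_const card_ffun !card_ord natrX.
Qed.

Lemma card_ffun_coord0 d N (i : 'I_d) :
  #|[pred f : {ffun 'I_d -> 'I_N.+1} | f i == ord0]| = (N.+1 ^ d.-1)%N.
Proof.
pose F j : pred 'I_N.+1 := if j == i then pred1 ord0 else predT.
rewrite (@eq_card _ _ (family F)); last first.
  move=> f; rewrite !inE; apply/idP/familyP => [/eqP fi j|/(_ i)].
    by rewrite /F; case: eqP => [->|_]; rewrite inE ?fi.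
  by rewrite /F eqxx inE.
rewrite card_family foldrE big_map big_enum /= (bigD1 i)//= /F eqxx card1 mul1n.
rewrite (eq_bigr (fun=> N.+1)); last by move=> j /negbTE ->; rewrite cardT size_enum_ord.
by rewrite prod_nat_const cardC1 card_ord.
Qed.

(** The left-hand side is the number of points of the box whose neighbour in the
direction [- e_i] is in the box too, and each of them gives a pair. Thus the mode
[e_i] has nearly the same weight in the Fejer kernel as the mode [0]. *)
Lemma count_box_neighbours d N (i : 'I_d) :
  N.+1%:R ^+ d - N.+1%:R ^+ d.-1 <=
  \sum_(f : {ffun 'I_d -> 'I_N.+1}) \sum_(h : {ffun 'I_d -> 'I_N.+1})
    (box_freq f - box_freq h == delta_mx 0 i)%:R :> R.
Proof.
have -> : N.+1%:R ^+ d - N.+1%:R ^+ d.-1 =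
    \sum_(f : {ffun 'I_d -> 'I_N.+1}) (f i != ord0)%:R :> R.
  have E := cardC [pred f : {ffun 'I_d -> 'I_N.+1} | f i == ord0].
  rewrite card_ffun_coord0 card_ffun !card_ord in E.
  rewrite -!natrX -E natrD addrC addKr -natr_sum -sum1_card big_mkcond /=.
  by congr _%:R; apply: eq_bigr => f _; rewrite !inE.
apply: ler_sum => f _.
have [fi|fi] := eqVneq (f i) ord0; first by apply: sumr_ge0.
have fi1 : ((f i).-1 < N.+1)%N by rewrite (leq_ltn_trans (leq_pred _)).
pose h := [ffun j => if j == i then Ordinal fi1 else f j].
rewrite (bigD1 h)//= (_ : (_ - _ == _)) ?lerDl ?sumr_ge0//.
apply/eqP/rowP => j; rewrite !mxE ffunE eqxx /=; case: (j =P i) => [->|_] /=; last by rewrite subrr.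
have : (0 < f i)%N by rewrite lt0n.
by move: (nat_of_ord (f i)) => a; lia.
Qed.

(** The kernel concentrates on the lattice of periods. Multiplication by [1 - cos z_i]
leaves the difference between the weights of the modes [0] and [e_i], of lower order
than the mass of the kernel. *)
Lemma torus_int_1Bcos_fejer d N (i : 'I_d) (x : 'rV[R]_d) :
  torus_int (fun y => (1 - cos (x 0 i - y 0 i)) * fejer N (x - y)) <=
  N.+1%:R ^+ d.-1 * (pi *+ 2) ^+ d.
Proof.
pose e : 'rV[int]_d := delta_mx 0 i.
have E m (y : 'rV[R]_d) : cos (x 0 i - y 0 i) * cosm m (x - y) =
   2^-1 * (cosm (e - m) (x - y) + cosm (e + m) (x - y)).
  rewrite -cosm_cosm {2}/cosm phase_delta; congr (cos _ * _).
  by rewrite !mxE.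
rewrite (_ : (fun y => _) = (fun y => fejer N (x - y) -
    \sum_(f : {ffun 'I_d -> 'I_N.+1}) \sum_(h : {ffun 'I_d -> 'I_N.+1})
      2^-1 * (cosm (e - (box_freq f - box_freq h)) (x - y) +
              cosm (e + (box_freq f - box_freq h)) (x - y)))); last first.
  apply/funext => y; rewrite mulrBl mul1r; congr (_ - _).
  rewrite /fejer mulr_sumr; apply: eq_bigr => f _.
  by rewrite mulr_sumr; apply: eq_bigr => h _; rewrite E.
have C1 (f h : {ffun 'I_d -> 'I_N.+1}) : torus_cont (fun y : 'rV[R]_d =>
    2^-1 * (cosm (e - (box_freq f - box_freq h)) (x - y) +
            cosm (e + (box_freq f - box_freq h)) (x - y))).
  by apply: torus_contZ; apply: torus_contD.
rewrite torus_intB//; last by do 2 (apply: torus_cont_sum => ? _).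
rewrite torus_int_fejer torus_int_sum; last by move=> ? _; apply: torus_cont_sum => ? _.
under eq_bigr => f _.
  rewrite torus_int_sum//.
  under eq_bigr => h _.
    rewrite torus_intZ ?torus_intD ?torus_int_cosmB//; last by auto.
    rewrite subr_eq0 addr_eq0 opprB -mulrDl mulrA (eq_sym e) (eq_sym e).
    over.
  rewrite -mulr_suml -mulr_sumr big_split /=.
  over.
rewrite /= -mulr_suml -mulr_sumr big_split /= [X in _ * (_ + X) * _]exchange_big /=.
set S := \sum_f _; have := count_box_neighbours N i; rewrite -/e -/S => hS.
rewrite (_ : 2^-1 * (S + S) = S); last by lra.
rewrite -mulrBl; apply: ler_wpM2r; first by rewrite exprn_ge0 ?ltW ?pi2_gt0.
by rewrite lerBlDr -lerBlDl.
Qed.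

(** A nonnegative kernel with concentrated mass reproduces functions with a given modulus
of continuity. *)
Lemma fejer_convolution d N (g : 'rV[R]_d -> R) (e C : R) : torus_cont g -> 0 <= C ->
  (forall x y, `|g x - g y| <= e + C * \sum_i (1 - cos (x 0 i - y 0 i))) ->
  forall x, `|N.+1%:R ^+ d * (pi *+ 2) ^+ d * g x - torus_int (fun y => g y * fejer N (x - y))| <=
    (e * N.+1%:R ^+ d + C * d%:R * N.+1%:R ^+ d.-1) * (pi *+ 2) ^+ d.
Proof.
move=> cg C0 hg x.
have cB : torus_cont (fun y : 'rV[R]_d => (g x - g y) * fejer N (x - y)).
  by apply: torus_contM => //; apply: torus_contB.
have Cx i : torus_cont (fun y : 'rV[R]_d => cos (x 0 i - y 0 i)).
  rewrite (_ : (fun y => _) = (fun y => cosm (delta_mx 0 i) (x - y)))//.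
  by apply/funext => y; rewrite /cosm phase_delta !mxE.
rewrite -(torus_int_fejer _ x); have -> : torus_int (fun y => fejer N (x - y)) * g x -
    torus_int (fun y => g y * fejer N (x - y)) = torus_int (fun y => (g x - g y) * fejer N (x - y)).
  rewrite mulrC -torus_intZ// -torus_intB; try by auto.
  by congr torus_int; apply/funext => y; rewrite mulrBl.
have cR : torus_cont (fun y : 'rV[R]_d => e * fejer N (x - y) +
     C * \sum_i (1 - cos (x 0 i - y 0 i)) * fejer N (x - y)).
  apply: torus_contD; apply: torus_contZ => //.
  by apply: torus_cont_sum => i _; apply: torus_contM => //; apply: torus_contB.
apply: (@le_trans _ _ (torus_int (fun y => e * fejer N (x - y) +
     C * \sum_i (1 - cos (x 0 i - y 0 i)) * fejer N (x - y)))).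
  have key y : `|(g x - g y) * fejer N (x - y)| <= e * fejer N (x - y) +
     C * \sum_i (1 - cos (x 0 i - y 0 i)) * fejer N (x - y).
    rewrite normrM (ger0_norm (fejer_ge0 _ _)) -mulr_suml mulrA -mulrDl.
    by rewrite ler_wpM2r// fejer_ge0.
  rewrite ler_norml -torus_intN//.
  apply/andP; split; apply: torus_int_le => //; first exact: torus_contN.
    by move=> y; have := key y; rewrite ler_norml => /andP[].
  by move=> y; have := key y; rewrite ler_norml => /andP[].
have cS i : torus_cont (fun y : 'rV[R]_d => (1 - cos (x 0 i - y 0 i)) * fejer N (x - y)).
  by apply: torus_contM => //; apply: torus_contB.
rewrite torus_intD; try by [apply: torus_contZ | apply: torus_contZ; apply: torus_cont_sum].
rewrite !torus_intZ//; try by apply: torus_cont_sum.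
rewrite torus_int_fejer torus_int_sum// mulrDl mulrA lerD2l -!mulrA ler_wpM2l//.
apply: (@le_trans _ _ (\sum_(i < d) N.+1%:R ^+ d.-1 * (pi *+ 2) ^+ d)).
  by apply: ler_sum => i _; exact: torus_int_1Bcos_fejer.
by rewrite sumr_const card_ord mulr_natl.
Qed.

(** The convolution is a trigonometric polynomial with the coefficients of [g], which makes
its pairing with [g] a combination of the squares [fpair g g k]. *)
Lemma fejer_convolutionE d N (g : 'rV[R]_d -> R) x : torus_cont g ->
  torus_int (fun y => g y * fejer N (x - y)) =
  \sum_(f : {ffun 'I_d -> 'I_N.+1}) \sum_(h : {ffun 'I_d -> 'I_N.+1})
    (cosc g (box_freq f - box_freq h) * cosm (box_freq f - box_freq h) x +
     sinc g (box_freq f - box_freq h) * sinm (box_freq f - box_freq h) x).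
Proof.
move=> cg.
under eq_fun => y.
  rewrite /fejer mulr_sumr.
  under eq_bigr do rewrite mulr_sumr.
  over.
have H (f h : {ffun 'I_d -> 'I_N.+1}) : torus_cont (fun y : 'rV[R]_d => g y * cosm (box_freq f - box_freq h) (x - y)) by exact: torus_contM.
rewrite torus_int_sum; last by move=> f _; apply: torus_cont_sum.
apply: eq_bigr => f _; rewrite torus_int_sum//; apply: eq_bigr => h _.
set m := box_freq f - box_freq h.
rewrite (_ : (fun y => _) = (fun y => cosm m x * (g y * cosm m y) + sinm m x * (g y * sinm m y))).
  by rewrite torus_intD ?torus_intZ// 1?mulrC 1?[X in _ + X]mulrC//; auto.
by apply/funext => y; rewrite cosmB; ring.
Qed.

Lemma ler_sum_subset (T : eqType) (s t : seq T) (F : T -> R) :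
  uniq s -> uniq t -> {subset s <= t} -> (forall k, 0 <= F k) ->
  \sum_(k <- s) F k <= \sum_(k <- t) F k.
Proof.
move=> us ut st F0; rewrite [leRHS](bigID (mem s))/= -[X in X + _]big_filter.
rewrite [X in _ <= X + _](perm_big s) ?lerDl ?sumr_ge0//=.
apply: uniq_perm; rewrite ?filter_uniq// => k.
by rewrite mem_filter; case: (boolP (k \in s)) => // /st ->.
Qed.

(** Parseval's identity, as the inequality opposite to Bessel's. The quadratic form
of the Fejer kernel is close to a multiple of the squared norm and is a
combination, with coefficients at most one, of the squared Fourier coefficients. *)
Lemma parseval d (g : 'rV[R]_d -> R) (e : R) : torus_cont g -> 0 < e ->
  exists N, torus_int (fun x => g x ^+ 2) <=
    (pi *+ 2) ^- d * \sum_(k <- cube d N) fpair g g k + e.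
Proof.
move=> cg e0; have [M M0 hM] := torus_cont_bounded cg.
pose P : R := (pi *+ 2) ^+ d.
have P0 : 0 < P by rewrite exprn_gt0// pi2_gt0.
(* The error of the convolution is counted twice and multiplied by [M]. *)
pose e1 := e / 2 / ((M + 1) * P).
have e10 : 0 < e1 by rewrite !divr_gt0// mulr_gt0//; lra.
have [C C0 hC] := torus_modulus cg e10.
have [N hN] : exists N : nat, C * d%:R / N.+1%:R <= e1.
  have [N _ hN] := near_infty_natSinv_lt (PosNum (divr_gt0 e10 (ltr_wpDl (mulr_ge0 C0 (ler0n R d)) ltr01))).
  exists N; have /= := hN N (leqnn _).
  rewrite ltr_pdivlMr; last by rewrite ltr_wpDl// mulr_ge0.
  by move/ltW/(le_trans _); apply; rewrite mulrC ler_wpM2l// lerDl.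
exists N; set S := \sum_(k <- _) _.
pose n : R := N.+1%:R ^+ d.
have n0 : 0 < n by rewrite exprn_gt0.
pose Tg x := torus_int (fun y => g y * fejer N (x - y)).
have cT : torus_cont Tg.
  rewrite /Tg; under eq_fun do rewrite fejer_convolutionE//.
  by do 2 (apply: torus_cont_sum => ? _); apply: torus_contD; apply: torus_contZ.
have TE : torus_int (fun x => g x * Tg x) = \sum_(f : {ffun 'I_d -> 'I_N.+1})
    \sum_(h : {ffun 'I_d -> 'I_N.+1}) fpair g g (box_freq f - box_freq h).
  under eq_fun do rewrite /Tg fejer_convolutionE// mulr_sumr.
  rewrite torus_int_sum; last first.
    move=> f _; apply: torus_contM => //; apply: torus_cont_sum => h _.
    by apply: torus_contD; apply: torus_contZ.
  apply: eq_bigr => f _; under eq_fun do rewrite mulr_sumr; rewrite torus_int_sum; last first.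
    by move=> h _; apply: torus_contM => //; apply: torus_contD; apply: torus_contZ.
  apply: eq_bigr => h _; set m := box_freq f - box_freq h.
  rewrite (_ : (fun x => _) = (fun x => cosc g m * (g x * cosm m x) + sinc g m * (g x * sinm m x))).
    by rewrite torus_intD ?torus_intZ//; auto.
  by apply/funext => x; ring.
have TS : torus_int (fun x => g x * Tg x) <= n * S.
  rewrite TE (_ : n * S = \sum_(f : {ffun 'I_d -> 'I_N.+1}) S); last first.
    by rewrite sumr_const card_ffun !card_ord -mulr_natl natrX.
  apply: ler_sum => f _.
  rewrite -(big_map (fun h => box_freq f - box_freq h) xpredT (fpair g g)).
  apply: ler_sum_subset; last exact: fpair_ge0.
  - by rewrite map_inj_uniq ?index_enum_uniq// => h h' /addrI /oppr_inj /box_freq_inj.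
  - exact: cube_uniq.
  - by move=> _ /mapP[h _ ->]; exact: box_freqB_cube.
pose E := e1 * n + C * d%:R * N.+1%:R ^+ d.-1.
have E2 : E <= 2 * e1 * n.
  suff : C * d%:R * N.+1%:R ^+ d.-1 <= e1 * n by rewrite /E; lra.
  move: hN; rewrite /n ler_pdivrMr//; case: (d) => [|d'] hN.
    by rewrite mulr0 mul0r expr0 mulr1 ltW.
  by rewrite exprS mulrA ler_wpM2r// exprn_ge0.
have : `|n * P * torus_int (fun x => g x ^+ 2) - torus_int (fun x => g x * Tg x)| <= M * (E * P) * P.
  have -> : n * P * torus_int (fun x => g x ^+ 2) - torus_int (fun x => g x * Tg x) =
      torus_int (fun x => g x * (n * P * g x - Tg x)).
    rewrite -torus_intZ; last exact: torus_contX.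
    rewrite -torus_intB//; [|by apply: torus_contZ; exact: torus_contX|by apply: torus_contM].
    by congr torus_int; apply/funext => x; ring.
  apply: torus_int_norm_le; first by apply: torus_contM => //; apply: torus_contB => //; apply: torus_contZ.
  move=> x; rewrite normrM; apply: ler_pM => //.
  exact: (fejer_convolution N cg C0 hC x).
rewrite ler_norml => /andP[_ h].
have {}h : n * P * torus_int (fun x => g x ^+ 2) <= n * S + M * (2 * e1 * n * P) * P.
  have : M * (E * P) * P <= M * (2 * e1 * n * P) * P.
    have P1 := ltW P0; by rewrite ler_wpM2r// ler_wpM2l// ler_wpM2r.
  by lra.
rewrite -(ler_pM2l (mulr_gt0 n0 P0)); apply: (le_trans h).
have Mn0 : M + 1 != 0 by rewrite gt_eqF// ltr_wpDl.
have -> : n * P * ((pi *+ 2) ^- d * S + e) = n * S + n * P * e.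
  by rewrite -/P; field; rewrite gt_eqF.
rewrite lerD2l (_ : M * (2 * e1 * n * P) * P = n * P * (e * (M / (M + 1)))); last first.
  by rewrite /e1; field; rewrite Mn0 gt_eqF.
apply: ler_wpM2l; first by rewrite mulr_ge0// ltW.
apply: ler_piMr; first exact: ltW.
by rewrite ler_pdivrMr; lra.
Qed.

(** * Energy forms *)

Lemma torus_fun_partial d (g : 'rV[R]_d -> R) i : torus_fun g -> torus_fun (partial i g).
Proof.
move=> tg x j; rewrite /partial.
have [|-> _] := @derive_shift _ _ g g (x + (pi *+ 2) *: basis_vec j) x (basis_vec i) (basis_vec i).
  by move=> h; rewrite addrA tg.
by [].
Qed.

Definition torus_C1 d (i : 'I_d) (g : 'rV[R]_d -> R) :=
  [/\ torus_cont g, forall x, derivable g x (basis_vec i) & torus_cont (partial i g)].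

Lemma torus_C1_cosm d i k : @torus_C1 d i (cosm k).
Proof.
have E : partial i (cosm k) = (fun x : 'rV[R]_d => (- (k 0 i)%:~R) * sinm k x).
  by apply/funext => x; rewrite /partial; have ? := is_derive_cosm k x i; rewrite derive_val mulNr.
split => //; last by rewrite E; exact: torus_contZ.
by move=> x; have [] := is_derive_cosm k x i.
Qed.

Lemma torus_C1_sinm d i k : @torus_C1 d i (sinm k).
Proof.
have E : partial i (sinm k) = (fun x : 'rV[R]_d => (k 0 i)%:~R * cosm k x).
  by apply/funext => x; rewrite /partial; have ? := is_derive_sinm k x i; rewrite derive_val.
split => //; last by rewrite E; exact: torus_contZ.
by move=> x; have [] := is_derive_sinm k x i.
Qed.

Lemma partialM d (g h : 'rV[R]_d -> R) i x :
  derivable g x (basis_vec i) -> derivable h x (basis_vec i) ->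
  partial i (fun x => g x * h x) x = partial i g x * h x + g x * partial i h x.
Proof. by move=> dg dh; rewrite /partial (deriveM dg dh) addrC mulrC. Qed.

(** The product of the two functions has a partial derivative of zero mean. *)
Lemma torus_ibp d (g h : 'rV[R]_d -> R) i : torus_C1 i g -> torus_C1 i h ->
  torus_int (fun x => partial i g x * h x) = - torus_int (fun x => g x * partial i h x).
Proof.
move=> [cg dg cdg] [ch dh cdh].
have E : partial i (fun x => g x * h x) = (fun x => partial i g x * h x + g x * partial i h x).
  by apply/funext => x; exact: partialM.
have := @torus_int_partial d (fun x => g x * h x) i.
rewrite E torus_intD; try by exact: torus_contM.
move=> /(_ (torus_contM cg ch)) H; apply/eqP; rewrite -addr_eq0; apply/eqP/H.
  by move=> x; exact: derivableM.
by apply: torus_contD; exact: torus_contM.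
Qed.

(** Together with [sinc_partial]: differentiation multiplies the complex coefficient by
[i k]. *)
Lemma cosc_partial d (g : 'rV[R]_d -> R) i k : torus_C1 i g ->
  cosc (partial i g) k = (k 0 i)%:~R * sinc g k.
Proof.
move=> g1; rewrite /cosc torus_ibp//; last exact: torus_C1_cosm.
rewrite -torus_intN; last by apply: torus_contM; [case: g1|case: (torus_C1_cosm i k)].
rewrite -torus_intZ; last by apply: torus_contM; case: g1.
congr torus_int; apply/funext => x; rewrite /partial.
by have ? := is_derive_cosm k x i; rewrite derive_val; ring.
Qed.

Lemma sinc_partial d (g : 'rV[R]_d -> R) i k : torus_C1 i g ->
  sinc (partial i g) k = - ((k 0 i)%:~R * cosc g k).
Proof.
move=> g1; rewrite /sinc torus_ibp//; last exact: torus_C1_sinm.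
rewrite -torus_intZ; last by apply: torus_contM; case: g1.
congr (- torus_int _); apply/funext => x; rewrite /partial.
by have ? := is_derive_sinm k x i; rewrite derive_val; ring.
Qed.

Lemma cosc_add d (g h : 'rV[R]_d -> R) k : torus_cont g -> torus_cont h ->
  cosc (fun x => g x + h x) k = cosc g k + cosc h k.
Proof. by move=> cg ch; rewrite /cosc -torus_intD//; auto; under eq_fun do rewrite mulrDl. Qed.

Lemma sinc_add d (g h : 'rV[R]_d -> R) k : torus_cont g -> torus_cont h ->
  sinc (fun x => g x + h x) k = sinc g k + sinc h k.
Proof. by move=> cg ch; rewrite /sinc -torus_intD//; auto; under eq_fun do rewrite mulrDl. Qed.

Lemma cosc_scale d c (g : 'rV[R]_d -> R) k : torus_cont g ->
  cosc (fun x => c * g x) k = c * cosc g k.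
Proof. by move=> cg; rewrite /cosc -torus_intZ//; auto; under eq_fun do rewrite -mulrA. Qed.

Lemma sinc_scale d c (g : 'rV[R]_d -> R) k : torus_cont g ->
  sinc (fun x => c * g x) k = c * sinc g k.
Proof. by move=> cg; rewrite /sinc -torus_intZ//; auto; under eq_fun do rewrite -mulrA. Qed.

(** The common features of the inner product of L^2 and of its filtered versions
that the energy balance of the Navier-Stokes equations relies on. *)
Record energy_form d (B : ('rV[R]_d -> R) -> ('rV[R]_d -> R) -> R) : Prop := EnergyForm {
  form_sym : forall g h, B g h = B h g;
  form_add : forall g g' h, torus_cont g -> torus_cont g' -> torus_cont h ->
    B (fun x => g x + g' x) h = B g h + B g' h;
  form_scale : forall c g h, torus_cont g -> torus_cont h ->
    B (fun x => c * g x) h = c * B g h;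
  form_skew : forall i g h, torus_C1 i g -> torus_C1 i h ->
    B (partial i g) h = - B g (partial i h);
  form_cont : forall a b (g h : R -> 'rV[R]_d -> R),
    jointly_cont `]a, b[ g -> jointly_cont `]a, b[ h ->
    {in `]a, b[, continuous (fun s => B (g s) (h s))};
  form_derive : forall a b (g dg : R -> 'rV[R]_d -> R),
    jointly_cont `]a, b[ g -> jointly_cont `]a, b[ dg ->
    (forall s x, s \in `]a, b[ -> is_derive s 1 (g ^~ x) (dg s x)) ->
    forall s, s \in `]a, b[ -> is_derive s 1 (fun s => B (g s) (g s)) (2 * B (dg s) (g s))
}.

Lemma jointly_contM d I (g h : R -> 'rV[R]_d -> R) : jointly_cont I g -> jointly_cont I h ->
  jointly_cont I (fun s x => g s x * h s x).
Proof.
move=> [tg cg] [th ch]; split; first by move=> s Is x i; rewrite tg// th.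
by move=> s x Is; exact: (cvgM (cg s x Is) (ch s x Is)).
Qed.

Lemma jointly_contD d I (g h : R -> 'rV[R]_d -> R) : jointly_cont I g -> jointly_cont I h ->
  jointly_cont I (fun s x => g s x + h s x).
Proof.
move=> [tg cg] [th ch]; split; first by move=> s Is x i; rewrite tg// th.
by move=> s x Is; exact: (cvgD (cg s x Is) (ch s x Is)).
Qed.

Lemma jointly_cont_sum d I (J : Type) (r : seq J) (g : J -> R -> 'rV[R]_d -> R) :
  (forall j, jointly_cont I (g j)) -> jointly_cont I (fun s x => \sum_(j <- r) g j s x).
Proof.
move=> cg; elim: r => [|j r IH].
  by under eq_fun do under eq_fun do rewrite big_nil; apply: jointly_cont_cst.
by under eq_fun do under eq_fun do rewrite big_cons; exact: jointly_contD.
Qed.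

Definition l2form d (g h : 'rV[R]_d -> R) := torus_int (fun x => g x * h x).

Lemma energy_form_l2 d : energy_form (@l2form d).
Proof.
split.
- by move=> g h; congr torus_int; apply/funext => x; rewrite mulrC.
- move=> g g' h cg cg' ch; rewrite /l2form -torus_intD; try by auto.
  by congr torus_int; apply/funext => x; rewrite mulrDl.
- move=> c g h cg ch; rewrite /l2form -torus_intZ; try by auto.
  by congr torus_int; apply/funext => x; rewrite mulrA.
- by move=> i g h g1 h1; exact: torus_ibp.
- by move=> a b g h cg ch; apply: jointly_cont_int; exact: jointly_contM.
- move=> a b g dg cg cdg hd s sab.
  rewrite /l2form -torus_intZ; last by apply: torus_contM; [exact: (jointly_contl cdg)|exact: (jointly_contl cg)].
  apply: (@is_derive_torus_int d a b (fun s x => g s x * g s x) (fun s x => 2 * (dg s x * g s x))) => //.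
  + exact: jointly_contM.
  + apply: (@jointly_contM _ _ (fun _ _ => 2)); first exact: jointly_cont_cst.
    exact: jointly_contM.
  + move=> r x rab; have h := hd r x rab.
    by apply: (is_derive_eq (is_deriveM h h)); rewrite /GRing.scale/=; ring.
Qed.

Lemma is_derive_sqr (F : R -> R) (s dF : R) : is_derive s 1 F dF ->
  is_derive s 1 (fun s => F s * F s) (2 * (dF * F s)).
Proof.
by move=> h; apply: (is_derive_eq (is_deriveM h h)); rewrite /GRing.scale/=; ring.
Qed.

Definition filtered_form d (w : 'rV[int]_d -> R) N (g h : 'rV[R]_d -> R) :=
  (pi *+ 2) ^- d * \sum_(k <- cube d N) w k * fpair g h k.

Lemma jointly_contZr d a b (g : R -> 'rV[R]_d -> R) h : jointly_cont `]a, b[ g -> torus_cont h ->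
  jointly_cont `]a, b[ (fun s x => g s x * h x).
Proof. by move=> cg ch; apply: jointly_contM => //; exact: jointly_cont_cst. Qed.

Lemma is_derive_sum_seq (T : Type) (r : seq T) (F : T -> R -> R) (dF : T -> R) (s : R) :
  (forall k, is_derive s 1 (F k) (dF k)) ->
  is_derive s 1 (fun s => \sum_(k <- r) F k s) (\sum_(k <- r) dF k).
Proof.
move=> h; elim: r => [|k r IH].
  by under eq_fun do rewrite big_nil; rewrite big_nil; exact: is_derive_cst.
by under eq_fun do rewrite big_cons; rewrite big_cons; exact: is_deriveD.
Qed.

Lemma is_deriveZl (c : R) (F : R -> R) (s dF : R) : is_derive s 1 F dF ->
  is_derive s 1 (fun s => c * F s) (c * dF).
Proof. exact: is_deriveZ. Qed.

Lemma energy_form_filtered d w N : energy_form (@filtered_form d w N).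
Proof.
split.
- move=> g h; congr (_ * _); apply: eq_bigr => k _; rewrite /fpair.
  by rewrite (mulrC (cosc g k)) (mulrC (sinc g k)).
- move=> g g' h cg cg' ch; rewrite /filtered_form -mulrDr -big_split/=; congr (_ * _).
  by apply: eq_bigr => k _; rewrite /fpair cosc_add// sinc_add//; ring.
- move=> c g h cg ch; rewrite /filtered_form mulrCA; congr (_ * _); rewrite mulr_sumr.
  by apply: eq_bigr => k _; rewrite /fpair cosc_scale// sinc_scale//; ring.
- move=> i g h g1 h1; rewrite /filtered_form -mulrN -sumrN; congr (_ * _).
  apply: eq_bigr => k _; rewrite /fpair !cosc_partial// !sinc_partial//; ring.
- move=> a b g h cg ch s sab; apply: (cvgM (cvg_cst _)).
  apply: (@cvg_sum_seq _ _ (nbhs s)) => k _; apply: (cvgM (cvg_cst _)).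
  apply: cvgD; apply: cvgM.
  + by apply: (@jointly_cont_int d a b (fun s x => g s x * cosm k x)) => //; exact: jointly_contZr.
  + by apply: (@jointly_cont_int d a b (fun s x => h s x * cosm k x)) => //; exact: jointly_contZr.
  + by apply: (@jointly_cont_int d a b (fun s x => g s x * sinm k x)) => //; exact: jointly_contZr.
  + by apply: (@jointly_cont_int d a b (fun s x => h s x * sinm k x)) => //; exact: jointly_contZr.
- move=> a b g dg cg cdg hd s sab.
  rewrite [2 * _]mulrCA mulr_sumr.
  apply: is_deriveZl; apply: is_derive_sum_seq => k.
  rewrite mulrCA; apply: is_deriveZl; rewrite /fpair mulrDr.
  have dm (m : 'rV[R]_d -> R) : torus_cont m ->
      is_derive s 1 (fun s => torus_int (fun x => g s x * m x)) (torus_int (fun x => dg s x * m x)).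
    move=> cm; apply: (@is_derive_torus_int d a b (fun s x => g s x * m x) (fun s x => dg s x * m x)) => //; try exact: jointly_contZr.
    move=> r x rab; have h := hd r x rab.
    rewrite (_ : (fun r => g r x * m x) = (fun r => m x * g r x)) 1?mulrC; first exact: is_deriveZl.
    by apply/funext => t; rewrite mulrC.
  by apply: is_deriveD; apply: is_derive_sqr; exact: dm.
Qed.

Definition form_sub d (B B' : ('rV[R]_d -> R) -> ('rV[R]_d -> R) -> R) g h := B g h - B' g h.

Lemma energy_form_sub d (B B' : ('rV[R]_d -> R) -> ('rV[R]_d -> R) -> R) :
  energy_form B -> energy_form B' -> energy_form (form_sub B B').
Proof.
move=> [s1 a1 z1 k1 c1 d1] [s2 a2 z2 k2 c2 d2]; split; rewrite /form_sub.
- by move=> g h; rewrite s1 s2.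
- by move=> g g' h cg cg' ch; rewrite a1// a2//; ring.
- by move=> c g h cg ch; rewrite z1// z2//; ring.
- by move=> i g h g1 h1; rewrite k1// k2//; ring.
- by move=> a b g h cg ch s sab; exact: (cvgB (c1 a b g h cg ch s sab) (c2 a b g h cg ch s sab)).
- move=> a b g dg cg cdg hd s sab; rewrite mulrBr.
  exact: (is_deriveB (d1 a b g dg cg cdg hd s sab) (d2 a b g dg cg cdg hd s sab)).
Qed.

(** * The Littlewood-Paley cutoff *)

Definition lp_symbol d (chi : 'rV[R]_d -> R) q (k : 'rV[int]_d) : R := chi (2 ^- q.+1 *: freq k).

Lemma enorm_sqr d (x : 'rV[R]_d) : enorm x ^+ 2 = dot x x.
Proof. by rewrite sqr_sqrtr// sumr_ge0// => i _; rewrite -expr2 sqr_ge0. Qed.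

Lemma enorm_ge0 d (x : 'rV[R]_d) : 0 <= enorm x.
Proof. exact: sqrtr_ge0. Qed.

Lemma enorm_ge_coord d (x : 'rV[R]_d) i : `|x 0 i| <= enorm x.
Proof.
rewrite -(@ler_pXn2r _ 2)// ?nnegrE ?enorm_ge0// enorm_sqr real_normK ?num_real//.
by rewrite /dot (bigD1 i)//= -expr2 lerDl sumr_ge0// => j _; rewrite -expr2 sqr_ge0.
Qed.

Lemma enorm_le_sum d (x : 'rV[R]_d) (M : R) : 0 <= M -> (forall i, `|x 0 i| <= M) ->
  enorm x <= d%:R * M.
Proof.
move=> M0 h; have dM : 0 <= d%:R * M by rewrite mulr_ge0.
rewrite -(@ler_pXn2r _ 2)// ?nnegrE ?enorm_ge0// enorm_sqr exprMn.
apply: (@le_trans _ _ (\sum_(i < d) M ^+ 2)).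
  apply: ler_sum => i _; rewrite -expr2 -real_normK ?num_real//.
  by rewrite ler_pXn2r// nnegrE.
rewrite sumr_const card_ord -[leLHS]mulr_natl; apply: ler_wpM2r; first exact: sqr_ge0.
by rewrite -natrX ler_nat; case: (d) => // n; rewrite expnS expn1 leq_pmull.
Qed.

Lemma lp_symbol_even d (chi : 'rV[R]_d -> R) q k : LP_cutoff chi ->
  lp_symbol chi q (- k) = lp_symbol chi q k.
Proof.
move=> [_ mono _ _]; rewrite /lp_symbol.
have -> : 2 ^- q.+1 *: freq (- k) = - (2 ^- q.+1 *: freq k) :> 'rV[R]_d.
  by rewrite -scalerN; congr (_ *: _); apply/rowP => i; rewrite !mxE rmorphN.
have E : enorm (- (2 ^- q.+1 *: freq k)) = enorm (2 ^- q.+1 *: freq k) :> R.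
  by congr Num.sqrt; apply: eq_bigr => i _; rewrite mxE mulrNN.
by apply/eqP; rewrite eq_le !mono ?E.
Qed.

Lemma lp_symbol_out d (chi : 'rV[R]_d -> R) q k : LP_cutoff chi ->
  k \notin cube d (2 ^ q.+1) -> lp_symbol chi q k = 0.
Proof.
move=> [_ _ _ chi0]; rewrite mem_cube negb_forall; case/existsP => i.
rewrite -ltNge => ki; apply: chi0; apply: (le_trans _ (enorm_ge_coord _ i)).
rewrite !mxE normrM gtr0_norm ?invr_gt0 ?exprn_gt0// mulrC ler_pdivlMr ?exprn_gt0// mul1r.
by rewrite -natrX -intr_norm pmulrn ler_int ltW.
Qed.

Lemma symbol_lp d (chi : 'rV[R]_d -> R) q : LP_cutoff chi ->
  symbol (2 ^ q.+1) (lp_symbol chi q).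
Proof. by move=> h; split=> k; [exact: lp_symbol_even|exact: lp_symbol_out]. Qed.

Lemma lp_symbol_itv d (chi : 'rV[R]_d -> R) q k : (0 < d)%N -> LP_cutoff chi ->
  0 <= lp_symbol chi q k <= 1.
Proof.
move=> d0 [_ mono chi1 chi0]; set x := 2 ^- q.+1 *: freq k : 'rV[R]_d.
have e0 : enorm (0 : 'rV[R]_d) = 0.
  by rewrite /enorm /dot big1 ?sqrtr0// => i _; rewrite mxE mul0r.
apply/andP; split; last first.
  by rewrite -(chi1 0) ?e0 ?invr_ge0// mono// e0 enorm_ge0.
pose y : 'rV[R]_d := (1 + enorm x) *: basis_vec (Ordinal d0).
have y1 : 1 + enorm x <= enorm y.
  apply: (le_trans _ (enorm_ge_coord _ (Ordinal d0))).
  by rewrite !mxE !eqxx mulr1 ger0_norm// addr_ge0// enorm_ge0.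
have := enorm_ge0 x => x0.
by rewrite -(chi0 y) ?mono//; lra.
Qed.

(** On the cube of side [N] the Euclidean norm is at most [d N], and the cutoff is 1 up to
[2^q]. *)
Lemma lp_symbol1 d (chi : 'rV[R]_d -> R) q N k : LP_cutoff chi -> (d * N <= 2 ^ q)%N ->
  k \in cube d N -> lp_symbol chi q k = 1.
Proof.
move=> [_ _ chi1 _] dN; rewrite mem_cube => /forallP kN; apply: chi1.
apply: (@le_trans _ _ (d%:R * (2 ^- q.+1 * N%:R))).
  apply: enorm_le_sum => [|i]; first by rewrite mulr_ge0// invr_ge0 exprn_ge0.
  rewrite !mxE normrM gtr0_norm ?invr_gt0 ?exprn_gt0// ler_wpM2l ?invr_ge0 ?exprn_ge0//.
  by rewrite -intr_norm (pmulrn 1) ler_int.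
rewrite mulrCA -natrM exprS invfM -mulrA ler_piMr ?invr_ge0//.
by rewrite mulrC ler_pdivrMr ?exprn_gt0// mul1r -natrX ler_nat.
Qed.

Lemma ReD (x y : R[i]) : complex.Re (x + y) = complex.Re x + complex.Re y.
Proof. by case: x => a b; case: y. Qed.

(** The symbol is real and even, so that the complex series is the real multiplier. *)
Lemma lowpass_scalE d (chi : 'rV[R]_d -> R) q (g : 'rV[R]_d -> R) : LP_cutoff chi ->
  lowpass_scal chi q g = multiplier (lp_symbol chi q) (2 ^ q.+1) g.
Proof.
move=> hchi; apply/funext => x; rewrite /lowpass_scal /multiplier.
rewrite (@fsbigE _ _ _ _ _ (cube d (2 ^ q.+1))) ?cube_uniq//; last first.
  move=> k _ kN; rewrite -/(lp_symbol chi q k) lp_symbol_out//.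
  by rewrite -[Complex 0 0]/(0 : R[i]) !mul0r.
rewrite (eq_bigl xpredT); last by move=> k; rewrite in_setT.
rewrite (big_morph (@complex.Re R) ReD (erefl : complex.Re 0 = 0)) mulr_sumr.
apply: eq_bigr => k _; rewrite /fourier_coef /fourier_mode -/(phase k x) -/(cosm k x) -/(sinm k x).
rewrite -/(lp_symbol chi q k) -/(cosc g k) -/(sinc g k) /=.
by ring.
Qed.

Lemma sqmod_fourier_coef d (g : 'rV[R]_d -> R) k :
  sqmod (fourier_coef g k) = (pi *+ 2) ^- d ^+ 2 * fpair g g k.
Proof. by rewrite /sqmod /fourier_coef /= -/(cosc g k) -/(sinc g k) /fpair; ring. Qed.

(** * The defect of a filter *)

Lemma form_expand d (B : ('rV[R]_d -> R) -> ('rV[R]_d -> R) -> R) g h t :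
  energy_form B -> torus_cont g -> torus_cont h ->
  B (fun x => g x + t * h x) (fun x => g x + t * h x) = B g g + 2 * t * B g h + t ^+ 2 * B h h.
Proof.
move=> fB cg ch; have cth := torus_contZ t ch.
rewrite form_add//; last exact: torus_contD.
rewrite (form_sym fB g) form_add// (form_sym fB _ (fun x => g x + _)) form_add//.
rewrite !(form_scale fB)// (form_sym fB g (fun x => t * h x)) !(form_scale fB)// (form_sym fB h g).
by rewrite (form_sym fB h) (form_scale fB)//; ring.
Qed.

(** The defect forms are degenerate, so that the case [B h h = 0] is treated apart. *)
Lemma form_cauchy_schwarz d (B : ('rV[R]_d -> R) -> ('rV[R]_d -> R) -> R) g h :
  energy_form B -> (forall g, torus_cont g -> 0 <= B g g) ->
  torus_cont g -> torus_cont h -> B g h ^+ 2 <= B g g * B h h.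
Proof.
move=> fB pos cg ch.
have key t : 0 <= B g g + 2 * t * B g h + t ^+ 2 * B h h.
  by rewrite -form_expand//; apply: pos; apply: torus_contD => //; exact: torus_contZ.
have := pos h ch; rewrite le_eqVlt => /predU1P[h0|h0].
  have [->|gh] := eqVneq (B g h) 0; first by rewrite expr0n /= -h0 mulr0.
  have := key (- (B g g + 1) / (2 * B g h)); rewrite -h0.
  have -> : B g g + 2 * (- (B g g + 1) / (2 * B g h)) * B g h +
     (- (B g g + 1) / (2 * B g h)) ^+ 2 * 0 = -1 by field.
  by rewrite ler0N1.
have := key (- B g h / B h h).
have -> : B g g + 2 * (- B g h / B h h) * B g h + (- B g h / B h h) ^+ 2 * B h h =
   B g g - B g h ^+ 2 / B h h by field; rewrite gt_eqF.
by rewrite subr_ge0 ler_pdivrMr.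
Qed.

(** When [w] is close to 1 at low frequencies and 0 at high ones, this is the
high-frequency part of the L^2 product. *)
Definition defect d (w : 'rV[int]_d -> R) N := form_sub (@l2form d) (filtered_form w N).

Lemma energy_form_defect d w N : energy_form (@defect d w N).
Proof. by apply: energy_form_sub; [exact: energy_form_l2|exact: energy_form_filtered]. Qed.

Lemma l2formE d (g : 'rV[R]_d -> R) : l2form g g = torus_int (fun x => g x ^+ 2).
Proof. by congr torus_int; apply/funext => x; rewrite expr2. Qed.

Lemma l2form_ge0 d (g : 'rV[R]_d -> R) : 0 <= l2form g g.
Proof. by rewrite l2formE; apply: torus_int_ge0 => x; exact: sqr_ge0. Qed.

Lemma pi2V_ge0 d : 0 <= (pi *+ 2) ^- d :> R.
Proof. by rewrite invr_ge0 exprn_ge0// ltW// pi2_gt0. Qed.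

(** By Bessel's inequality. *)
Lemma defect_ge0 d w N (g : 'rV[R]_d -> R) : (forall k, w k <= 1) -> torus_cont g ->
  0 <= defect w N g g.
Proof.
move=> w1 cg; rewrite subr_ge0 l2formE; apply: le_trans (bessel N cg).
rewrite ler_wpM2l ?pi2V_ge0//; apply: ler_sum => k _.
by rewrite ler_piMl// fpair_ge0.
Qed.

Lemma defect_le d w N (g : 'rV[R]_d -> R) : (forall k, 0 <= w k) -> defect w N g g <= l2form g g.
Proof.
move=> w0; rewrite gerBl mulr_ge0 ?pi2V_ge0// sumr_ge0// => k _.
by rewrite mulr_ge0// fpair_ge0.
Qed.

Lemma defect_widen d w M N (g h : 'rV[R]_d -> R) : (forall k, k \notin cube d M -> w k = 0) ->
  (M <= N)%N -> defect w M g h = defect w N g h.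
Proof.
move=> wM MN; congr (_ - _ * _).
rewrite [RHS](bigID (mem (cube d M)))/= [X in _ + X]big1 ?addr0; last first.
  by move=> k /wM ->; rewrite mul0r.
rewrite -[RHS]big_filter; apply: perm_big; apply: uniq_perm; rewrite ?filter_uniq ?cube_uniq//.
by move=> k; rewrite mem_filter; case: (boolP (k \in cube d M)) => // /(cubeS MN) ->.
Qed.

(** By Parseval's identity: only the frequencies outside a large cube are left. *)
Lemma defect_small d (g : 'rV[R]_d -> R) (e : R) : torus_cont g -> 0 < e ->
  exists N, forall w M, (forall k, 0 <= w k) ->
    (forall k, k \in cube d N -> w k = 1) ->
    (N <= M)%N -> defect w M g g <= e.
Proof.
move=> cg e0; have [N hN] := parseval cg e0; exists N => w M w0 w1 NM.
rewrite /defect /form_sub l2formE lerBlDr addrC; apply: (le_trans hN).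
rewrite lerD2r ler_wpM2l ?pi2V_ge0//.
apply: (@le_trans _ _ (\sum_(k <- cube d N) w k * fpair g g k)).
  by rewrite !big_seq; apply: ler_sum => k kN; rewrite w1// mul1r.
apply: ler_sum_subset; [exact: cube_uniq|exact: cube_uniq|exact: cubeS|].
by move=> k; rewrite mulr_ge0// fpair_ge0.
Qed.

Lemma fpair_young d (g h : 'rV[R]_d -> R) k (a : R) : 0 < a ->
  `|fpair g h k| <= (a * fpair g g k + a^-1 * fpair h h k) / 2.
Proof.
move=> a0; have am : a * a^-1 = 1 by rewrite divff// gt_eqF.
have ai : 0 < a^-1 by rewrite invr_gt0.
have H (x y : R) : `|x * y| <= (a * x ^+ 2 + a^-1 * y ^+ 2) / 2.
  have h1 : 0 <= a * (x - a^-1 * y) ^+ 2 by rewrite mulr_ge0 ?sqr_ge0// ltW.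
  have h2 : 0 <= a * (x + a^-1 * y) ^+ 2 by rewrite mulr_ge0 ?sqr_ge0// ltW.
  have e1 : a * (x - a^-1 * y) ^+ 2 = a * x ^+ 2 - 2 * (a * a^-1) * (x * y) + (a * a^-1) * a^-1 * y ^+ 2 by ring.
  have e2 : a * (x + a^-1 * y) ^+ 2 = a * x ^+ 2 + 2 * (a * a^-1) * (x * y) + (a * a^-1) * a^-1 * y ^+ 2 by ring.
  rewrite am in e1; rewrite am in e2.
  by rewrite ler_norml; apply/andP; split; lra.
apply: (le_trans (ler_normD _ _)).
have := H (cosc g k) (cosc h k); have := H (sinc g k) (sinc h k).
by rewrite /fpair -!expr2; lra.
Qed.

(** The defect of a filter with symbol between 0 and 1 is controlled by any pair of
dual weighted norms. Only the frequencies up to a large cutoff matter, since the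
defect of the sharp cutoff tends to zero. *)
Lemma defect_dual_bound d w M (g h : 'rV[R]_d -> R) (a : 'rV[int]_d -> R) (U V : R) :
  torus_cont g -> torus_cont h ->
  (forall k, 0 <= w k <= 1) -> (forall k, k \notin cube d M -> w k = 0) ->
  (forall k, 0 < a k) ->
  (forall N, (pi *+ 2) ^- d * \sum_(k <- cube d N) a k * fpair g g k <= U) ->
  (forall N, (pi *+ 2) ^- d * \sum_(k <- cube d N) (a k)^-1 * fpair h h k <= V) ->
  `|defect w M g h| <= (U + V) / 2.
Proof.
move=> cg ch w01 wM a0 hU hV.
apply/ler_addgt0Pr => e e0.
(* With this bound on the defect at [g], Cauchy-Schwarz yields [e] at [g] and [h]. *)
pose E := e ^+ 2 / (l2form h h + 1).
have h0 := l2form_ge0 h.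
have E0 : 0 < E by rewrite divr_gt0 ?exprn_gt0//; lra.
have [N0 hN0] := defect_small cg E0.
pose N := maxn M N0.
pose one := fun _ : 'rV[int]_d => 1 : R.
have sharp : `|defect one N g h| <= e.
  rewrite -(@ler_pXn2r _ 2)// ?nnegrE ?(ltW e0)// real_normK ?num_real//.
  have pos (k : 'rV[R]_d -> R) : torus_cont k -> 0 <= defect one N k k by apply: defect_ge0.
  apply: (le_trans (form_cauchy_schwarz (energy_form_defect one N) pos cg ch)).
  apply: (@le_trans _ _ (E * (l2form h h + 1))); last by rewrite divfK// gt_eqF//; lra.
  apply: ler_pM; [exact: pos|exact: pos| |].
    by apply: hN0 => //; rewrite /N leq_maxr.
  by apply: (le_trans (@defect_le d one N h _)) => //; lra.
rewrite (@defect_widen _ _ _ N) ?leq_maxl//.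
have -> : defect w N g h = defect one N g h +
    (pi *+ 2) ^- d * \sum_(k <- cube d N) (1 - w k) * fpair g h k.
  rewrite /defect /form_sub /filtered_form -addrA; congr (_ + _).
  rewrite -mulrN -mulrN -mulrDr; congr (_ * _); rewrite -!sumrN -big_split/=.
  by apply: eq_bigr => k _; rewrite /one; ring.
rewrite (le_trans (ler_normD _ _))// addrC lerD//.
rewrite normrM ger0_norm ?pi2V_ge0//.
apply: (@le_trans _ _ ((pi *+ 2) ^- d * \sum_(k <- cube d N)
     (a k * fpair g g k + (a k)^-1 * fpair h h k) / 2)).
  rewrite ler_wpM2l ?pi2V_ge0// (le_trans (ler_norm_sum _ _ _))//.
  apply: ler_sum => k _; rewrite normrM.
  have /andP[wk0 wk1] := w01 k.
  apply: le_trans (fpair_young g h k (a0 k)).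
  by rewrite ler_piMl// ger0_norm; lra.
by rewrite -mulr_suml big_split/= mulrA mulrDr ler_wpM2r// lerD.
Qed.

(** * Smooth fields on the space-time cylinder *)

Lemma near_comp_fst (T : topologicalType) (a b : R) t (x : T) : t \in `]a, b[ ->
  \forall z \near (t, x), z.1 \in `]a, b[.
Proof. by move=> tab; exact: (cvg_fst (near_in_itvoo tab)). Qed.

(** Two-variable continuity at a point only sees times close to the given one. *)
Lemma continuous_slab (T U : topologicalType) (a b : R) (g h : R -> T -> U) :
  (forall t x, t \in `]a, b[ -> g t x = h t x) ->
  (forall t x, t \in `]a, b[ -> {for (t, x), continuous (fun z : R * T => g z.1 z.2)}) ->
  forall t x, t \in `]a, b[ -> {for (t, x), continuous (fun z : R * T => h z.1 z.2)}.
Proof.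
move=> gh cg t x tab; rewrite /prop_for /continuous_at /= -gh//.
apply: cvg_trans (cg t x tab); apply: near_eq_cvg.
near=> z; apply: gh; near: z; exact: near_comp_fst.
Unshelve. all: by end_near. Qed.

Lemma continuous_pair_eta (T1 T2 U : topologicalType) (h : T1 * T2 -> U) z :
  {for z, continuous h} -> {for z, continuous (fun z => h (z.1, z.2))}.
Proof. by move=> c; rewrite (_ : (fun z => h _) = h)//; apply/funext => -[]. Qed.

Section smooth_fields.
Variables (tau : R) (d : nat) (u : R -> 'rV[R]_d -> 'rV[R]_d).
Hypothesis su : smooth_QT tau u.

Let W (z : R * 'rV[R]_d) := u z.1 z.2.

Lemma smooth_itv t : t \in `]0, tau[ -> torus_fun (u t).
Proof. by rewrite in_itv/=; exact: su.1. Qed.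

Lemma continuous_coord2 (h : R -> 'rV[R]_d -> 'rV[R]_d) i t x :
  {for (t, x), continuous (fun z : R * 'rV[R]_d => h z.1 z.2)} ->
  {for (t, x), continuous (fun z : R * 'rV[R]_d => h z.1 z.2 0 i)}.
Proof.
move=> c; apply: (@continuous_cvg _ _ _ (nbhs (t, x)) _ (fun z : R * 'rV[R]_d => h z.1 z.2)
  (fun M : 'rV[R]_d => M 0 i) (h t x)); first exact: coord_continuous.
exact: c.
Qed.

Lemma smooth_C0 i : jointly_cont `]0, tau[ (fun t x => u t x 0 i).
Proof.
split; first by move=> s Is x j; rewrite smooth_itv.
move=> s x Is; have [c0 _] := su.2 0%N.
by apply: (@continuous_coord2 u); apply: (c0 (s, x)); split.
Qed.

(** Spatial derivatives at fixed time are space-time derivatives in the directions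
[(0, e_j)], whose joint continuity is part of smoothness. *)
Lemma smooth_partial t x i j : t \in `]0, tau[ ->
  derivable (fun y => u t y 0 i) x (basis_vec j) /\
  'D_(0, basis_vec j) W (t, x) 0 i = partial j (fun y => u t y 0 i) x.
Proof.
move=> It; have [_ h] := su.2 1%N; have [dW _] := h (0, basis_vec j).
have {}dW := dW (t, x) (conj It Logic.I).
have [|E1 E2] := @derive_shift _ _ (fun y => u t y 0 i) (fun z => W z 0 i) x (t, x)
  (basis_vec j) (0, basis_vec j).
  by move=> s; rewrite /W /= scaler0 add0r.
split; first by apply: E2; move/derivable_mxP : dW.
by rewrite /partial E1 derive_mx// mxE.
Qed.

Lemma smooth_C1 i j : jointly_cont `]0, tau[ (fun t x => partial j (fun y => u t y 0 i) x).
Proof.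
split; first by move=> s Is; apply: torus_fun_partial => x k; rewrite smooth_itv.
apply: (continuous_slab (fun t x It => (smooth_partial x i j It).2)) => t x It.
apply: (@continuous_coord2 (fun t x => 'D_(0, basis_vec j) W (t, x))).
have [_ h] := su.2 1%N; have [_ [c1 _]] := h (0, basis_vec j).
exact: (continuous_pair_eta (c1 (t, x) (conj It Logic.I))).
Qed.

Lemma smooth_partial2 t x i j l : t \in `]0, tau[ ->
  derivable (partial j (fun y => u t y 0 i)) x (basis_vec l) /\
  'D_(0, basis_vec l) ('D_(0, basis_vec j) W) (t, x) 0 i = partial l (partial j (fun y => u t y 0 i)) x.
Proof.
move=> It; have [_ h] := su.2 2%N; have [_ [_ h']] := h (0, basis_vec j).
have [dW _] := h' (0, basis_vec l).
have {}dW := dW (t, x) (conj It Logic.I).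
have [|E1 E2] := @derive_shift _ _ (partial j (fun y => u t y 0 i))
  (fun z => 'D_(0, basis_vec j) W z 0 i) x (t, x) (basis_vec l) (0, basis_vec l).
  move=> s; rewrite -(smooth_partial _ i j It).2.
  have -> // : s *: (0, basis_vec l) + (t, x) = (t, s *: basis_vec l + x) :> R * 'rV[R]_d.
  by apply: injective_projections => //=; rewrite scaler0 add0r.
split; first by apply: E2; move/derivable_mxP : dW.
by rewrite /partial E1 derive_mx// mxE.
Qed.

Lemma smooth_C2 i j l :
  jointly_cont `]0, tau[ (fun t x => partial l (partial j (fun y => u t y 0 i)) x).
Proof.
split; first by move=> s Is; do 2 apply: torus_fun_partial; move=> x k; rewrite smooth_itv.
apply: (continuous_slab (fun t x It => (smooth_partial2 x i j l It).2)) => t x It.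
apply: (@continuous_coord2 (fun t x => 'D_(0, basis_vec l) ('D_(0, basis_vec j) W) (t, x))).
have [_ h] := su.2 2%N; have [_ [_ h']] := h (0, basis_vec j).
have [_ [c1 _]] := h' (0, basis_vec l).
exact: (continuous_pair_eta (c1 (t, x) (conj It Logic.I))).
Qed.

Lemma smooth_dt t x i : t \in `]0, tau[ ->
  derivable (fun s => u s x 0 i) t 1 /\
  'D_(1, 0) W (t, x) 0 i = derive1 (fun s => u s x 0 i) t.
Proof.
move=> It; have [_ h] := su.2 1%N; have [dW _] := h (1, 0).
have {}dW := dW (t, x) (conj It Logic.I).
have [|E1 E2] := @derive_shift _ _ (fun s => u s x 0 i) (fun z => W z 0 i) t (t, x) 1 (1, 0).
  by move=> s; rewrite /W /= scaler0 add0r.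
split; first by apply: E2; move/derivable_mxP : dW.
by rewrite derive1E E1 derive_mx// mxE.
Qed.

Lemma smooth_Ct i : jointly_cont `]0, tau[ (fun t x => derive1 (fun s => u s x 0 i) t).
Proof.
split.
  move=> s Is x k; rewrite !derive1E; apply: near_eq_derive.
  have := near_in_itvoo Is; apply: filterS => r Ir.
  by rewrite smooth_itv.
apply: (continuous_slab (fun t x It => (smooth_dt x i It).2)) => t x It.
apply: (@continuous_coord2 (fun t x => 'D_(1, 0) W (t, x))).
have [_ h] := su.2 1%N; have [_ [c1 _]] := h (1, 0).
exact: (continuous_pair_eta (c1 (t, x) (conj It Logic.I))).
Qed.

Lemma smooth_is_derive t x i : t \in `]0, tau[ ->
  is_derive t 1 (fun s => u s x 0 i) (derive1 (fun s => u s x 0 i) t).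
Proof.
move=> It; have [dt _] := smooth_dt x i It.
by rewrite derive1E; exact: derivableP.
Qed.

Lemma smooth_torus_C1 t i j : t \in `]0, tau[ -> torus_C1 j (fun y => u t y 0 i).
Proof.
move=> It; split; first exact: (jointly_contl (smooth_C0 i)).
  by move=> x; exact: (smooth_partial x i j It).1.
exact: (jointly_contl (smooth_C1 i j)).
Qed.

Lemma smooth_torus_C2 t i j l : t \in `]0, tau[ -> torus_C1 l (partial j (fun y => u t y 0 i)).
Proof.
move=> It; split; first exact: (jointly_contl (smooth_C1 i j)).
  by move=> x; exact: (smooth_partial2 x i j l It).1.
exact: (jointly_contl (smooth_C2 i j l)).
Qed.

End smooth_fields.

Lemma line_lipschitz_ge0 (V : normedModType R) (g : V -> R) (z v : V) (h M : R) : 0 <= h ->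
  (forall s : R, 0 <= s <= h -> derivable g (z + s *: v) v /\ `|'D_v g (z + s *: v)| <= M) ->
  `|g (z + h *: v) - g z| <= M * h.
Proof.
move=> h0 H; pose F s := g (z + s *: v).
have dF s : s \in `[0, h] -> is_derive s 1 F ('D_v g (z + s *: v)).
  by rewrite in_itv/= => /H[dg _]; exact: is_derive_line.
have dF' s : s \in `]0, h[ -> is_derive s 1 F ('D_v g (z + s *: v)).
  by move=> sI; apply: dF; exact: subset_itv_oo_cc.
have cF : {within `[0, h], continuous F}.
  by apply: derivable_within_continuous => s sI; have [] := dF s sI.
have [c cI] := @MVT_segment R F (fun s => 'D_v g (z + s *: v)) 0 h h0 dF' cF.
rewrite subr0 /F scale0r addr0 => ->; rewrite normrM (ger0_norm h0) ler_wpM2r//.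
by have := cI; rewrite in_itv/= => /H[].
Qed.

Lemma line_lipschitz (V : normedModType R) (g : V -> R) (z v : V) (h M : R) :
  (forall s : R, `|s| <= `|h| -> derivable g (z + s *: v) v /\ `|'D_v g (z + s *: v)| <= M) ->
  `|g (z + h *: v) - g z| <= M * `|h|.
Proof.
move=> H; have [h0|h0] := ler0P h; last first.
  apply: (@line_lipschitz_ge0 V g z v h M (ltW h0)) => s /andP[s0 sh].
  by apply: H; rewrite (ger0_norm s0) gtr0_norm.
rewrite distrC; have E : z = (z + h *: v) + (- h) *: v.
  by rewrite -addrA -scalerDl subrr scale0r addr0.
have h1 : 0 <= - h by rewrite oppr_ge0.
rewrite {1}E; apply: (@line_lipschitz_ge0 V g _ v (- h) M h1) => s /andP[s0 sh].
rewrite -addrA -scalerDl; apply: H.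
by rewrite (ler0_norm h0) ler0_norm; lra.
Qed.

(** Continuous partial derivatives make a function continuous: move from one point
to the other one coordinate at a time and apply the mean value theorem. *)
Lemma continuous_partials d (g : 'rV[R]_d -> R) :
  (forall i x, derivable g x (basis_vec i)) ->
  (forall i, continuous (partial i g)) -> continuous g.
Proof.
move=> dg cg x.
pose M : R := \sum_i (`|partial i g x| + 1).
have [r r0 hr] : exists2 r : R, 0 < r & forall y : 'rV[R]_d, (forall j, `|x 0 j - y 0 j| < r) ->
    forall i, `|partial i g y| <= M.
  have : \forall y \near x, forall i, `|partial i g y| <= M.
    apply: (@filter_forall _ _ (fun i y => `|partial i g y| <= M) (nbhs x) _) => i.
    have /cvgrPdist_lt/(_ _ ltr01) := cg i x.
    apply: filterS => y hy; apply: (@le_trans _ _ (`|partial i g x| + 1)).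
      rewrite -[partial i g y](subrK (partial i g x)) addrC.
      by rewrite (le_trans (ler_normD _ _))// lerD2l distrC ltW.
    by rewrite /M (bigD1 i)//= lerDl sumr_ge0// => j _; rewrite addr_ge0.
  move=> /nbhs_ballP[r /= r0 hr]; exists r => // y hy; apply: hr.
  by split=> // i j; rewrite (ord1 i); exact: hy.
have M0 : 0 <= M by rewrite sumr_ge0// => i _; rewrite addr_ge0.
(* The first [n] coordinates have already been moved from [x] to [y]. *)
pose z (y : 'rV[R]_d) (n : nat) : 'rV[R]_d := \row_j (if (j < n)%N then y 0 j else x 0 j).
have step (y : 'rV[R]_d) (i : 'I_d) : (forall j, `|x 0 j - y 0 j| < r) ->
    `|g (z y i.+1) - g (z y i)| <= M * `|y 0 i - x 0 i|.
  move=> hy.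
  have -> : z y i.+1 = z y i + (y 0 i - x 0 i) *: basis_vec i.
    apply/rowP => j; rewrite !mxE eqxx /= ltnS leq_eqVlt.
    have [->|ji] := eqVneq j i; first by rewrite eqxx ltnn /= mulr1 addrC subrK.
    by rewrite val_eqE (negbTE ji) mulr0 addr0.
  apply: line_lipschitz => s hs; split; first exact: dg.
  apply: hr => j; rewrite !mxE eqxx /=.
  have [->|ji] := eqVneq j i.
    rewrite ltnn mulr1 opprD addrA subrr sub0r normrN (le_lt_trans hs)//.
    by rewrite distrC.
  by rewrite mulr0 addr0; case: ifP => _; rewrite ?subrr ?normr0.
have tot (y : 'rV[R]_d) : (forall j, `|x 0 j - y 0 j| < r) ->
    `|g y - g x| <= M * \sum_i `|y 0 i - x 0 i|.
  move=> hy.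
  have -> : g y - g x = \sum_(i < d) (g (z y i.+1) - g (z y i)).
    rewrite -(big_mkord xpredT (fun n => g (z y n.+1) - g (z y n))).
    rewrite (@telescope_sumr _ 0 d (fun n => g (z y n)))//.
    have -> : z y d = y by apply/rowP => j; rewrite mxE ltn_ord.
    by have -> : z y 0 = x by apply/rowP => j; rewrite mxE.
  rewrite (le_trans (ler_norm_sum _ _ _))// mulr_sumr; apply: ler_sum => i _.
  exact: step.
apply/(@cvgrPdist_le _ _ _ (nbhs x)) => e e0.
have h1 : \forall y \near nbhs x, forall j,  `|x 0 j - (y : 'rV[R]_d) 0 j| < r.
  apply: (@filter_forall _ _ (fun j (y : 'rV[R]_d) => `|x 0 j - y 0 j| < r) (nbhs x) _) => j.
  by have /cvgrPdist_lt/(_ _ r0) := @coord_continuous R 1 d 0 j x.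
have e1 : 0 < e / (M * d%:R + 1) by rewrite divr_gt0// ltr_wpDl// mulr_ge0.
have h2 : \forall y \near nbhs x, forall j,  `|x 0 j - (y : 'rV[R]_d) 0 j| <= e / (M * d%:R + 1).
  apply: (@filter_forall _ _ (fun j (y : 'rV[R]_d) => `|x 0 j - y 0 j| <= e / (M * d%:R + 1)) (nbhs x) _) => j.
  by have /cvgrPdist_le/(_ _ e1) := @coord_continuous R 1 d 0 j x.
apply: filterS2 h1 h2 => y h1 h2.
rewrite distrC (le_trans (tot y h1))//.
apply: (@le_trans _ _ (M * \sum_(i < d) (e / (M * d%:R + 1)))).
  by rewrite ler_wpM2l//; apply: ler_sum => i _; rewrite distrC.
rewrite sumr_const card_ord -[X in M * X]mulr_natl; set q := e / _ in e1 *.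
have E : (M * d%:R + 1) * q = e by rewrite mulrC divfK// gt_eqF// ltr_wpDl// mulr_ge0.
by rewrite mulrA; lra.
Qed.

Lemma form_opp d (B : ('rV[R]_d -> R) -> ('rV[R]_d -> R) -> R) g h : energy_form B ->
  torus_cont g -> torus_cont h -> B (fun x => - g x) h = - B g h.
Proof.
move=> fB cg ch; rewrite -[RHS]mulN1r -form_scale//; congr B.
by apply/funext => x; rewrite mulN1r.
Qed.

Lemma form0 d (B : ('rV[R]_d -> R) -> ('rV[R]_d -> R) -> R) h : energy_form B ->
  torus_cont h -> B (fun=> 0) h = 0.
Proof.
move=> fB ch; rewrite -[RHS](mul0r (B (fun=> 0) h)) -form_scale//; congr B.
by apply/funext => x; rewrite mul0r.
Qed.

Lemma form_sum d (B : ('rV[R]_d -> R) -> ('rV[R]_d -> R) -> R) (J : Type) (r : seq J)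
    (g : J -> 'rV[R]_d -> R) h : energy_form B ->
  (forall j, torus_cont (g j)) -> torus_cont h ->
  B (fun x => \sum_(j <- r) g j x) h = \sum_(j <- r) B (g j) h.
Proof.
move=> fB cg ch; elim: r => [|j r IH].
  by under eq_fun do rewrite big_nil; rewrite big_nil form0.
under eq_fun do rewrite big_cons; rewrite big_cons form_add ?IH//.
exact: torus_cont_sum.
Qed.

(** * The energy balance *)

Definition vform d (B : ('rV[R]_d -> R) -> ('rV[R]_d -> R) -> R) (v w : 'rV[R]_d -> 'rV[R]_d) :=
  \sum_i B (fun x => v x 0 i) (fun x => w x 0 i).

(** The dissipation measured by [B]. *)
Definition gradform d (B : ('rV[R]_d -> R) -> ('rV[R]_d -> R) -> R) (v : 'rV[R]_d -> 'rV[R]_d) :=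
  \sum_i \sum_j B (partial j (fun x => v x 0 i)) (partial j (fun x => v x 0 i)).

Lemma inner_vform d (v w : 'rV[R]_d -> 'rV[R]_d) :
  (forall i, torus_cont (fun x => v x 0 i)) -> (forall i, torus_cont (fun x => w x 0 i)) ->
  inner v w = vform (@l2form d) v w.
Proof.
by move=> cv cw; rewrite /inner /dot torus_int_sum// => i _; exact: torus_contM.
Qed.

(** The symbol is squared because both arguments of the product are filtered. *)
Definition lp_form d (chi : 'rV[R]_d -> R) q :=
  filtered_form (fun k : 'rV[int]_d => lp_symbol chi q k ^+ 2) (2 ^ q.+1).

Lemma inner_lowpass d (chi : 'rV[R]_d -> R) q (v w : 'rV[R]_d -> 'rV[R]_d) : LP_cutoff chi ->
  (forall i, torus_cont (fun x => v x 0 i)) -> (forall i, torus_cont (fun x => w x 0 i)) ->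
  inner (lowpass chi q v) (lowpass chi q w) = vform (lp_form chi q) v w.
Proof.
move=> hchi cv cw.
have E (z : 'rV[R]_d -> 'rV[R]_d) i : (fun x => lowpass chi q z x 0 i) =
    multiplier (lp_symbol chi q) (2 ^ q.+1) (fun x => z x 0 i).
  by apply/funext => x; rewrite mxE lowpass_scalE.
rewrite inner_vform; try by move=> i; rewrite E; exact: torus_cont_multiplier.
apply: eq_bigr => i _; rewrite !E /l2form torus_int_multiplier2//.
exact: symbol_lp.
Qed.

Lemma solve_time_derivative (a l n q b : R) : a - l + n + q = b -> a = l + (- n + (- q + b)).
Proof. by lra. Qed.

Section energy_balance.
Variables (tau : R) (d : nat) (u f : R -> 'rV[R]_d -> 'rV[R]_d).
Hypotheses (su : smooth_QT tau u) (sf : smooth_QT tau f) (nse : NSE tau u f).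

Lemma jointly_cont_advection i :
  jointly_cont `]0, tau[ (fun t x => advection (u t) x 0 i).
Proof.
have -> : (fun t x => advection (u t) x 0 i) =
    (fun t x => \sum_j u t x 0 j * partial j (fun y => u t y 0 i) x).
  by apply/funext => t; apply/funext => x; rewrite mxE.
apply: jointly_cont_sum => j; apply: jointly_contM; [exact: smooth_C0|exact: smooth_C1].
Qed.

Lemma divergence_free t x : t \in `]0, tau[ ->
  \sum_j partial j (fun y => u t y 0 j) x = 0.
Proof. by case: nse => p hp; rewrite in_itv/= => /hp[]. Qed.

(** Only the existence of the partial derivatives of the pressure is known. The equation
expresses them through the velocity and the force, so that they are continuous and the
pressure can be used in integrations by parts. *)
Lemma pressure_gradient t : t \in `]0, tau[ -> exists p,
  [/\ torus_cont p, forall i, torus_C1 i p &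
  forall i, (fun x => derive1 (fun s => u s x 0 i) t) =
    (fun x => \sum_j partial j (partial j (fun y => u t y 0 i)) x +
              (- advection (u t) x 0 i + (- partial i p x + f t x 0 i)))].
Proof.
move=> It; case: nse => p /(_ t); move: (It); rewrite in_itv/= => It' /(_ It')[tp dp eqn div0].
have flux i x : \sum_j partial j (fun y => u t y 0 j * u t y 0 i) x = advection (u t) x 0 i.
  rewrite mxE; transitivity (\sum_j (partial j (fun y => u t y 0 j) x * u t x 0 i +
      u t x 0 j * partial j (fun y => u t y 0 i) x)).
    by apply: eq_bigr => j _; apply: partialM; exact: (smooth_partial su _ _ _ It).1.
  by rewrite big_split/= -mulr_suml div0 mul0r add0r.
have dtE i x : derive1 (fun s => u s x 0 i) t =
    \sum_j partial j (partial j (fun y => u t y 0 i)) x +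
              (- advection (u t) x 0 i + (- partial i (p t) x + f t x 0 i)).
  by have := eqn x i; rewrite flux; exact: solve_time_derivative.
have cdp i : torus_cont (partial i (p t)).
  have -> : partial i (p t) = (fun x => f t x 0 i + (\sum_j partial j (partial j (fun y => u t y 0 i)) x -
      (advection (u t) x 0 i + derive1 (fun s => u s x 0 i) t))).
    by apply/funext => x; rewrite dtE; ring.
  apply: torus_contD; first exact: (jointly_contl (smooth_C0 sf i)).
  apply: torus_contB.
    by apply: torus_cont_sum => j _; exact: (jointly_contl (smooth_C2 su i j j)).
  apply: torus_contD; first exact: (jointly_contl (jointly_cont_advection i)).
  exact: (jointly_contl (smooth_Ct su i)).
have cp : torus_cont (p t).
  by split=> //; apply: continuous_partials => [//|j]; have [] := cdp j.
by exists (p t); split=> // i; apply/funext => x; exact: dtE.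
Qed.

(** The energy balance for any energy form: integration by parts turns the Laplacian into
minus the dissipation, and moves the gradient of the pressure to the divergence of the
velocity, which vanishes. The advection term is kept, since it only vanishes for the
L^2 product. *)
Lemma energy_balance B t : energy_form B -> t \in `]0, tau[ ->
  is_derive t 1 (fun t => vform B (u t) (u t))
    (2 * (- gradform B (u t) + (- vform B (advection (u t)) (u t) + vform B (f t) (u t)))).
Proof.
move=> fB It.
have cU i : torus_cont (fun x => u t x 0 i) := jointly_contl (smooth_C0 su i) It.
have cF i : torus_cont (fun x => f t x 0 i) := jointly_contl (smooth_C0 sf i) It.
have cA i : torus_cont (fun x => advection (u t) x 0 i) := jointly_contl (jointly_cont_advection i) It.
have c1 i j : torus_C1 j (fun x => u t x 0 i) := smooth_torus_C1 su i j It.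
have c2 i j : torus_C1 j (partial j (fun x => u t x 0 i)) := smooth_torus_C2 su i j j It.
have [p [cp0 cp dtE]] := pressure_gradient It.
have c3 i j : torus_cont (partial j (partial j (fun x => u t x 0 i))) by case: (c2 i j).
have c4 i : torus_cont (partial i p) by case: (cp i).
have -> : 2 * (- gradform B (u t) + (- vform B (advection (u t)) (u t) + vform B (f t) (u t))) =
    \sum_i 2 * B (fun x => derive1 (fun s => u s x 0 i) t) (fun x => u t x 0 i).
  rewrite -mulr_sumr; congr (2 * _).
  have P0 : \sum_i B (partial i p) (fun x => u t x 0 i) = 0.
    transitivity (- B (fun x => \sum_i partial i (fun y => u t y 0 i) x) p).
      rewrite form_sum//; last by move=> i; case: (c1 i i).
      by rewrite -sumrN; apply: eq_bigr => i _; rewrite form_skew// (form_sym fB p).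
    rewrite (_ : (fun x => _) = fun=> 0) ?form0 ?oppr0//.
    by apply/funext => x; rewrite divergence_free.
  have E i : B (fun x => derive1 (fun s => u s x 0 i) t) (fun x => u t x 0 i) =
      - (\sum_j B (partial j (fun x => u t x 0 i)) (partial j (fun x => u t x 0 i))) +
      (- B (fun x => advection (u t) x 0 i) (fun x => u t x 0 i) +
       (- B (partial i p) (fun x => u t x 0 i) + B (fun x => f t x 0 i) (fun x => u t x 0 i))).
    have cN := torus_contN (c4 i); have cAN := torus_contN (cA i).
    have cNF := torus_contD cN (cF i); have cANF := torus_contD cAN cNF.
    rewrite dtE (form_add fB _ cANF (cU i)); last exact: torus_cont_sum.
    rewrite (form_add fB cAN cNF (cU i)).
    rewrite form_add// !form_opp// form_sum// -sumrN; congr (_ + _).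
    by apply: eq_bigr => j _; rewrite form_skew.
  under [RHS]eq_bigr do rewrite E.
  by rewrite !big_split/= !sumrN P0 oppr0 add0r.
apply: is_derive_sum_seq => i.
apply: (@form_derive _ B fB 0 tau (fun t x => u t x 0 i) (fun t x => derive1 (fun s => u s x 0 i) t)) => //.
- exact: smooth_C0.
- exact: smooth_Ct.
- by move=> s x; exact: smooth_is_derive.
Qed.

End energy_balance.

Section integrated_balance.
Variables (tau : R) (d : nat) (u f : R -> 'rV[R]_d -> 'rV[R]_d).
Hypotheses (su : smooth_QT tau u) (sf : smooth_QT tau f) (nse : NSE tau u f).

(** The advection of [u_i] paired with [u_i] is half the transport of [u_i^2], which has zero
mean because [u] is divergence free. *)
Lemma l2form_transport t : t \in `]0, tau[ ->
  vform (@l2form d) (advection (u t)) (u t) = 0.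
Proof.
move=> It.
have c1 i j : torus_C1 j (fun x => u t x 0 i) := smooth_torus_C1 su i j It.
have cU i : torus_cont (fun x => u t x 0 i) := jointly_contl (smooth_C0 su i) It.
rewrite /vform big1// => i _.
have sq x j : partial j (fun x => u t x 0 i * u t x 0 i) x =
    2 * (u t x 0 i * partial j (fun x => u t x 0 i) x).
  by rewrite partialM; [ring|case: (c1 i j)|case: (c1 i j)].
have sqC1 j : torus_C1 j (fun x => u t x 0 i * u t x 0 i).
  have [a b c] := c1 i j; split; [exact: torus_contM|by move=> x; exact: derivableM|].
  rewrite (_ : partial j _ = (fun x => 2 * (u t x 0 i * partial j (fun x => u t x 0 i) x))).
    by apply: torus_contZ; exact: torus_contM.
  by apply/funext => x; rewrite sq.
have H : \sum_j l2form (partial j (fun x => u t x 0 i * u t x 0 i)) (fun x => u t x 0 j) = 0.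
  transitivity (- l2form (fun x => \sum_j partial j (fun x => u t x 0 j) x) (fun x => u t x 0 i * u t x 0 i)).
    rewrite (form_sum _ (energy_form_l2 d)); [|by move=> j; case: (c1 j j)|exact: torus_contM].
    rewrite -sumrN; apply: eq_bigr => j _.
    by rewrite (form_skew (energy_form_l2 d))// (form_sym (energy_form_l2 d)).
  rewrite (_ : (fun x => \sum_j _) = fun=> 0); last first.
    by apply/funext => x; exact: (divergence_free nse).
  by rewrite (form0 (energy_form_l2 d)) ?oppr0//; exact: torus_contM.
have -> : l2form (fun x => advection (u t) x 0 i) (fun x => u t x 0 i) =
    2^-1 * \sum_j l2form (partial j (fun x => u t x 0 i * u t x 0 i)) (fun x => u t x 0 j).
  rewrite /l2form -torus_int_sum; last by move=> j _; apply: torus_contM => //; case: (sqC1 j).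
  rewrite -torus_intZ; last by apply: torus_cont_sum => j _; apply: torus_contM => //; case: (sqC1 j).
  congr torus_int; apply/funext => x; rewrite mxE mulr_sumr mulr_suml; apply: eq_bigr => j _.
  by rewrite sq; lra.
by rewrite H mulr0.
Qed.

Lemma vform_cont B (v w : R -> 'rV[R]_d -> 'rV[R]_d) : energy_form B ->
  (forall i, jointly_cont `]0, tau[ (fun t x => v t x 0 i)) ->
  (forall i, jointly_cont `]0, tau[ (fun t x => w t x 0 i)) ->
  {in `]0, tau[, continuous (fun t => vform B (v t) (w t))}.
Proof.
move=> fB cv cw t It; apply: (@cvg_sum_seq _ _ (nbhs t)) => i _.
exact: (form_cont fB (cv i) (cw i)).
Qed.

Lemma gradform_cont B : energy_form B ->
  {in `]0, tau[, continuous (fun t => gradform B (u t))}.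
Proof.
move=> fB t It; apply: (@cvg_sum_seq _ _ (nbhs t)) => i _.
apply: (@cvg_sum_seq _ _ (nbhs t)) => j _.
exact: (form_cont fB (smooth_C1 su i j) (smooth_C1 su i j)).
Qed.

Lemma itv_cc_sub (a b : R) : 0 < a -> b < tau -> {subset `[a, b] <= `]0, tau[}.
Proof.
move=> a0 bt t; rewrite !in_itv/= => /andP[at_ tb].
by rewrite (lt_le_trans a0)// (le_lt_trans tb).
Qed.

Lemma within_continuous_itv (F : R -> R) a b : 0 < a -> b < tau ->
  {in `]0, tau[, continuous F} -> {within `[a, b], continuous F}.
Proof.
move=> a0 bt cF; apply: continuous_in_subspaceT => t; rewrite inE/= => tab.
by apply: cF; apply: (itv_cc_sub a0 bt).
Qed.

Lemma integrable_cc (F : R -> R) a b : 0 < a -> b < tau ->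
  {in `]0, tau[, continuous F} -> mu.-integrable `[a, b] (EFin \o F).
Proof.
move=> a0 bt cF; apply: continuous_compact_integrable; first exact: segment_compact.
exact: within_continuous_itv.
Qed.

Lemma cont_advection_form B : energy_form B ->
  {in `]0, tau[, continuous (fun t => vform B (advection (u t)) (u t))}.
Proof.
move=> fB; apply: (@vform_cont B (fun t => advection (u t))) => // i.
  exact: jointly_cont_advection.
exact: smooth_C0.
Qed.

Lemma cont_work_form B : energy_form B ->
  {in `]0, tau[, continuous (fun t => vform B (f t) (u t))}.
Proof. by move=> fB; apply: vform_cont => // i; exact: smooth_C0. Qed.

Lemma cont_energy_form B : energy_form B ->
  {in `]0, tau[, continuous (fun t => vform B (u t) (u t))}.
Proof. by move=> fB; apply: vform_cont => // i; exact: smooth_C0. Qed.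

Lemma integrated_energy_balance B a b : energy_form B -> 0 < a -> a <= b -> b < tau ->
  vform B (u b) (u b) - vform B (u a) (u a) =
  2 * (- (\int[mu]_(t in `[a, b]) gradform B (u t)) +
       (- (\int[mu]_(t in `[a, b]) vform B (advection (u t)) (u t)) +
        \int[mu]_(t in `[a, b]) vform B (f t) (u t))).
Proof.
move=> fB a0 ab bt.
have cG := gradform_cont fB; have cA := cont_advection_form fB; have cW := cont_work_form fB.
have iG := integrable_cc a0 bt cG; have iA := integrable_cc a0 bt cA; have iW := integrable_cc a0 bt cW.
have cS : {within `[a, b], continuous (fun t => 2 * (- gradform B (u t) +
    (- vform B (advection (u t)) (u t) + vform B (f t) (u t))))}.
  apply: within_continuous_itv => // t It; apply: (cvgM (cvg_cst _)).
  exact: (cvgD (cvgN (cG t It)) (cvgD (cvgN (cA t It)) (cW t It))).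
have dS (t : R) (tab : t \in `[a, b]) := energy_balance su sf nse fB (itv_cc_sub a0 bt tab).
rewrite -[LHS](FTC2_itv ab dS cS).
have mab : measurable (`[a, b]%classic : set (measurableTypeR R)) by exact: measurable_itv.
have cNG : {in `]0, tau[, continuous (fun t => - gradform B (u t))}.
  by move=> t It; exact: (cvgN (cG t It)).
have cNA : {in `]0, tau[, continuous (fun t => - vform B (advection (u t)) (u t))}.
  by move=> t It; exact: (cvgN (cA t It)).
have cNAW : {in `]0, tau[, continuous (fun t => - vform B (advection (u t)) (u t) + vform B (f t) (u t))}.
  by move=> t It; exact: (cvgD (cNA t It) (cW t It)).
have cT : {in `]0, tau[, continuous (fun t => - gradform B (u t) +
    (- vform B (advection (u t)) (u t) + vform B (f t) (u t)))}.
  by move=> t It; exact: (cvgD (cNG t It) (cNAW t It)).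
have NE F : mu.-integrable `[a, b] (EFin \o F) ->
    \int[mu]_(t in `[a, b]) - F t = - \int[mu]_(t in `[a, b]) F t.
  move=> iF; rewrite -[RHS]mulN1r -RintegralZl//.
  by apply: eq_Rintegral => t _; rewrite mulN1r.
rewrite (RintegralZl 2 mab (integrable_cc a0 bt cT)).
rewrite (RintegralD mab (integrable_cc a0 bt cNG) (integrable_cc a0 bt cNAW)).
by rewrite (RintegralD mab (integrable_cc a0 bt cNA) iW) !NE.
Qed.

Lemma l2_energy_balance a b : 0 < a -> a <= b -> b < tau ->
  vform (@l2form d) (u b) (u b) + 2 * \int[mu]_(t in `[a, b]) gradform (@l2form d) (u t) =
  vform (@l2form d) (u a) (u a) + 2 * \int[mu]_(t in `[a, b]) vform (@l2form d) (f t) (u t).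
Proof.
move=> a0 ab bt; have := integrated_energy_balance (energy_form_l2 d) a0 ab bt.
rewrite (_ : \int[mu]_(t in `[a, b]) vform (@l2form d) (advection (u t)) (u t) = 0); first lra.
rewrite (@eq_Rintegral _ _ _ mu `[a, b] (cst 0)) ?Rintegral_cst ?mul0r//.
by move=> t; rewrite inE/= => tab; apply: l2form_transport; apply: (itv_cc_sub a0 bt).
Qed.

End integrated_balance.

(** * Integrals up to the final time *)

(** The sum over a countable type is a series, for which measurability is known. *)
Lemma measurable_fun_esum (dT : measure_display) (T : measurableType dT) (J : countType) (D : set T)
    (g : J -> T -> \bar R) :
  (forall k, measurable_fun D (g k)) -> (forall k t, (0 <= g k t)%E) ->
  measurable_fun D (fun t => \esum_(k in [set: J]) g k t).
Proof.
move=> mg g0.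
pose h n t := if @pickle_inv J n is Some k then g k t else 0%E.
have h0 n t : (0 <= h n t)%E by rewrite /h; case: pickle_inv.
have E t : \esum_(k in [set: J]) g k t = (\sum_(0 <= n <oo | n \in predT) h n t)%E.
  rewrite (_ : (\sum_(0 <= n <oo | n \in predT) h n t)%E = (\sum_(0 <= n <oo) h n t)%E)//.
  rewrite nneseries_esumT// (_ : (fun k => g k t) = (fun k => h (pickle k) t)); last first.
    by apply/funext => k; rewrite /h pickleK_inv.
  rewrite -(@esum_image _ _ _ setT pickle (h ^~ t)); last by move=> x y _ _; exact: (pcan_inj pickleK).
  rewrite esum_mkcond; apply: eq_esum => n _; case: ifPn => //.
  rewrite notin_setE /h => nr; have := @pickle_invK J n.
  by case: pickle_inv => //= k kn; exfalso; apply: nr; exists k.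
rewrite (_ : (fun t => _) = (fun t => (\sum_(0 <= n <oo | n \in predT) h n t)%E)); last first.
  by apply/funext => t; exact: E.
apply: ge0_emeasurable_sum => // n _; rewrite /h.
by case: pickle_inv => [k|]; [exact: mg|exact: measurable_cst].
Qed.

Lemma le_esum_seq (J : choiceType) (s : seq J) (F : J -> R) : uniq s -> (forall k, 0 <= F k) ->
  ((\sum_(k <- s) F k)%:E <= \esum_(k in [set: J]) (F k)%:E)%E.
Proof.
move=> us F0; apply: esum_ge; exists [set` s]; first by split.
by rewrite -fsbig_seq// sumEFin.
Qed.

Lemma cvg_Rintegral_left (h : R -> R) (a b : R) : a < b ->
  mu.-integrable `[a, b[ (EFin \o h) ->
  (\int[mu]_(t in `[a, x]) h t) @[x --> b^'-] --> \int[mu]_(t in `[a, b[) h t.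
Proof.
move=> ab ih; pose D : set (measurableTypeR R) := `[a, b[%classic.
have mD : measurable D by exact: measurable_itv.
have DI : D = `[a, b] `&` D by rewrite setIidr// => t; apply: subset_itvl; rewrite bnd_simp.
have ihD : mu.-integrable `[a, b] (EFin \o (h \_ D)).
  by rewrite -restrict_EFin; apply/integrable_restrict => //; rewrite -?DI// setIC -DI.
have := parameterized_integral_cvg_at_left ab ihD.
rewrite /parameterized_integral -Rintegral_mkcondr -DI.
apply: cvg_trans; apply: near_eq_cvg; near=> x.
apply: eq_Rintegral => t; rewrite inE/= in_itv/= => /andP[at_ tx].
rewrite patchE mem_set// /D /= in_itv/= at_ (le_lt_trans tx)//.
Unshelve. all: by end_near. Qed.

(** The majorant takes extended real values because the Sobolev norm of the force is finite
only almost everywhere in time. *)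
Lemma int_to_end_dominated (tau a : R) (h : nat -> R -> R) (Psi : R -> \bar R) : a < tau ->
  (forall q, measurable_fun (`[a, tau[%classic : set (measurableTypeR R)) (h q)) ->
  mu.-integrable `[a, tau[ Psi ->
  (forall q t, t \in `[a, tau[ -> (`|h q t|%:E <= Psi t)%E) ->
  (forall t, t \in `[a, tau[ -> h q t @[q --> \oo] --> (0 : R)) ->
  (forall q, mu.-integrable `[a, tau[ (EFin \o h q)) /\
  (\int[mu]_(t in `[a, tau[) h q t) @[q --> \oo] --> (0 : R).
Proof.
move=> at_ mh iPsi hPsi h0.
pose D : set (measurableTypeR R) := `[a, tau[%classic.
have mD : measurable D by exact: measurable_itv.
have ih q : mu.-integrable D (EFin \o h q).
  apply: (le_integrable mD _ _ iPsi); first by apply/measurable_EFinP; exact: mh.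
  by move=> t Dt /=; apply: (le_trans (hPsi q t Dt)); exact: lee_abs.
split => //.
have mhE q : measurable_fun D (fun t => (h q t)%:E) by apply/measurable_EFinP; exact: mh.
have hc : {ae mu, forall t, D t -> (fun q => (h q t)%:E) @ \oo --> (cst 0%E : R -> \bar R) t}.
  by apply: aeW => t Dt; apply: cvg_EFin; [exact: nearW|exact: h0].
have hb : {ae mu, forall t q, D t -> (`|(h q t)%:E| <= Psi t)%E}.
  by apply: aeW => t q Dt; exact: hPsi.
have [_ _] := @dominated_convergence _ _ _ mu D mD (fun q t => (h q t)%:E) (cst 0%E) Psi
  mhE (measurable_cst _) hc iPsi hb.
rewrite integral_cst// mul0e => /fine_cvg.
exact.
Qed.

Lemma subset_co_oo (a tau : R) : 0 < a -> `[a, tau[ `<=` `]0, tau[%classic.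
Proof. by move=> a0 t /=; rewrite !in_itv/= => /andP[at_ ->]; rewrite (lt_le_trans a0). Qed.

Lemma measurable_co (F : R -> R) (a tau : R) : 0 < a -> {in `]0, tau[, continuous F} ->
  measurable_fun (`[a, tau[%classic : set (measurableTypeR R)) F.
Proof.
move=> a0 cF; apply: (@measurable_funS _ _ _ _ `]0, tau[%classic); first exact: measurable_itv.
  exact: subset_co_oo.
apply: open_continuous_measurable_fun; first exact: interval_open.
by move=> t; rewrite inE/=; exact: cF.
Qed.

(** Monotone convergence along the intervals [[a, tau - (tau - a) / (n + 1)]]. *)
Lemma integrable_of_bounded_itv (G : R -> R) (a tau K : R) : 0 < a -> a < tau ->
  {in `]0, tau[, continuous G} -> (forall t, t \in `[a, tau[ -> 0 <= G t) ->
  (forall b, a <= b -> b < tau -> \int[mu]_(t in `[a, b]) G t <= K) ->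
  mu.-integrable `[a, tau[ (EFin \o G).
Proof.
move=> a0 at_ cG G0 hK.
pose S n : set (measurableTypeR R) := `[a, tau - (tau - a) / n.+1%:R]%classic.
have len0 : 0 < tau - a by rewrite subr_gt0.
have Sb n : a <= tau - (tau - a) / n.+1%:R < tau.
  rewrite gtrBl divr_gt0// andbT lerBrDr -lerBrDl ler_pdivrMr//.
  by rewrite ler_peMr ?(ltW len0)// ler1n.
have Ssub n : S n `<=` `[a, tau[.
  move=> t; rewrite /S /= !in_itv/= => /andP[-> tS]; rewrite (le_lt_trans tS)//.
  by have /andP[] := Sb n.
have mS n : measurable (S n) by exact: measurable_itv.
have Shomo : {homo S : n m / (n <= m)%N >-> (n <= m)%O}.
  move=> n m nm; apply/subsetPset => t; rewrite /S /= !in_itv/= => /andP[-> /le_trans]; apply.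
  by rewrite lerD2l lerN2 ler_pM2l// lef_pV2 ?posrE// ler_nat.
have US : \bigcup_n S n = `[a, tau[%classic.
  apply/seteqP; split=> [t [n _]|t]; first exact: Ssub.
  rewrite /= in_itv/= => /andP[ta tt].
  have e0 : 0 < (tau - t) / (tau - a) by rewrite divr_gt0// subr_gt0.
  have [n _ hn] := near_infty_natSinv_lt (PosNum e0).
  exists n => //; rewrite /S /= in_itv/= ta /=.
  have := hn n (leqnn _); rewrite /= ltr_pdivlMr//; move: (n.+1%:R^-1) => r; lra.
have mG : measurable_fun (`[a, tau[%classic : set (measurableTypeR R)) G by exact: measurable_co.
apply/integrableP; split; first exact/measurable_EFinP.
have -> : (\int[mu]_(x in `[a, tau[) `|(EFin \o G) x| = \int[mu]_(x in `[a, tau[) (EFin \o G) x)%E.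
  by apply: eq_integral => t; rewrite inE /= => tI; rewrite ger0_norm// G0.
rewrite -US; have cvgS := @ge0_nondecreasing_set_cvg_integral _ _ _ S (EFin \o G) mu Shomo mS
  (fun n => (measurable_EFinP _ _).2 (measurable_funS (measurable_itv _) (@Ssub n) mG)).
have {}cvgS := cvgS (fun n t St => G0 t (Ssub n t St)).
rewrite -(cvg_lim _ cvgS)//; apply: (@le_lt_trans _ _ K%:E); last exact: ltry.
apply: lime_le; first by apply/cvg_ex; exists (\int[mu]_(x in \bigcup_i S i) (EFin \o G) x)%E.
apply: nearW => n; have /andP[b1 b2] := Sb n.
have := hK _ b1 b2; rewrite -lee_fin /Rintegral fineK//.
apply: integrable_fin_num; first exact: measurable_itv.
exact: (integrable_cc a0 b2 cG).
Qed.

(** The double limit bounds the integral from some fixed time close to 0 to all times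
close to [tau]; the integral over the remaining fixed interval is a constant. *)
Lemma calL_bounded (W : R -> R) (a tau : R) : 0 < a -> a < tau ->
  {in `]0, tau[, continuous W} -> in_calL tau W ->
  exists K, exists2 c, a < c < tau & forall b, c < b -> b < tau -> \int[mu]_(t in `[a, b]) W t <= K.
Proof.
move=> a0 at_ cW [_ [l /cvgrPdist_lt/(_ _ ltr01)]].
move=> [[P Q] /= [P0 Qt] PQ].
have [x0 [Px x00 xa]] : exists x, [/\ P x, 0 < x & x < a].
  have : \forall x \near 0^'+, P x /\ 0 < x /\ x < a.
    near=> x; split; first by near: x.
    split; first by near: x; exact: nbhs_right_gt.
    by near: x; exact: nbhs_right_lt.
  by move=> /filter_ex[x [? []]]; exists x.
have [c ca hc] : exists2 c, a < c < tau & forall b, c < b -> b < tau -> Q b.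
  move: Qt => /nbhs_ballP[e /= e0 he].
  have m0 : 0 < Num.min e (tau - a) by rewrite lt_min e0 subr_gt0.
  have m1 : Num.min e (tau - a) <= e by rewrite ge_min lexx.
  have m2 : Num.min e (tau - a) <= tau - a by rewrite ge_min lexx orbT.
  exists (tau - Num.min e (tau - a) / 2); first by apply/andP; split; lra.
  move=> b cb bt; apply: he => //=; rewrite /ball/= ger0_norm; lra.
exists (l + 1 - \int[mu]_(t in `[x0, a]) W t); exists c => // b cb bt.
have ab : a < b by move: ca => /andP[ca _]; exact: lt_trans cb.
have /= := PQ (x0, b) (conj Px (hc b cb bt)).
have iW := integrable_cc x00 bt cW.
have := @Rintegral_itvB R W (BLeft x0) (BRight b) a iW.
rewrite !bnd_simp => /(_ (ltW xa) (ltW ab)).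
rewrite Rintegral_itv_obnd_cbnd; last first.
  by apply: (integrableS _ _ _ iW) => //; apply: subset_itvr; rewrite bnd_simp ltW.
by move=> <-; rewrite ltr_norml => /andP[]; lra.
Unshelve. all: by end_near. Qed.

(** * Energy bounds up to the final time *)

Lemma continuous_in_eq (F G : R -> R) (a b : R) : {in `]a, b[, F =1 G} ->
  {in `]a, b[, continuous F} -> {in `]a, b[, continuous G}.
Proof.
move=> FG cF t It; rewrite /continuous_at -FG//.
apply: cvg_trans (cF t It); apply: near_eq_cvg.
by have := near_in_itvoo It; apply: filterS => s Is; rewrite FG.
Qed.

Lemma gradform_ge0 d (B : ('rV[R]_d -> R) -> ('rV[R]_d -> R) -> R) (v : 'rV[R]_d -> 'rV[R]_d) :
  (forall i j, 0 <= B (partial j (fun x => v x 0 i)) (partial j (fun x => v x 0 i))) ->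
  0 <= gradform B v.
Proof. by move=> h; apply: sumr_ge0 => i _; apply: sumr_ge0 => j _. Qed.

Lemma vform_ge0 d (B : ('rV[R]_d -> R) -> ('rV[R]_d -> R) -> R) (v : 'rV[R]_d -> 'rV[R]_d) :
  (forall i, 0 <= B (fun x => v x 0 i) (fun x => v x 0 i)) -> 0 <= vform B v v.
Proof. by move=> h; apply: sumr_ge0 => i _. Qed.

Lemma vform_sym d (B : ('rV[R]_d -> R) -> ('rV[R]_d -> R) -> R) (v w : 'rV[R]_d -> 'rV[R]_d) :
  energy_form B -> vform B v w = vform B w v.
Proof. by move=> fB; apply: eq_bigr => i _; exact: form_sym. Qed.

Lemma balance_le (e y e0 w k : R) : e + 2 * y = e0 + 2 * w -> w <= k -> e + 2 * y <= e0 + 2 * k.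
Proof. by lra. Qed.

Section energy_bounds.
Variables (tau : R) (d : nat) (u f : R -> 'rV[R]_d -> 'rV[R]_d).
Hypotheses (tau0 : 0 < tau) (huf : class_N tau u f).

Let su : smooth_QT tau u. Proof. by case: huf => -[]. Qed.
Let sf : smooth_QT tau f. Proof. by case: huf => -[]. Qed.
Let nse : NSE tau u f. Proof. by case: huf. Qed.

Lemma inner_work t : t \in `]0, tau[ -> inner (u t) (f t) = vform (@l2form d) (f t) (u t).
Proof.
move=> It; rewrite (vform_sym _ _ (energy_form_l2 d)) inner_vform// => i.
  exact: (jointly_contl (smooth_C0 su i)).
exact: (jointly_contl (smooth_C0 sf i)).
Qed.

(** A solution with finite energy input has bounded energy and a square integrable
gradient up to the final time, by the energy equality. *)
Lemma energy_bounds :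
  (exists2 E0, 0 <= E0 & forall t, t \in `[tau / 2, tau[ -> vform (@l2form d) (u t) (u t) <= E0) /\
  mu.-integrable `[tau / 2, tau[ (EFin \o (fun t => gradform (@l2form d) (u t))).
Proof.
have [a -> [a0 at_]] : exists2 a, tau / 2 = a & 0 < a /\ a < tau.
  exists (tau / 2) => //; split; first by rewrite divr_gt0.
  by rewrite ltr_pdivrMr// ltr_pMr// ltr1n.
have fl := energy_form_l2 d.
have cW : {in `]0, tau[, continuous (fun t => inner (u t) (f t))}.
  apply: (continuous_in_eq _ (cont_work_form su sf fl)) => t It.
  by rewrite inner_work.
have calL : in_calL tau (fun t => inner (u t) (f t)) by case: huf.
have [K [c /andP[ac ct] hK]] := calL_bounded a0 at_ cW calL.
have bal b : a <= b -> b < tau ->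
    vform (@l2form d) (u b) (u b) + 2 * \int[mu]_(t in `[a, b]) gradform (@l2form d) (u t) =
    vform (@l2form d) (u a) (u a) + 2 * \int[mu]_(t in `[a, b]) inner (u t) (f t).
  move=> ab bt; rewrite (l2_energy_balance su sf nse a0 ab bt); congr (_ + 2 * _).
  apply: eq_Rintegral => t; rewrite inE/= => tab; rewrite inner_work//.
  exact: (itv_cc_sub a0 bt).
have G0 t : t \in `[a, tau[ -> 0 <= gradform (@l2form d) (u t).
  by move=> _; apply: gradform_ge0 => i j; exact: l2form_ge0.
have E0 t : 0 <= vform (@l2form d) (u t) (u t) by apply: vform_ge0 => i; exact: l2form_ge0.
have cG := gradform_cont su fl.
have intG0 b : 0 <= \int[mu]_(t in `[a, b]) gradform (@l2form d) (u t).
  by apply: Rintegral_ge0 => t _; apply: gradform_ge0 => i j; exact: l2form_ge0.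
have [c' [c'c c't]] : exists c', c < c' /\ c' < tau.
  by exists ((c + tau) / 2); split; lra.
split.
  have ac' : a <= c' by lra.
  have [s sI hs] := EVT_max ac' (within_continuous_itv a0 c't (cont_energy_form su fl)).
  exists (Num.max (vform (@l2form d) (u s) (u s)) (vform (@l2form d) (u a) (u a) + 2 * K)).
    by rewrite le_max E0.
  move=> t; rewrite in_itv/= => /andP[ta tt]; rewrite le_max.
  have [tc|ct'] := leP t c'; first by rewrite hs// in_itv/= ta.
  apply/orP; right; apply: le_trans (balance_le (bal t ta tt) (hK t (lt_trans c'c ct') tt)).
  by rewrite lerDl mulr_ge0.
apply: (integrable_of_bounded_itv (K := (vform (@l2form d) (u a) (u a) + 2 * K) / 2) a0 at_ cG G0).
move=> b ab bt.
have [b' [bb' b't cb']] : exists b', [/\ b <= b', b' < tau & c < b'].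
  by exists (Num.max b c'); rewrite le_max lexx gt_max bt c't lt_max c'c orbT.
have : \int[mu]_(t in `[a, b]) gradform (@l2form d) (u t) <=
       \int[mu]_(t in `[a, b']) gradform (@l2form d) (u t).
  have iG' := integrable_cc a0 b't cG.
  have := @Rintegral_itvB R (fun t => gradform (@l2form d) (u t)) (BLeft a) (BRight b') b iG'.
  rewrite !bnd_simp => /(_ ab bb') E.
  rewrite -subr_ge0 E; apply: Rintegral_ge0 => t _.
  by apply: gradform_ge0 => i j; exact: l2form_ge0.
move=> /le_trans; apply; rewrite ler_pdivlMr// mulrC.
apply: le_trans (balance_le (bal b' (le_trans ab bb') b't) (hK b' cb' b't)).
by rewrite lerDr.
Qed.

End energy_bounds.

(** * Domination of the lost work *)

(** The choice of the scale at which the Sobolev weight is balanced: with b equal to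
the p-th root of B and X the larger of b and F, the weight is A = X / b ^ (p - 1),
and both products are then at most X ^ p. *)
Lemma critical_scaling (B F p : R) : 1 <= B -> 0 <= F -> 1 <= p <= 2 ->
  exists2 A, 0 < A &
    A * B `^ (2 - 2 / p) <= B + F `^ p /\ A^-1 * F ^+ 2 <= B + F `^ p.
Proof.
move=> B1 F0 /andP[p1 p2].
have p0 : 0 < p by apply: lt_le_trans p1.
have B0 : 0 < B by apply: lt_le_trans B1.
pose b := B `^ p^-1; have b0 : 0 < b by exact: powR_gt0.
have b1 : 1 <= b by rewrite -(powRr0 B) ler_powR// invr_ge0 ltW.
pose X := Num.max b F; have X0 : 0 < X by rewrite lt_max b0.
have bX : b <= X by rewrite le_max lexx.
have FX : F <= X by rewrite le_max lexx orbT.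
pose r := b `^ (p - 1); have r0 : 0 < r by exact: powR_gt0.
have rX : r <= X `^ (p - 1).
  by rewrite ge0_ler_powR ?nnegrE ?subr_ge0//; exact: ltW.
have XpE : X * X `^ (p - 1) = X `^ p by rewrite mulr_powRB1// ltW.
have rr : B `^ (2 - 2 / p) = r * r.
  rewrite /r -powRD; last by rewrite (gt_eqF b0) implybT.
  by rewrite /b -powRrM; congr (_ `^ _); field; rewrite gt_eqF.
have bp : b `^ p = B by rewrite /b -powRrM mulVf ?gt_eqF// powRr1// ltW.
have XpB : X `^ p <= B + F `^ p.
  rewrite /X; have [bF|Fb] := leP b F; last by rewrite bp lerDl powR_ge0.
  by rewrite lerDr ltW.
have XrX : X * r <= X `^ p by rewrite -XpE ler_pM2l.
exists (X / r); first by rewrite divr_gt0.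
split; apply: (le_trans _ XpB); apply: (le_trans _ XrX).
  by rewrite rr mulrA divfK// gt_eqF.
rewrite invf_div -mulrA (mulrC X r) ler_pM2l// mulrC ler_pdivrMr// expr2.
by apply: ler_pM.
Qed.

(** With [x = K / B] this is [x^s <= 1 + x]. *)
Lemma powR_weight_le (B K s : R) : 0 < B -> 0 < K -> 0 <= s <= 1 ->
  K `^ s <= B `^ s * (1 + K / B).
Proof.
move=> B0 K0 /andP[s0 s1].
have KB : 0 < K / B by rewrite divr_gt0.
have -> : K `^ s = B `^ s * (K / B) `^ s.
  by rewrite -powRM ?ltW// mulrC divfK// gt_eqF.
apply: ler_wpM2l; first exact: powR_ge0.
have [h|h] := leP 1 (K / B).
  rewrite (@le_trans _ _ ((K / B) `^ 1)) ?ler_powR//.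
  by rewrite powRr1 ?(ltW KB)// lerDr.
rewrite (@le_trans _ _ (1 `^ s))//; last by rewrite powR1 lerDl ltW.
by rewrite ge0_ler_powR ?nnegrE// ltW.
Qed.

Definition weight d (k : 'rV[int]_d) : R := 1 + dot (freq k) (freq k).

Lemma weight_gt0 d (k : 'rV[int]_d) : 0 < weight k.
Proof. by rewrite ltr_wpDr// -enorm_sqr sqr_ge0. Qed.

Lemma fpair_partial d (g : 'rV[R]_d -> R) i k : torus_C1 i g ->
  fpair (partial i g) (partial i g) k = (k 0 i)%:~R ^+ 2 * fpair g g k.
Proof. by move=> g1; rewrite /fpair cosc_partial// sinc_partial//; ring. Qed.

(** Bessel's inequality for [g] and for its derivatives, whose coefficients carry the
factors [k_i]. *)
Lemma weighted_bessel d N (g : 'rV[R]_d -> R) : torus_cont g -> (forall i, torus_C1 i g) ->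
  (pi *+ 2) ^- d * \sum_(k <- cube d N) weight k * fpair g g k <=
  l2form g g + \sum_i l2form (partial i g) (partial i g).
Proof.
move=> cg g1.
have -> : \sum_(k <- cube d N) weight k * fpair g g k = \sum_(k <- cube d N) fpair g g k +
    \sum_i \sum_(k <- cube d N) fpair (partial i g) (partial i g) k.
  rewrite exchange_big -big_split/=; apply: eq_bigr => k _.
  rewrite /weight mulrDl mul1r /dot mulr_suml; congr (_ + _); apply: eq_bigr => i _.
  by rewrite fpair_partial// !mxE expr2.
rewrite mulrDr l2formE lerD ?bessel// mulr_sumr.
by apply: ler_sum => i _; rewrite l2formE bessel//; case: (g1 i).
Qed.

(** Interpolation between the energy and its dissipation. *)
Lemma sobolev_bessel d N (g : 'rV[R]_d -> R) (B E s : R) : torus_cont g -> (forall i, torus_C1 i g) ->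
  0 < B -> 0 <= s <= 1 ->
  l2form g g <= E -> l2form g g + \sum_i l2form (partial i g) (partial i g) <= (E + 1) * B ->
  (pi *+ 2) ^- d * \sum_(k <- cube d N) weight k `^ s * fpair g g k <= B `^ s * (2 * E + 1).
Proof.
move=> cg g1 B0 s01 hE hG.
have hb := bessel N cg; rewrite -l2formE in hb.
have hw := weighted_bessel N cg g1.
apply: (@le_trans _ _ (B `^ s * ((pi *+ 2) ^- d * \sum_(k <- cube d N) fpair g g k +
    ((pi *+ 2) ^- d * \sum_(k <- cube d N) weight k * fpair g g k) / B))).
  rewrite -mulrA -mulrDr mulrCA ler_wpM2l ?pi2V_ge0//.
  rewrite mulr_suml -big_split/= mulr_sumr; apply: ler_sum => k _.
  have -> : B `^ s * (fpair g g k + weight k * fpair g g k / B) =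
     B `^ s * (1 + weight k / B) * fpair g g k by ring.
  by rewrite ler_wpM2r ?fpair_ge0// powR_weight_le// weight_gt0.
apply: ler_wpM2l; first exact: powR_ge0.
rewrite (_ : 2 * E + 1 = E + (E + 1)); last by ring.
by rewrite lerD ?(le_trans hb)// ler_pdivrMr// (le_trans hw).
Qed.

(** Pointwise in time, the work lost by a filter is controlled by the dissipation and
by the critical norm of the force, uniformly in the filter. *)
Lemma work_defect_bound d (v w : 'rV[R]_d -> 'rV[R]_d) (sym : 'rV[int]_d -> R) M (E p : R) :
  (forall i, torus_cont (fun x => v x 0 i)) -> (forall i j, torus_C1 j (fun x => v x 0 i)) ->
  (forall i, torus_cont (fun x => w x 0 i)) ->
  (forall k, 0 <= sym k <= 1) -> (forall k, k \notin cube d M -> sym k = 0) ->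
  1 <= p <= 2 -> 0 <= E -> vform (@l2form d) v v <= E ->
  (`|vform (defect sym M) w v|%:E <=
    (d%:R * (2 * E + 1 + (pi *+ 2) ^+ d))%:E *
    ((1 + gradform (@l2form d) v)%:E + Hs_norm (- 2 + 2 / p) w `^ p))%E.
Proof.
move=> cv dv cw sym01 symM p12 E0 hE.
have /andP[p1 p2] := p12.
have p0 : 0 < p by apply: lt_le_trans p1.
set C := d%:R * _.
have [d0|d0] := posnP d.
  rewrite /vform big1; last by move=> i; have := ltn_ord i; rewrite {2}d0.
  rewrite normr0 mule_ge0//; last first.
    by rewrite adde_ge0 ?poweR_ge0// lee_fin addr_ge0// gradform_ge0// => i j; exact: l2form_ge0.
  by rewrite lee_fin /C d0 mul0r.
have pd0 : 0 < (pi *+ 2) ^+ d :> R by rewrite exprn_gt0 ?pi2_gt0.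
have C0 : 0 < C by rewrite mulr_gt0 ?ltr0n// ltr_wpDl// addr_ge0// mulr_ge0.
pose G := gradform (@l2form d) v.
have G0 : 0 <= G by apply: gradform_ge0 => i j; exact: l2form_ge0.
rewrite -/G /Hs_norm; set S := \esum_(k in _) _.
have S0 : (0 <= S)%E.
  apply: esum_ge0 => k _; rewrite lee_fin mulr_ge0 ?powR_ge0// sumr_ge0// => i _.
  by rewrite addr_ge0// sqr_ge0.
(* A force outside the critical space at this time makes the majorant infinite. *)
case: (eqVneq S +oo%E) => [->|Sy].
  rewrite !poweRyr ?gt_eqF ?invr_gt0// addeC gt0_muley ?lte_fin//.
  by rewrite leey.
have Sfin : S \is a fin_num by rewrite ge0_fin_numE// lt_neqAle Sy leey.
pose F := Num.sqrt (fine S); have F0 : 0 <= F by exact: sqrtr_ge0.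
have F2 : F ^+ 2 = fine S by rewrite sqr_sqrtr// fine_ge0.
have -> : ((S `^ 2^-1) `^ p)%E = (F `^ p)%:E.
  by rewrite -(fineK Sfin) !poweR_EFin powR12_sqrt// fine_ge0.
rewrite -EFinD -EFinM lee_fin.
have B1 : 1 <= 1 + G by rewrite lerDl.
have B0 : 0 < 1 + G by apply: lt_le_trans B1.
have [A A0 [hA1 hA2]] := critical_scaling B1 F0 p12.
set s := 2 - 2 / p in hA1.
have s01 : 0 <= s <= 1.
  rewrite /s subr_ge0 ler_pdivrMr// lerBlDl -lerBlDr ler_pdivlMr//.
  by apply/andP; split; lra.
set Q := 1 + G + F `^ p in hA1 hA2 *.
have comp i : `|defect sym M (fun x => w x 0 i) (fun x => v x 0 i)| <= (2 * E + 1 + (pi *+ 2) ^+ d) * Q.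
  have hEi : l2form (fun x => v x 0 i) (fun x => v x 0 i) <= E.
    apply: le_trans hE; rewrite /vform (bigD1 i)//= lerDl sumr_ge0// => j _.
    exact: l2form_ge0.
  (* [(E + 1) (1 + G)] rather than [E + G], to divide by [1 + G] in the interpolation. *)
  have hGi : l2form (fun x => v x 0 i) (fun x => v x 0 i) +
      \sum_j l2form (partial j (fun x => v x 0 i)) (partial j (fun x => v x 0 i)) <= (E + 1) * (1 + G).
    apply: (@le_trans _ _ (E + G)).
      apply: lerD => //; rewrite /G /gradform [leRHS](bigD1 i)//= lerDl sumr_ge0// => k _.
      by apply: sumr_ge0 => j _; exact: l2form_ge0.
    have := mulr_ge0 E0 G0; lra.
  rewrite (form_sym (energy_form_defect _ _)).
  apply: le_trans (_ : (A * ((1 + G) `^ s * (2 * E + 1)) + A^-1 * ((pi *+ 2) ^+ d * F ^+ 2)) / 2 <= _); last first.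
    have -> : A * ((1 + G) `^ s * (2 * E + 1)) = (A * (1 + G) `^ s) * (2 * E + 1) by ring.
    have -> : A^-1 * ((pi *+ 2) ^+ d * F ^+ 2) = (A^-1 * F ^+ 2) * (pi *+ 2) ^+ d by ring.
    have h1 : A * (1 + G) `^ s * (2 * E + 1) <= Q * (2 * E + 1).
      by rewrite ler_wpM2r// addr_ge0// mulr_ge0.
    have h2 : (A^-1 * F ^+ 2) * (pi *+ 2) ^+ d <= Q * (pi *+ 2) ^+ d.
      by rewrite ler_wpM2r// ltW.
    have Q0 : 0 <= Q by rewrite addr_ge0 ?powR_ge0// ltW.
    rewrite ler_pdivrMr//; apply: (le_trans (lerD h1 h2)); rewrite -mulrDr (mulrC _ Q).
    by rewrite ler_peMr ?ler1n// mulr_ge0// !addr_ge0 ?mulr_ge0// ltW.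
  apply: (@defect_dual_bound _ _ _ _ _ (fun k => A * weight k `^ s)) => //.
  - by move=> k; rewrite mulr_gt0// powR_gt0// weight_gt0.
  - move=> N; under eq_bigr do rewrite -mulrA.
    rewrite -mulr_sumr mulrCA ler_pM2l//.
    exact: sobolev_bessel.
  - move=> N; under eq_bigr do rewrite invfM -mulrA.
    rewrite -mulr_sumr mulrCA ler_pM2l ?invr_gt0//.
    have cN : (pi *+ 2) ^- d = (pi *+ 2) ^+ d * (pi *+ 2) ^- d ^+ 2 :> R.
      by rewrite expr2 mulrA divff ?mul1r// gt_eqF.
    rewrite cN -mulrA ler_pM2l// mulr_sumr F2 -lee_fin fineK//.
    apply: le_trans (le_esum_seq (s := cube d N) _ _); last 2 first.
    + exact: cube_uniq.
    + move=> k; rewrite mulr_ge0 ?powR_ge0// sumr_ge0// => j _.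
      by rewrite addr_ge0// sqr_ge0.
    rewrite lee_fin; apply: ler_sum => k _.
    rewrite (_ : - 2 + 2 / p = - s); last by rewrite /s; ring.
    rewrite powRN mulrCA ler_wpM2l ?invr_ge0 ?powR_ge0// -sqmod_fourier_coef.
    rewrite (bigD1 i)//= lerDl sumr_ge0// => j _.
    by rewrite addr_ge0// sqr_ge0.
rewrite /C -mulrA; apply: (le_trans (ler_norm_sum _ _ _)).
apply: (le_trans (ler_sum _ (fun i _ => comp i))).
by rewrite sumr_const card_ord -[leLHS]mulr_natl.
Qed.

(** * The defect of the Littlewood-Paley filter *)

Lemma integral_to_endE (tau a : R) (h : R -> R) : a < tau ->
  mu.-integrable `[a, tau[ (EFin \o h) ->
  int_to_end tau a h = \int[mu]_(t in `[a, tau[) h t.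
Proof. by move=> at_ ih; apply: cvg_lim => //; exact: cvg_Rintegral_left. Qed.

Lemma limn_esup_norm0 (v : nat -> R) : v q @[q --> \oo] --> (0 : R) ->
  limn_esup (fun q => `|v q|%:E) = 0%E.
Proof.
move=> v0; apply: (cvg_limn_einf_sup _).2.
apply: cvg_EFin; first exact: nearW.
by rewrite -(normr0 R); exact: (cvg_norm v0).
Qed.

Lemma measurable_half_open (a b : R) : measurable (`[a, b[%classic : set (measurableTypeR R)).
Proof. exact: measurable_itv. Qed.

Lemma integrable_cst_co (a b c : R) : mu.-integrable `[a, b[ (EFin \o (fun=> c)).
Proof.
apply: (@integrableS _ _ _ mu `[a, b]%classic); [exact: measurable_itv|exact: measurable_itv| |].
  by apply: subset_itvl; rewrite bnd_simp.
apply: continuous_compact_integrable; first exact: segment_compact.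
by apply: continuous_subspaceT => t; exact: cvg_cst.
Qed.

Section measurable_norm.
Variables (tau : R) (d : nat) (f : R -> 'rV[R]_d -> 'rV[R]_d).
Hypothesis sf : smooth_QT tau f.

Lemma fpair_cont i k :
  {in `]0, tau[, continuous (fun t => fpair (fun x => f t x 0 i) (fun x => f t x 0 i) k)}.
Proof.
have cc : {in `]0, tau[, continuous (fun t => cosc (fun x => f t x 0 i) k)}.
  apply: (jointly_cont_int (h := fun t x => f t x 0 i * cosm k x)); apply: jointly_contZr.
    exact: smooth_C0.
  by case: (torus_C1_cosm i k).
have cs : {in `]0, tau[, continuous (fun t => sinc (fun x => f t x 0 i) k)}.
  apply: (jointly_cont_int (h := fun t x => f t x 0 i * sinm k x)); apply: jointly_contZr.
    exact: smooth_C0.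
  by case: (torus_C1_sinm i k).
move=> t It; exact: (cvgD (cvgM (cc t It) (cc t It)) (cvgM (cs t It) (cs t It))).
Qed.

Lemma measurable_Hs_norm (s : R) :
  measurable_fun (`]0, tau[%classic : set (measurableTypeR R)) (fun t => Hs_norm s (f t)).
Proof.
apply: (measurableT_comp (measurable_poweR 2^-1)).
apply: measurable_fun_esum => [k|k t]; last first.
  rewrite lee_fin mulr_ge0 ?powR_ge0// sumr_ge0// => i _.
  by rewrite addr_ge0// sqr_ge0.
apply/measurable_EFinP; apply: open_continuous_measurable_fun; first exact: interval_open.
move=> t; rewrite inE/= => It.
apply: (cvgM (cvg_cst _)); apply: (@cvg_sum_seq _ _ (nbhs t)) => i _.
rewrite (_ : (fun t => _) = (fun t => (pi *+ 2) ^- d ^+ 2 *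
    fpair (fun x => f t x 0 i) (fun x => f t x 0 i) k)); last first.
  by apply/funext => z; exact: sqmod_fourier_coef.
rewrite sqmod_fourier_coef; apply: (cvgM (cvg_cst _)); exact: fpair_cont.
Qed.

End measurable_norm.

Section vanishing_defect.
Variables (d : nat) (chi : 'rV[R]_d -> R).
Hypotheses (d0 : (0 < d)%N) (hchi : LP_cutoff chi).

Definition lp_defect q := defect (fun k : 'rV[int]_d => lp_symbol chi q k ^+ 2) (2 ^ q.+1).

Lemma lp_symbol_sqr_itv q k : 0 <= lp_symbol chi q k ^+ 2 <= 1.
Proof.
have /andP[h0 h1] := lp_symbol_itv q k d0 hchi.
by rewrite exprn_ge0//= exprn_ile1.
Qed.

Lemma lp_symbol_sqr_out q k : k \notin cube d (2 ^ q.+1) -> lp_symbol chi q k ^+ 2 = 0.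
Proof. by move=> h; rewrite lp_symbol_out// expr0n. Qed.

Lemma energy_form_lp_defect q : energy_form (lp_defect q).
Proof. exact: energy_form_defect. Qed.

Lemma lp_defect_ge0 q g : torus_cont g -> 0 <= lp_defect q g g.
Proof. by apply: defect_ge0 => k; have /andP[] := lp_symbol_sqr_itv q k. Qed.

Lemma lp_defect_le q g : lp_defect q g g <= l2form g g.
Proof. by apply: defect_le => k; have /andP[] := lp_symbol_sqr_itv q k. Qed.

Lemma lp_defect_cvg0 g : torus_cont g -> lp_defect q g g @[q --> \oo] --> (0 : R).
Proof.
move=> cg; apply/cvgrPdist_le => e e0.
have [N hN] := defect_small cg e0.
exists (d * N)%N => // q /= dNq; rewrite sub0r normrN ger0_norm ?lp_defect_ge0//.
have dN2 : (d * N <= 2 ^ q)%N by apply: (leq_trans dNq); rewrite ltnW// ltn_expl.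
apply: hN => [k|k kN|]; first by have /andP[] := lp_symbol_sqr_itv q k.
  by rewrite (lp_symbol1 hchi dN2 kN) expr1n.
apply: (leq_trans (leq_pmull N d0)); apply: (leq_trans dN2).
by rewrite leq_exp2l.
Qed.

(** By the Cauchy-Schwarz inequality: the defect at [g] tends to 0 while the one at [h] is
bounded by its squared norm. *)
Lemma lp_defect_cross_cvg0 g h : torus_cont g -> torus_cont h ->
  lp_defect q g h @[q --> \oo] --> (0 : R).
Proof.
move=> cg ch; apply/cvgrPdist_le => e e0.
have E0 : 0 < e ^+ 2 / (l2form h h + 1) by rewrite divr_gt0 ?exprn_gt0// ltr_wpDl// l2form_ge0.
have /cvgrPdist_le/(_ _ E0) := lp_defect_cvg0 cg.
apply: filterS => q; rewrite !sub0r !normrN ger0_norm ?lp_defect_ge0// ler_pdivlMr; last first.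
  by rewrite ltr_wpDl// l2form_ge0.
move=> hq; rewrite -(@ler_pXn2r _ 2)// ?nnegrE ?(ltW e0)// real_normK ?num_real//.
apply: (le_trans (form_cauchy_schwarz (energy_form_lp_defect q) (@lp_defect_ge0 q) cg ch)).
apply: le_trans hq; apply: ler_pM; rewrite ?lp_defect_ge0//.
by rewrite (le_trans (lp_defect_le q h))// lerDl.
Qed.

Lemma vform_lp_defect_cvg0 (v w : 'rV[R]_d -> 'rV[R]_d) :
  (forall i, torus_cont (fun x => v x 0 i)) -> (forall i, torus_cont (fun x => w x 0 i)) ->
  vform (lp_defect q) v w @[q --> \oo] --> (0 : R).
Proof.
move=> cv cw; rewrite -[X in _ --> X](_ : \sum_(i < d) 0 = 0); last by rewrite big1.
by apply: (@cvg_sum_seq _ _ \oo) => i _; exact: lp_defect_cross_cvg0.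
Qed.

Lemma gradform_lp_defect_cvg0 (v : 'rV[R]_d -> 'rV[R]_d) :
  (forall i j, torus_cont (partial j (fun x => v x 0 i))) ->
  gradform (lp_defect q) v @[q --> \oo] --> (0 : R).
Proof.
move=> cv; rewrite -[X in _ --> X](_ : \sum_(i < d) \sum_(j < d) 0 = 0); last first.
  by rewrite big1// => i _; rewrite big1.
apply: (@cvg_sum_seq _ _ \oo) => i _; apply: (@cvg_sum_seq _ _ \oo) => j _.
exact: lp_defect_cvg0.
Qed.

(** Filtering both fields removes their defect from the L^2 product. *)
Lemma inner_lowpass_defect q (v w : 'rV[R]_d -> 'rV[R]_d) :
  (forall i, torus_cont (fun x => v x 0 i)) -> (forall i, torus_cont (fun x => w x 0 i)) ->
  inner (lowpass chi q v) (lowpass chi q w) =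
  vform (@l2form d) v w - vform (lp_defect q) v w.
Proof.
move=> cv cw; rewrite inner_lowpass// /vform -sumrB; apply: eq_bigr => i _.
by rewrite /lp_defect /defect /form_sub opprB addrC subrK.
Qed.

End vanishing_defect.

(** * The anomalous work vanishes *)

Section vanishing_work.
Variables (tau : R) (d : nat) (chi : 'rV[R]_d -> R).
Variables (u f : R -> 'rV[R]_d -> 'rV[R]_d) (p : R).
Hypotheses (tau0 : 0 < tau) (d0 : (0 < d)%N) (hchi : LP_cutoff chi).
Hypotheses (huf : class_N tau u f) (hp : 1 <= p <= 2) (hf : Lp_Hs tau p (- 2 + 2 / p) f).

Let su : smooth_QT tau u. Proof. by case: huf => -[]. Qed.
Let sf : smooth_QT tau f. Proof. by case: huf => -[]. Qed.
Let nse : NSE tau u f. Proof. by case: huf. Qed.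

Lemma half_gt0 : 0 < tau / 2. Proof. by rewrite divr_gt0. Qed.
Lemma half_lt : tau / 2 < tau. Proof. by rewrite ltr_pdivrMr// ltr_pMr// ltr1n. Qed.

Lemma cont_comp (v : R -> 'rV[R]_d -> 'rV[R]_d) t : smooth_QT tau v -> t \in `]0, tau[ ->
  forall i, torus_cont (fun x => v t x 0 i).
Proof. by move=> sv It i; exact: (jointly_contl (smooth_C0 sv i) It). Qed.

Lemma half_sub t : t \in `[tau / 2, tau[ -> t \in `]0, tau[.
Proof. exact: (subset_co_oo half_gt0). Qed.

Lemma integrable_Hs_norm :
  mu.-integrable `[tau / 2, tau[ (fun t => (Hs_norm (- 2 + 2 / p) (f t) `^ p)%E).
Proof.
have mH : measurable_fun (`]0, tau[%classic : set (measurableTypeR R))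
    (fun t => (Hs_norm (- 2 + 2 / p) (f t) `^ p)%E).
  by apply: (measurableT_comp (measurable_poweR p)); exact: measurable_Hs_norm.
have sub := @subset_co_oo _ tau half_gt0.
apply/integrableP; split; first exact: (measurable_funS (measurable_itv _) sub mH).
under eq_integral do rewrite gee0_abs ?poweR_ge0//.
apply: le_lt_trans hf; apply: ge0_subset_integral => //.
by move=> t _; exact: poweR_ge0.
Qed.

(** The work of the force against the high frequencies vanishes, and no work is lost
to the final time. *)
Lemma lp_defect_work :
  (forall q, mu.-integrable `[tau / 2, tau[
     (EFin \o (fun t => vform (lp_defect chi q) (f t) (u t)))) /\
  (\int[mu]_(t in `[tau / 2, tau[) vform (lp_defect chi q) (f t) (u t)) @[q --> \oo] --> (0 : R).
Proof.
have [[E E0 hE] iG] := energy_bounds tau0 huf.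
pose C : R := d%:R * (2 * E + 1 + (pi *+ 2) ^+ d).
pose Psi t := (C%:E * ((1 + gradform (@l2form d) (u t))%:E + Hs_norm (- 2 + 2 / p) (f t) `^ p))%E.
apply: (int_to_end_dominated (Psi := Psi) half_lt).
- move=> q; apply: (measurable_co half_gt0).
  exact: (cont_work_form su sf (energy_form_lp_defect chi q)).
- apply: integrableZl; first exact: measurable_itv.
  apply: integrableD; first exact: measurable_itv.
    have := integrableD (measurable_half_open _ _) (@integrable_cst_co (tau / 2) tau 1) iG.
    by apply: eq_integrable.
  exact: integrable_Hs_norm.
- move=> q t It; have It0 := half_sub It.
  apply: work_defect_bound => //.
  + exact: cont_comp.
  + by move=> i j; exact: (smooth_torus_C1 su i j It0).
  + exact: cont_comp.
  + exact: lp_symbol_sqr_itv.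
  + exact: lp_symbol_sqr_out.
  + exact: hE.
- by move=> t It; apply: vform_lp_defect_cvg0 => //; apply: cont_comp => //; exact: half_sub.
Qed.

Lemma anomalous_work_eq0 : anomalous_work tau chi u f = 0%E.
Proof.
have [iW W0] := lp_defect_work.
have E q : int_to_end tau (tau / 2) (fun t =>
    inner (lowpass chi q (u t)) (lowpass chi q (f t)) - inner (u t) (f t)) =
    -1 * \int[mu]_(t in `[tau / 2, tau[) vform (lp_defect chi q) (f t) (u t).
  have F t : t \in `]0, tau[ -> 
      inner (lowpass chi q (u t)) (lowpass chi q (f t)) - inner (u t) (f t) =
      -1 * vform (lp_defect chi q) (f t) (u t).
    move=> It; have cu := cont_comp su It; have cf := cont_comp sf It.
    rewrite inner_lowpass_defect// inner_vform// (vform_sym _ _ (energy_form_lp_defect chi q)); ring.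
  have iN := integrableZl (measurable_half_open _ _) (-1) (iW q).
  rewrite integral_to_endE; [|exact: half_lt|]; last first.
    apply: (eq_integrable (measurable_half_open _ _) _ _ _ iN) => t; rewrite inE => It /=.
    by rewrite F//; exact: half_sub.
  rewrite -RintegralZl//.
  by apply: eq_Rintegral => t; rewrite inE => It; rewrite F//; exact: half_sub.
apply: limn_esup_norm0; rewrite (funext E).
by rewrite -[X in _ --> X](mulr0 (-1)); exact: (cvgM (cvg_cst _) W0).
Qed.

End vanishing_work.

(** * Strong continuity of the energy at the final time *)

Lemma sqr_L2norm d (w : 'rV[R]_d -> 'rV[R]_d) :
  (L2norm w `^ 2 = \int[torus_measure d]_x (dot (w (vec_of_tuple x)) (w (vec_of_tuple x)))%:E)%E.
Proof.
rewrite poweR_Lnorm ?pnatr_eq0//; apply: eq_integral => x _.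
rewrite gee0_abs ?lee_fin ?enorm_ge0// poweR_EFin.
by rewrite -[2]/(2%:R) powR_mulrn ?enorm_ge0// enorm_sqr.
Qed.

Lemma dot_sub_le d (x y : 'rV[R]_d) : dot (x - y) (x - y) <= 2 * dot x x + 2 * dot y y.
Proof.
rewrite /dot !mulr_sumr -big_split/=; apply: ler_sum => i _; rewrite !mxE.
by have := sqr_ge0 (x 0 i + y 0 i); lra.
Qed.

Lemma dot_ge0 d (x : 'rV[R]_d) : 0 <= dot x x.
Proof. by rewrite -enorm_sqr sqr_ge0. Qed.

Lemma measurable_dot d (w : 'rV[R]_d -> 'rV[R]_d) :
  (forall i, measurable_fun setT (fun x : d.-tuple (measurableTypeR R) => w (vec_of_tuple x) 0 i)) ->
  measurable_fun setT (fun x : d.-tuple (measurableTypeR R) =>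
    (dot (w (vec_of_tuple x)) (w (vec_of_tuple x)))%:E).
Proof.
move=> mw; apply/measurable_EFinP; apply: measurable_sum => i.
exact: measurable_funM.
Qed.

Lemma inL2_measurable d (w : 'rV[R]_d -> 'rV[R]_d) i : inL2 w ->
  measurable_fun setT (fun x : d.-tuple (measurableTypeR R) => w (vec_of_tuple x) 0 i).
Proof. by move=> [_ /(_ i)]; rewrite !inE => /andP[]; rewrite inE. Qed.

Lemma torus_cont_measurable d (g : 'rV[R]_d -> R) : torus_cont g ->
  measurable_fun setT (fun x : d.-tuple (measurableTypeR R) => g (vec_of_tuple x)).
Proof. by move=> [_ cg]; exact: measurable_vec. Qed.

(** Only the parallelogram inequality is used, so that the two fields may be compared
with a third one that is merely square integrable. *)
Lemma inner_sub_le d (v v' w : 'rV[R]_d -> 'rV[R]_d) (e : R) :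
  (forall i, torus_cont (fun x => v x 0 i)) -> (forall i, torus_cont (fun x => v' x 0 i)) ->
  inL2 w -> 0 <= e ->
  (L2norm (fun x => v x - w x)%R <= e%:E)%E -> (L2norm (fun x => v' x - w x)%R <= e%:E)%E ->
  inner (fun x => v x - v' x) (fun x => v x - v' x) <= 4 * e ^+ 2.
Proof.
move=> cv cv' hw e0 hv hv'.
have sq (z : 'rV[R]_d -> 'rV[R]_d) : (L2norm (fun x => z x - w x)%R <= e%:E)%E ->
    (\int[torus_measure d]_x (dot ((z (vec_of_tuple x) - w (vec_of_tuple x))%R)
       ((z (vec_of_tuple x) - w (vec_of_tuple x))%R))%:E <= (e ^+ 2)%:E)%E.
  move=> hz; rewrite -(@sqr_L2norm d (fun x => z x - w x)).
  have -> : (e ^+ 2)%:E = (e%:E `^ 2)%E :> \bar R.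
    by rewrite poweR_EFin -[2 in RHS]/(2%:R) powR_mulrn.
  apply: gt0_ler_poweR; rewrite ?in_itv/= ?leey ?Lnorm_ge0 ?lee_fin ?e0//.
have mz (z : 'rV[R]_d -> 'rV[R]_d) : (forall i, torus_cont (fun x => z x 0 i)) ->
    measurable_fun setT (fun x : d.-tuple (measurableTypeR R) =>
    (2 * dot (z (vec_of_tuple x) - w (vec_of_tuple x)) (z (vec_of_tuple x) - w (vec_of_tuple x)))%:E).
  move=> cz.
  have : measurable_fun setT (fun x : d.-tuple (measurableTypeR R) =>
     (dot (z (vec_of_tuple x) - w (vec_of_tuple x)) (z (vec_of_tuple x) - w (vec_of_tuple x)))%:E).
    apply: (@measurable_dot d (fun x => z x - w x)) => i.
    rewrite (_ : (fun x => _) = (fun x : d.-tuple (measurableTypeR R) =>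
      z (vec_of_tuple x) 0 i - w (vec_of_tuple x) 0 i)); last by apply/funext => x; rewrite !mxE.
    apply: measurable_funB; first exact: (torus_cont_measurable (cz i)).
    exact: inL2_measurable.
  by move=> /measurable_EFinP h; apply/measurable_EFinP; apply: measurable_funM.
have two (z : 'rV[R]_d -> 'rV[R]_d) : (forall i, torus_cont (fun x => z x 0 i)) ->
   (L2norm (fun x => z x - w x)%R <= e%:E)%E ->
   (\int[torus_measure d]_x (2 * dot ((z (vec_of_tuple x) - w (vec_of_tuple x))%R)
       ((z (vec_of_tuple x) - w (vec_of_tuple x))%R))%:E <= (2 * e ^+ 2)%:E)%E.
  move=> cz hz; under eq_integral do rewrite EFinM.
  rewrite ge0_integralZl//; first by rewrite EFinM lee_pmul2l// sq.
  - have /measurable_EFinP := mz z cz => h; apply/measurable_EFinP.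
    have := measurable_funM (@measurable_cst _ _ _ _ setT (2^-1 : R)) h.
    by apply: eq_measurable_fun => x _ /=; rewrite mulrA mulVf ?mul1r.
  - by move=> x _; rewrite lee_fin dot_ge0.
have key : (\int[torus_measure d]_x (dot ((v (vec_of_tuple x) - v' (vec_of_tuple x))%R)
       ((v (vec_of_tuple x) - v' (vec_of_tuple x))%R))%:E <= (4 * e ^+ 2)%:E)%E.
  have -> : 4 * e ^+ 2 = 2 * e ^+ 2 + 2 * e ^+ 2 by ring.
  rewrite EFinD; apply: le_trans (leeD (two v cv hv) (two v' cv' hv')).
  rewrite -ge0_integralD//; [|by move=> x _; rewrite lee_fin mulr_ge0 ?dot_ge0|exact: mz|
    by move=> x _; rewrite lee_fin mulr_ge0 ?dot_ge0|exact: mz].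
  apply: ge0_le_integral => //.
  - by move=> x _; rewrite lee_fin dot_ge0.
  - apply: (@measurable_dot d (fun x => v x - v' x)) => i.
    have := torus_contB (cv i) (cv' i); move=> /torus_cont_measurable.
    by apply: eq_measurable_fun => x _; rewrite !mxE.
  - by apply: emeasurable_funD; exact: mz.
  - move=> x _; rewrite -EFinD lee_fin; apply: le_trans (dot_sub_le _ _).
    by rewrite opprB addrA subrK.
rewrite /inner /torus_int /Rintegral -lee_fin fineK//.
rewrite ge0_fin_numE; first by apply: le_lt_trans key _; rewrite ltry.
by apply: integral_ge0 => x _; rewrite lee_fin dot_ge0.
Qed.

Lemma form_young d (B : ('rV[R]_d -> R) -> ('rV[R]_d -> R) -> R) g h (l : R) :
  energy_form B -> (forall g, torus_cont g -> 0 <= B g g) ->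
  torus_cont g -> torus_cont h -> 0 < l ->
  B g g <= (1 + l) * B h h + (1 + l^-1) * B (fun x => g x - h x) (fun x => g x - h x).
Proof.
move=> fB pos cg ch l0.
have ck := torus_contB cg ch; set k := fun x => g x - h x in ck *.
have E : B g g = B h h + 2 * 1 * B h k + 1 ^+ 2 * B k k.
  rewrite -form_expand//; congr B; apply/funext => x; rewrite /k; ring.
have := pos _ (torus_contD ch (torus_contZ (- l^-1) ck)).
rewrite (form_expand (- l^-1) fB ch ck) => /(mulr_ge0 (ltW l0)).
have -> : l * (B h h + 2 * - l^-1 * B h k + (- l^-1) ^+ 2 * B k k) =
    l * B h h - 2 * B h k + l^-1 * B k k by field; rewrite gt_eqF.
by rewrite E; lra.
Qed.

(** The constants show that two fields that are close in L^2 have almost the same energy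
for any form bounded by the L^2 product, which applies to all the cutoffs at once. *)
Lemma vform_young d (B : ('rV[R]_d -> R) -> ('rV[R]_d -> R) -> R) (v w : 'rV[R]_d -> 'rV[R]_d) (l : R) :
  energy_form B -> (forall g, torus_cont g -> 0 <= B g g) ->
  (forall i, torus_cont (fun x => v x 0 i)) -> (forall i, torus_cont (fun x => w x 0 i)) -> 0 < l ->
  vform B v v <= (1 + l) * vform B w w +
    (1 + l^-1) * vform B (fun x => v x - w x) (fun x => v x - w x).
Proof.
move=> fB pos cv cw l0; rewrite /vform !mulr_sumr -big_split/=; apply: ler_sum => i _.
apply: (le_trans (form_young fB pos (cv i) (cw i) l0)).
rewrite (_ : (fun x => (v x - w x) 0 i) = (fun x => v x 0 i - w x 0 i))//.
by apply/funext => x; rewrite !mxE.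
Qed.

Section energy_continuous_at_the_end.
Variables (tau : R) (d : nat) (u : R -> 'rV[R]_d -> 'rV[R]_d).
Hypotheses (tau0 : 0 < tau) (su : smooth_QT tau u) (cu : continuous_L2 tau u).

(** The final value is only known to be square integrable, so that two times are compared
through it and the estimate involves smooth fields only. *)
Lemma l2_cauchy_end (e : R) : 0 < e -> exists c, [/\ tau / 2 <= c, c < tau &
  forall s t, c < s -> s < tau -> c < t -> t < tau ->
    vform (@l2form d) (fun x => u s x - u t x) (fun x => u s x - u t x) <= e].
Proof.
move=> e0; case: cu => v [vu _ [vL2 _] cv].
pose r := Num.sqrt (e / 4); have r0 : 0 < r by rewrite sqrtr_gt0 divr_gt0.
have r2 : 4 * r ^+ 2 = e by rewrite sqr_sqrtr ?divr_ge0 ?ltW//; field.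
have := cv tau; rewrite (ltW tau0) lexx => /(_ isT).
move=> /(_ _ (@nbhs_open_ereal_lt _ 0 (fun=> r) r0)).
rewrite /nbhs/= /within/= => /nbhs_ballP[del /= del0 hdel].
pose c := Num.max (tau / 2) (tau - del).
have ctau : c < tau by rewrite gt_max half_lt// gtrBl del0.
exists c; split => //; first by rewrite le_max lexx.
have ok s : c < s -> s < tau -> (L2norm (fun x => u s x - v tau x)%R <= r%:E)%E.
  rewrite gt_max => /andP[s1 s2] st.
  have s0 : 0 < s by apply: lt_trans s1; rewrite divr_gt0.
  rewrite -(vu s) ?s0//; apply: ltW; apply: hdel.
    by rewrite /ball/= ger0_norm ?subr_ge0 ?(ltW st)//; lra.
  by rewrite in_itv/= (ltW s0) (ltW st).
have cont s : c < s -> s < tau -> forall i, torus_cont (fun x => u s x 0 i).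
  rewrite gt_max => /andP[s1 s2] st; apply: (cont_comp su); rewrite in_itv/= st andbT.
  by apply: lt_trans s1; rewrite divr_gt0.
move=> s t cs st ct tt; rewrite -r2 -inner_vform; first last.
- move=> i; have := torus_contB (cont s cs st i) (cont t ct tt i).
  by rewrite (_ : (fun x => (u s x - u t x) 0 i) = (fun x => u s x 0 i - u t x 0 i))//;
     apply/funext => x; rewrite !mxE.
- move=> i; have := torus_contB (cont s cs st i) (cont t ct tt i).
  by rewrite (_ : (fun x => (u s x - u t x) 0 i) = (fun x => u s x 0 i - u t x 0 i))//;
     apply/funext => x; rewrite !mxE.
apply: (inner_sub_le (cont s cs st) (cont t ct tt) vL2 (ltW r0)); exact: ok.
Qed.

End energy_continuous_at_the_end.

(** * The anomalous dissipation vanishes *)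

Section vanishing_dissipation.
Variables (tau : R) (d : nat) (chi : 'rV[R]_d -> R).
Variables (u f : R -> 'rV[R]_d -> 'rV[R]_d) (p : R).
Hypotheses (tau0 : 0 < tau) (d0 : (0 < d)%N) (hchi : LP_cutoff chi).
Hypotheses (huf : class_N tau u f) (hp : 1 <= p <= 2) (hf : Lp_Hs tau p (- 2 + 2 / p) f).
Hypothesis cu : continuous_L2 tau u.

Let su : smooth_QT tau u. Proof. by case: huf => -[]. Qed.
Let sf : smooth_QT tau f. Proof. by case: huf => -[]. Qed.
Let nse : NSE tau u f. Proof. by case: huf. Qed.

Let high_energy q t := vform (lp_defect chi q) (u t) (u t).

Lemma high_energy_ge0 q t : t \in `]0, tau[ -> 0 <= high_energy q t.
Proof. by move=> It; apply: vform_ge0 => i; apply: lp_defect_ge0 => //; exact: (cont_comp su It). Qed.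

Lemma high_energy_young q s t (l e : R) : s \in `]0, tau[ -> t \in `]0, tau[ -> 0 < l ->
  vform (@l2form d) (fun x => u s x - u t x) (fun x => u s x - u t x) <= e ->
  high_energy q s <= (1 + l) * high_energy q t + (1 + l^-1) * e.
Proof.
move=> Is It l0 he.
have := vform_young (energy_form_lp_defect chi q) (@lp_defect_ge0 d chi d0 hchi q)
  (cont_comp su Is) (cont_comp su It) l0.
move=> /le_trans; apply; rewrite lerD2l ler_wpM2l//; first by rewrite addr_ge0// invr_ge0 ltW.
by apply: le_trans he; apply: ler_sum => i _; exact: lp_defect_le.
Qed.

Lemma near_end (c : R) : c < tau -> \forall b \near tau^'-, c < b /\ b < tau.
Proof.
move=> ct; near=> b; split; first by near: b; exact: nbhs_left_gt.
by near: b; exact: nbhs_left_lt.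
Unshelve. all: by end_near. Qed.

(** The high-frequency energy is a Cauchy family. With parameter [l] in the inequality of
Young, it varies by at most [l] times the energy bound plus a multiple of the squared
distance in L^2. *)
Lemma high_energy_lim q : cvg (high_energy q b @[b --> tau^'-]).
Proof.
have [[E E0 hE] _] := energy_bounds tau0 huf.
apply: cauchy_cvg; apply: cauchy_exP => eps eps0.
(* Two errors of size [eps / 4], one for each term of Young's inequality. *)
have [l l0 lE] : exists2 l, 0 < l & l * E <= eps / 4.
  exists (eps / 4 / (E + 1)); first by rewrite divr_gt0 ?ltr_wpDl// divr_gt0.
  by rewrite mulrAC ler_pdivrMr ?ltr_wpDl// ler_pM2l ?divr_gt0// lerDl.
have l1 : 0 < 1 + l^-1 by rewrite addr_gt0 ?invr_gt0.
have [e e0 eE] : exists2 e, 0 < e & (1 + l^-1) * e = eps / 4.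
  exists (eps / 4 / (1 + l^-1)); first by rewrite !divr_gt0.
  by rewrite mulrC divfK// gt_eqF.
have [c [c1 ct hc]] := l2_cauchy_end tau0 su cu e0.
have [t0 [ct0 t0t]] : exists t0, c < t0 /\ t0 < tau by exists ((c + tau) / 2); split; lra.
have inI t : c < t -> t < tau -> t \in `[tau / 2, tau[.
  by move=> h1 h2; rewrite in_itv/= h2 andbT (le_trans c1)// ltW.
have step s t : c < s -> s < tau -> c < t -> t < tau ->
    high_energy q s - high_energy q t <= eps / 4 + eps / 4.
  move=> cs st ct' tt.
  have Is := half_sub tau0 (inI s cs st); have It := half_sub tau0 (inI t ct' tt).
  have := high_energy_young q Is It l0 (hc s t cs st ct' tt); rewrite eE => h.
  have : l * high_energy q t <= eps / 4.
    apply: le_trans lE; rewrite ler_pM2l//; apply: le_trans (hE t (inI t ct' tt)).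
    by apply: ler_sum => i _; exact: lp_defect_le.
  by move: h; move: (high_energy q s) (high_energy q t) => x y; lra.
exists (high_energy q t0); have := near_end ct; apply: filterS => b [cb bt].
have := step t0 b ct0 t0t cb bt; have := step b t0 cb bt ct0 t0t.
rewrite /ball/= ltr_norml.
by move: (high_energy q b) (high_energy q t0) => x y h1 h2; apply/andP; split; lra.
Qed.

(** The energy of the high frequencies tends to zero uniformly up to the final time. *)
Lemma high_energy_end_cvg0 :
  lim (high_energy q b @[b --> tau^'-]) @[q --> \oo] --> (0 : R).
Proof.
apply/cvgrPdist_le => e e0.
have e4 : 0 < e / 4 by rewrite divr_gt0.
have [c [c1 ct hc]] := l2_cauchy_end tau0 su cu e4.
have [t0 [ct0 t0t]] : exists t0, c < t0 /\ t0 < tau by exists ((c + tau) / 2); split; lra.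
have inI t : c < t -> t < tau -> t \in `]0, tau[.
  by move=> h1 h2; apply: (half_sub tau0); rewrite in_itv/= h2 andbT (le_trans c1)// ltW.
have It0 := inI t0 ct0 t0t.
have := vform_lp_defect_cvg0 d0 hchi (cont_comp su It0) (cont_comp su It0).
move=> /cvgrPdist_le/(_ _ e4); apply: filterS => q.
rewrite !sub0r !normrN => /ler_normlW hq.
have nb : \forall b \near tau^'-, 0 <= high_energy q b <= e.
  have := near_end ct; apply: filterS => b [cb bt].
  have Ib := inI b cb bt; rewrite high_energy_ge0//=.
  have := high_energy_young q Ib It0 ltr01 (hc b t0 cb bt ct0 t0t).
  rewrite invr1; move: hq; rewrite /high_energy.
  by move: (vform _ (u b) _) (vform _ (u t0) _) => x y; lra.
rewrite ger0_norm.
  by apply: limr_le; [exact: high_energy_lim|apply: filterS nb => b /andP[]].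
by apply: limr_ge; [exact: high_energy_lim|apply: filterS nb => b /andP[]].
Qed.

Lemma lp_defect_dissipation :
  (forall q, mu.-integrable `[tau / 2, tau[ (EFin \o (fun t => gradform (lp_defect chi q) (u t)))) /\
  (\int[mu]_(t in `[tau / 2, tau[) gradform (lp_defect chi q) (u t)) @[q --> \oo] --> (0 : R).
Proof.
have [_ iG] := energy_bounds tau0 huf.
have c1 t : t \in `[tau / 2, tau[ -> forall i j, torus_cont (partial j (fun x => u t x 0 i)).
  by move=> It i j; have [] := smooth_torus_C1 su i j (half_sub tau0 It).
apply: (int_to_end_dominated (half_lt tau0) _ iG) => [q|q t It|t It].
- exact: (measurable_co (half_gt0 tau0) (gradform_cont su (energy_form_lp_defect chi q))).
- rewrite /= lee_fin ger0_norm.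
    by apply: ler_sum => i _; apply: ler_sum => j _; exact: lp_defect_le.
  by apply: gradform_ge0 => i j; apply: lp_defect_ge0 => //; exact: c1.
- by apply: gradform_lp_defect_cvg0 => //; exact: c1.
Qed.

Lemma flux_cancel (x a w : R) : -1 * a = - x + (- a + w) + (x - w).
Proof. by ring. Qed.

(** The flux through the filter is what the balance of the high frequencies leaves:
their change of energy, their dissipation and the work done on them. *)
Lemma lp_flux_balance q b : tau / 2 <= b -> b < tau ->
  \int[mu]_(t in `[tau / 2, b])
    inner (lowpass chi q (advection (u t))) (lowpass chi q (u t)) =
  2^-1 * (high_energy q b - high_energy q (tau / 2)) +
  (\int[mu]_(t in `[tau / 2, b]) gradform (lp_defect chi q) (u t) -
   \int[mu]_(t in `[tau / 2, b]) vform (lp_defect chi q) (f t) (u t)).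
Proof.
move=> ab bt.
have bal := integrated_energy_balance su sf nse (energy_form_lp_defect chi q) (half_gt0 tau0) ab bt.
rewrite /high_energy bal mulrA mulVf// mul1r.
have -> : \int[mu]_(t in `[tau / 2, b])
    inner (lowpass chi q (advection (u t))) (lowpass chi q (u t)) =
    -1 * \int[mu]_(t in `[tau / 2, b]) vform (lp_defect chi q) (advection (u t)) (u t).
  rewrite -RintegralZl; [|exact: measurable_itv|]; last first.
    exact: (integrable_cc (half_gt0 tau0) bt (cont_advection_form su (energy_form_lp_defect chi q))).
  apply: eq_Rintegral => t; rewrite inE/= => tab.
  have It := itv_cc_sub (half_gt0 tau0) bt tab.
  rewrite inner_lowpass_defect//; last exact: (cont_comp su It); last first.
    by move=> i; exact: (jointly_contl (jointly_cont_advection su i) It).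
  by rewrite (l2form_transport su nse It) sub0r mulN1r.
exact: flux_cancel.
Qed.

Lemma anomalous_dissipation_eq0 : anomalous_dissipation tau chi u = 0%E.
Proof.
have [iW W0] := lp_defect_work tau0 d0 hchi huf hp hf.
have [iG G0] := lp_defect_dissipation.
have E q : int_to_end tau (tau / 2) (fun t =>
     inner (lowpass chi q (advection (u t))) (lowpass chi q (u t))) =
   2^-1 * (lim (high_energy q b @[b --> tau^'-]) - high_energy q (tau / 2)) +
   (\int[mu]_(t in `[tau / 2, tau[) gradform (lp_defect chi q) (u t) -
    \int[mu]_(t in `[tau / 2, tau[) vform (lp_defect chi q) (f t) (u t)).
  have hL := high_energy_lim (q := q).
  have hG := cvg_Rintegral_left (half_lt tau0) (iG q).
  have hW := cvg_Rintegral_left (half_lt tau0) (iW q).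
  apply: cvg_lim => //.
  apply: (cvg_trans _ (cvgD (cvgM (cvg_cst (2^-1 : R))
    (cvgB hL (cvg_cst (high_energy q (tau / 2))))) (cvgB hG hW))); apply: near_eq_cvg.
  have := near_end (half_lt tau0); apply: filterS => b [ab bt].
  by rewrite lp_flux_balance// ltW.
apply: limn_esup_norm0; rewrite (funext E).
have Ia : tau / 2 \in `]0, tau[ by rewrite in_itv/= half_gt0// half_lt.
have Ha := vform_lp_defect_cvg0 d0 hchi (cont_comp su Ia) (cont_comp su Ia).
rewrite -[X in _ --> X](_ : 2^-1 * (0 - 0) + (0 - 0) = 0 :> R); last by rewrite !subr0 mulr0 addr0.
exact: (cvgD (cvgM (cvg_cst (2^-1 : R)) (cvgB high_energy_end_cvg0 Ha)) (cvgB G0 W0)).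
Qed.

End vanishing_dissipation.

End torus_functions.

Theorem theorem1p2 (R : realType) (d : nat) (hd : (3 <= d)%N)
    (tau : R) (htau : 0 < tau)
    (chi : 'rV[R]_d -> R) (hchi : LP_cutoff chi)
    (u f : R -> 'rV[R]_d -> 'rV[R]_d) (huf : class_N tau u f)
    (p : R) (hp : 1 <= p <= 2) (hf : Lp_Hs tau p (- 2 + 2 / p) f) :
  anomalous_work tau chi u f = 0%E /\
  (continuous_L2 tau u ->
   anomalous_dissipation tau chi u = 0%E /\ anomalous_work tau chi u f = 0%E).
Proof.
have d0 : (0 < d)%N by exact: leq_trans hd.
have W : anomalous_work tau chi u f = 0%E := anomalous_work_eq0 htau d0 hchi huf hp hf.
split; first exact: W.
move=> cu; split; last exact: W.
exact: (anomalous_dissipation_eq0 htau d0 hchi huf hp hf cu).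
Qed.
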